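(* Assume that $X$ is of Pareto-type with index $\alpha=1$, i.e. $1-F(x)\sim x^{-1}\ell(x)$ as $x\to\infty$ with $\ell$ slowly varying, that $\mu_1=\infty$, and that the counting process $\{N(t);\,t\geq 0\}$ $\mathcal{D}$-averages in time to the random variable $\Lambda$. Define $(a_t)_{t>0}$ by $\lim_{t\to\infty}t\,a_t^{-1}\ell(a_t)=1$ and $(a^\prime_t)_{t>0}$ by $\lim_{t\to\infty}t\,(a^{\prime}_t)^{-1}\tilde\ell(a^\prime_t)=1$, with $\tilde\ell(x)=\int_0^x\frac{\ell(u)}{u}\,du\in\mathrm{RV}_0$. Then $$\frac{a^\prime_t}{a_t^2}\,C_{N(t)}\stackrel{\mathcal{D}}{\longrightarrow}\frac{U_1}{\Lambda}\quad\text{and}\quad\frac{a^\prime_t}{a_t^2}\,\widehat{\mathrm{D}(X)}\stackrel{\mathcal{D}}{\longrightarrow}\frac{U_1}{\Lambda}\quad\text{as } t\rightarrow\infty,$$ where the joint distribution of the random vector $(U_1,\Lambda)^\prime$ is determined by $$\mathbb{E}\left\{e^{-rU_1-s\Lambda}\right\}=\mathbb{E}\left\{e^{-\sqrt{r\pi}\,\Lambda}\right\},\quad r>0,\ s\geq 0.$$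
   Context: $X$ is a positive random variable with distribution function $F$ and $\mu_\beta:=\mathbb{E}X^\beta\le\infty$; $X_1,X_2,\ldots$ are i.i.d. copies of $X$; $\{N(t);\,t\geq 0\}$ is a counting process (nonnegative integer-valued, nondecreasing in $t$) independent of the $X_i$'s. For fixed $t\ge0$, $C_{N(t)}:=\frac{X_1^2+\cdots+X_{N(t)}^2}{X_1+\cdots+X_{N(t)}}$ if $N(t)\ge1$ and $C_{N(t)}:=0$ otherwise. The sample dispersion based on $X_1,\ldots,X_{N(t)}$ is $\widehat{\mathrm{D}(X)}:=S^2/\overline X$, where $\overline X:=\frac{1}{N(t)}\sum_{i=1}^{N(t)}X_i$ and $S^2:=\frac{1}{N(t)}\sum_{i=1}^{N(t)}(X_i-\overline X)^2$; on $\{N(t)=0\}$ it is set to $0$. $X$ (or $F$) is of Pareto-type with index $\alpha>0$ if $1-F(x)\sim x^{-\alpha}\ell(x)$ as $x\to\infty$ for a slowly varying function $\ell$. $\mathrm{RV}_0$ is the class of slowly varying functions. The counting process $\mathcal{D}$-averages in time to $\Lambda$ if $N(t)/t\stackrel{\mathcal{D}}{\longrightarrow}\Lambda$ (convergence in distribution) as $t\to\infty$, where $\mathbb{P}[\Lambda>0]=1$.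
   Formalization: The transform is taken as E e^{-rU_1-sΛ} = E e^{-sΛ-√(rπ)Λ}: as printed, without sΛ on the right, it contradicts Λ>0 (compare s=0 and s=1). Also a_t and a'_t are required to tend to ∞, since the limit relations alone admit spurious solutions near 0. *)

(* Defs.v *)
From HB Require Import structures.
From mathcomp Require Import all_boot all_order all_algebra.
From mathcomp Require Import all_classical all_reals all_analysis.

Set Implicit Arguments.
Unset Strict Implicit.
Unset Printing Implicit Defensive.

Import Order.TTheory GRing.Theory Num.Theory.
Import numFieldNormedType.Exports.

Local Open Scope classical_set_scope.
Local Open Scope ring_scope.

(* Only the values on ]0, +oo[ matter; positivity is only required near +oo. *)
Definition slowly_varying (R : realType) (l : R -> R) : Prop :=
  [/\ measurable_fun (`]0, +oo[%classic : set R) l,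
      \forall x \near +oo, 0 < l x
    & forall c : R, 0 < c -> l (c * x) / l x @[x --> +oo] --> (1 : R)].

Definition pareto_type (R : realType) (F : R -> R) (alpha : R) (l : R -> R)
    : Prop :=
  slowly_varying l /\
  (1 - F x) / (x `^ (- alpha) * l x) @[x --> +oo] --> (1 : R).

Definition tilde (R : realType) (l : R -> R) (x : R) : R :=
  \int[@lebesgue_measure R]_(u in `]0, x]) (l u / u).

Definition distribution_function (d : measure_display) (T : measurableType d)
    (R : realType) (P : probability T R) (X : {RV P >-> R}) (x : R) : R :=
  fine (cdf X x).

Definition identically_distributed (d : measure_display) (T : measurableType d)
    (R : realType) (P : probability T R) (X Y : {RV P >-> R}) : Prop :=
  forall B : set R, measurable B ->
    distribution P X B = distribution P Y B.

Definition mutually_independent (d : measure_display) (T : measurableType d)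
    (R : realType) (P : probability T R) (X : nat -> {RV P >-> R}) : Prop :=
  forall (J : seq nat) (B : nat -> set R), uniq J ->
    (forall i, measurable (B i)) ->
    (P (\bigcap_(i in [set` J]) (X i @^-1` B i))
      = \prod_(i <- J) P (X i @^-1` B i))%E.

Definition iid_copies (d : measure_display) (T : measurableType d)
    (R : realType) (P : probability T R) (X : {RV P >-> R})
    (Xs : nat -> {RV P >-> R}) : Prop :=
  mutually_independent Xs /\ forall i, identically_distributed (Xs i) X.

Definition sigma_family (d d' : measure_display) (T : measurableType d)
    (T' : measurableType d') (I : Type) (D : set I) (Y : I -> T -> T')
    : set (set T) :=
  <<s \bigcup_(i in D) preimage_set_system [set: T] (Y i) measurable >>.

Definition counting_process (d : measure_display) (T : measurableType d)
    (R : realType) (P : probability T R) (N : R -> {RV P >-> nat}) : Prop :=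
  forall (w : T) (s t : R), 0 <= s -> s <= t -> (N s w <= N t w)%N.

(* The whole process (N t) for t >= 0, not merely each N t, is independent of
   the whole sequence. *)
Definition process_independent (d : measure_display) (T : measurableType d)
    (R : realType) (P : probability T R) (N : R -> {RV P >-> nat})
    (X : nat -> {RV P >-> R}) : Prop :=
  forall A B : set T,
    sigma_family [set t : R | 0 <= t] N A -> sigma_family [set: nat] X B ->
    (P (A `&` B) = P A * P B)%E.

(* Weak convergence as t tends to +oo; the limit may live on another
   probability space. *)
Definition cvg_in_distribution (d d' : measure_display) (T : measurableType d)
    (T' : measurableType d') (R : realType) (P : probability T R)
    (P' : probability T' R) (Y : R -> T -> R) (Z : T' -> R) : Prop :=
  forall f : R -> R, continuous f -> (exists M, forall x, `|f x| <= M) ->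
    ('E_P[f \o Y t])%E @[t --> +oo] --> ('E_P'[f \o Z])%E.

Definition D_averages_in_time (d d' : measure_display) (T : measurableType d)
    (T' : measurableType d') (R : realType) (P : probability T R)
    (P' : probability T' R) (N : R -> {RV P >-> nat}) (Lam : {RV P' >-> R})
    : Prop :=
  P' [set w | 0 < Lam w] = 1%E /\
  cvg_in_distribution P P' (fun t w => (N t w)%:R / t) Lam.

(* In the sample statistics below, x 0, ..., x n.-1 stand for X_1, ..., X_n. *)
Definition C_stat (R : realType) (x : nat -> R) (n : nat) : R :=
  if (0 < n)%N then (\sum_(i < n) x i ^+ 2) / (\sum_(i < n) x i) else 0.

Definition sample_mean (R : realType) (x : nat -> R) (n : nat) : R :=
  (\sum_(i < n) x i) / n%:R.

Definition sample_variance (R : realType) (x : nat -> R) (n : nat) : R :=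
  (\sum_(i < n) (x i - sample_mean x n) ^+ 2) / n%:R.

Definition sample_dispersion (R : realType) (x : nat -> R) (n : nat) : R :=
  if (0 < n)%N then sample_variance x n / sample_mean x n else 0.

(* Main.v *)
Require Import Defs.
From HB Require Import structures.
From mathcomp Require Import all_boot all_order all_algebra.
From mathcomp Require Import all_classical all_reals all_analysis.
From mathcomp Require Import measurable_realfun ring lra.

(** Rescaled, [C_stat] is the ratio of the sum of squares on the scale
    [a t ^+ 2] to the sum of the variables on the scale [a' t].  A square has
    tail of index 1/2, so the first sum behaves like a positive stable variable
    of that index; the second obeys a weak law of large numbers with the
    truncated mean as norming function, and tends to [Lam].  Random summation
    couples both limits through the number of terms.

    The convergence is proved with joint Laplace transforms of the two sums and
    of [N t / t].  For one summand the rate is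
    [t * (1 - E exp (- (r (X / a) ^ 2 + s X / a' + k / t)))
     --> sqrt (r pi) + s + k], which is [joint_rate].  The term [sqrt (r pi)]
    comes from [cvg_quadratic_laplace]: the mean of [1 - exp (- Y ^ 2)] is the
    integral of the tail of [Y] against [2 y exp (- y ^ 2)], the rescaled tail
    tends to [1 / y], and a Gaussian integral remains; small values of [X] are
    controlled by the truncated second moment ([tsquare_bound]).  The term [s]
    comes from the slow variation of the truncated mean ([tmean_sv],
    [cvg_linear_laplace]), itself a consequence of [x * tail x] being negligible
    with respect to the truncated mean ([tail_over_tmean]).  The cross term
    vanishes ([cross_rate]) because [a / a' --> 0] ([a_over_a']).

    By independence the transform of the random sums is the mean of an [N t]-th
    power ([mean_random_prod]), with limit
    [E exp (- (sqrt (r pi) + s + k) Lam)] ([cvg_mean_random_power],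
    [cvg_joint_laplace]).  For [k = 0] this is the transform of [(U, Lam)]
    ([limit_laplace]).  Convergence of the transforms gives convergence in
    distribution of the ratio ([cvg_laplace_ratio]): the values of the transform
    at integers are the mixed moments of a pair in the unit square, and these
    determine limits by Bernstein approximation in two variables
    ([cvg_mean_moments]).

    The norming function [a'] is prescribed through [tilde l].  Since
    [x * tail x] is equivalent to [l x], the integral [tilde l] is equivalent to
    the truncated mean, which is the integral of the tail ([tilde_equiv]); this
    translates the norming condition and shows that [tilde l] varies slowly
    ([tilde_slowly_varying]).

    The dispersion is [C_stat] minus the sample mean ([dispersion_C_stat]).  The
    sample mean, rescaled, is the product of [a' ^ 2 / (t a ^ 2)], which tends
    to 0 ([a'_sq_over]), and of a ratio of two of the three normalized
    quantities above, which is tight ([cvg_linear_over_count]); such a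
    perturbation does not change the limit ([cvg_mean_dist_perturb]). *)

Set Implicit Arguments.
Unset Strict Implicit.

Import Order.TTheory GRing.Theory Num.Theory.
Import numFieldNormedType.Exports.

Local Open Scope classical_set_scope.
Local Open Scope ring_scope.

(** * Expectations of bounded random variables *)

Definition bounded_mfun {d} {T : measurableType d} {R : realType}
    (f : T -> R) : Prop :=
  measurable_fun [set: T] f /\ exists M, forall x, `|f x| <= M.

Section bounded_expectations.
Context {d} {T : measurableType d} {R : realType} (P : probability T R).
Implicit Types f g h : T -> R.

Lemma bounded_mfun_integrable f :
  bounded_mfun f -> P.-integrable [set: T] (EFin \o f).
Proof.
move=> [mf [M fM]]; apply: measurable_bounded_integrable => //.
  by rewrite (le_lt_trans (probability_le1 _ _))// ltry.
by exists M; split; rewrite ?num_real// => y My x _; exact: le_trans (ltW My).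
Qed.

Lemma bounded_mfun_cst (c : R) : bounded_mfun (fun _ : T => c).
Proof. by split; [exact: measurable_cst|exists `|c|]. Qed.

Lemma bounded_mfunD f g :
  bounded_mfun f -> bounded_mfun g -> bounded_mfun (fun x => f x + g x).
Proof.
move=> [mf [M fM]] [mg [M' gM]]; split; first exact: measurable_funD.
by exists (M + M') => x; rewrite (le_trans (ler_normD _ _))// lerD.
Qed.

Lemma bounded_mfunB f g :
  bounded_mfun f -> bounded_mfun g -> bounded_mfun (fun x => f x - g x).
Proof.
move=> [mf [M fM]] [mg [M' gM]]; split; first exact: measurable_funB.
by exists (M + M') => x; rewrite (le_trans (ler_normB _ _))// lerD.
Qed.

Lemma bounded_mfunM f g :
  bounded_mfun f -> bounded_mfun g -> bounded_mfun (fun x => f x * g x).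
Proof.
move=> [mf [M fM]] [mg [M' gM]]; split; first exact: measurable_funM.
by exists (M * M') => x; rewrite normrM ler_pM.
Qed.

Lemma bounded_mfunX f n : bounded_mfun f -> bounded_mfun (fun x => f x ^+ n).
Proof.
move=> [mf [M fM]]; split; first exact: measurable_funX.
by exists (M ^+ n) => x; rewrite normrX lerXn2r ?nnegrE ?(le_trans _ (fM x)).
Qed.

Lemma bounded_mfun_indic (A : set T) : measurable A ->
  bounded_mfun (\1_A : T -> R).
Proof.
move=> mA; split; first exact: measurable_indic.
by exists 1 => x; rewrite indicE ger0_norm ?ler0n// lern1 leq_b1.
Qed.

Lemma bounded_mfun01 f : measurable_fun setT f ->
  (forall x, 0 <= f x <= 1) -> bounded_mfun f.
Proof.
move=> mf f01; split => //; exists 1 => x.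
by have /andP[f0 f1] := f01 x; rewrite ger0_norm.
Qed.

Lemma mean_cst (c : R) : \int[P]_x c = c.
Proof.
rewrite Rintegral_cst// -[RHS]mulr1; congr (_ * _).
exact: (congr1 fine (probability_setT P)).
Qed.

Lemma meanD f g : bounded_mfun f -> bounded_mfun g ->
  \int[P]_x (f x + g x) = \int[P]_x f x + \int[P]_x g x.
Proof. by move=> ? ?; rewrite RintegralD//; exact: bounded_mfun_integrable. Qed.

Lemma meanB f g : bounded_mfun f -> bounded_mfun g ->
  \int[P]_x (f x - g x) = \int[P]_x f x - \int[P]_x g x.
Proof. by move=> ? ?; rewrite RintegralB//; exact: bounded_mfun_integrable. Qed.

Lemma meanZ (c : R) f : bounded_mfun f ->
  \int[P]_x (c * f x) = c * \int[P]_x f x.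
Proof. by move=> ?; rewrite RintegralZl//; exact: bounded_mfun_integrable. Qed.

Lemma le_mean f g : bounded_mfun f -> bounded_mfun g ->
  (forall x, f x <= g x) -> \int[P]_x f x <= \int[P]_x g x.
Proof.
by move=> ? ? fg; rewrite le_Rintegral//; exact: bounded_mfun_integrable.
Qed.

Lemma mean_dist f g h : bounded_mfun f -> bounded_mfun g -> bounded_mfun h ->
  (forall x, `|f x - g x| <= h x) ->
  `|\int[P]_x f x - \int[P]_x g x| <= \int[P]_x h x.
Proof.
move=> bf bg bh fgh; rewrite -meanB// ler_norml -(mulN1r (Rintegral _ _ h)).
rewrite -meanZ//; apply/andP; split; apply: le_mean => //.
- by apply: bounded_mfunM => //; exact: bounded_mfun_cst.
- exact: bounded_mfunB.
- by move=> x; have := fgh x; rewrite ler_norml mulN1r => /andP[].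
- exact: bounded_mfunB.
- by move=> x; have := fgh x; rewrite ler_norml => /andP[].
Qed.

Lemma mean01 f : bounded_mfun f -> (forall x, 0 <= f x <= 1) ->
  0 <= \int[P]_x f x <= 1.
Proof.
move=> bf f01; apply/andP; split.
- rewrite -[X in X <= _](mean_cst 0); apply: le_mean => //.
    exact: bounded_mfun_cst.
  by move=> x; have /andP[] := f01 x.
- rewrite -[X in _ <= X](mean_cst 1); apply: le_mean => //.
    exact: bounded_mfun_cst.
  by move=> x; have /andP[] := f01 x.
Qed.

Lemma mean_ae_eq f g : measurable_fun setT f -> measurable_fun setT g ->
  {ae P, forall x, f x = g x} -> \int[P]_x f x = \int[P]_x g x.
Proof.
move=> mf mg fg; congr fine; apply: ae_eq_integral => //.
- exact/measurable_EFinP.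
- exact/measurable_EFinP.
- by apply: filterS fg => x -> _.
Qed.

Lemma mean_expectation f : bounded_mfun f ->
  ('E_P[f] = (\int[P]_x f x)%:E)%E.
Proof.
move=> bf; rewrite unlock /Rintegral fineK//.
by apply: integrable_fin_num => //; exact: bounded_mfun_integrable.
Qed.

End bounded_expectations.

Section cvg_mean.
Context {d d'} {T : measurableType d} {T' : measurableType d'} {R : realType}.
Context {P : probability T R} {P' : probability T' R}.
Context {I : Type} {F : set_system I} {FF : ProperFilter F}.

(** The three-epsilon argument behind every passage to the limit below: the
    approximations [g] have convergent means, and the means of the errors [h]
    are asymptotically small. *)
Lemma cvg_mean_approx (f : I -> T -> R) (f0 : T' -> R) :
  (forall t, bounded_mfun (f t)) -> bounded_mfun f0 ->
  (forall e, 0 < e -> exists g : I -> T -> R, exists h : I -> T -> R,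
     exists g0 : T' -> R, exists h0 : T' -> R,
   [/\ [/\ forall t, bounded_mfun (g t), forall t, bounded_mfun (h t),
           bounded_mfun g0 & bounded_mfun h0],
       \forall t \near F, forall x, `|f t x - g t x| <= h t x,
       forall x, `|f0 x - g0 x| <= h0 x,
       \int[P]_x g t x @[t --> F] --> \int[P']_x g0 x
     & \int[P]_x h t x @[t --> F] --> \int[P']_x h0 x /\ \int[P']_x h0 x < e]) ->
  \int[P]_x f t x @[t --> F] --> \int[P']_x f0 x.
Proof.
move=> bf bf0 H; apply/cvgrPdist_lt => e e0.
have [|g [h [g0 [h0 [[bg bh bg0 bh0] fg fg0 cg [ch he]]]]]] := H (e / 3).
  by rewrite divr_gt0.
have e3 : 0 < e / 3 by rewrite divr_gt0.
move/cvgrPdist_lt : cg => /(_ _ e3) cg.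
move/cvgr_lt : ch => /(_ _ he) ch.
near=> t.
have A : `|\int[P]_x f t x - \int[P]_x g t x| <= \int[P]_x h t x.
  by apply: mean_dist => //; near: t.
have B : `|\int[P']_x f0 x - \int[P']_x g0 x| <= \int[P']_x h0 x.
  exact: mean_dist.
have C : `|\int[P']_x g0 x - \int[P]_x g t x| < e / 3 by near: t.
have D : \int[P]_x h t x < e / 3 by near: t.
have := ler_distD (\int[P']_x g0 x) (\int[P']_x f0 x) (\int[P]_x f t x).
have := ler_distD (\int[P]_x g t x) (\int[P']_x g0 x) (\int[P]_x f t x).
rewrite (distrC (Rintegral P setT (g t))).
move: A B C D he; set a := `| _ |; set b := `| _ |; set c := `| _ |.
lra.
Unshelve. all: by end_near. Qed.

End cvg_mean.

Section bounded_convergence.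
Context {d} {T : measurableType d} {R : realType} (P : probability T R).

Lemma bounded_cvg_mean (f : nat -> T -> R) (f0 : T -> R) (K : R) :
  (forall n, measurable_fun [set: T] (f n)) -> measurable_fun [set: T] f0 ->
  (forall n x, `|f n x| <= K) ->
  {ae P, forall x, f n x @[n --> \oo] --> f0 x} ->
  \int[P]_x f n x @[n --> \oo] --> \int[P]_x f0 x.
Proof.
move=> mf mf0 fK ff0; apply: fine_cvg.
have [|||||i0 _ ] := @dominated_convergence _ T R P setT measurableT
    (fun n x => (f n x)%:E) (fun x => (f0 x)%:E) (fun=> K%:E).
- by move=> n; exact/measurable_EFinP.
- exact/measurable_EFinP.
- by apply: filterS ff0 => x h _; apply: cvg_EFin => //; exact: nearW.
- exact: (bounded_mfun_integrable P (bounded_mfun_cst (T := T) K)).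
- by apply: aeW => x n _; rewrite lee_fin.
- by rewrite /Rintegral fineK//; exact: integrable_fin_num.
Qed.

End bounded_convergence.

(** Inversion is discontinuous at 0, but it is everywhere the pointwise limit
    of the continuous functions [x / (x ^+ 2 + 1 / n)]. *)
Lemma measurable_inv (R : realType) : measurable_fun [set: R] (@GRing.inv R).
Proof.
pose h n (x : R) : R := x / (x ^+ 2 + n.+1%:R^-1).
have h0 n (x : R) : x ^+ 2 + n.+1%:R^-1 != 0.
  by rewrite gt_eqF// ltr_wpDl ?sqr_ge0// invr_gt0.
apply: (@measurable_fun_cvg _ _ _ _ h) => [n|x _].
  apply: continuous_measurable_fun => x.
  apply: cvgM; first exact: cvg_id.
  apply: cvgV; first exact: h0.
  by apply: cvgD; [exact: exprn_continuous|exact: cvg_cst].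
have [->|x0] := eqVneq x 0.
  rewrite invr0 (_ : h ^~ 0 = fun=> 0); first exact: cvg_cst.
  by apply/funext => n; rewrite /h mul0r.
rewrite (_ : x^-1 = x / (x ^+ 2 + 0)); last first.
  by rewrite addr0 expr2 invfM mulrA divff// mul1r.
apply: cvgM; first exact: cvg_cst.
apply: cvgV; first by rewrite addr0 expf_neq0.
by apply: cvgD; [exact: cvg_cst|exact: cvg_harmonic].
Qed.

Lemma measurable_fun_div d (T : measurableType d) (R : realType)
    (f g : T -> R) : measurable_fun setT f -> measurable_fun setT g ->
  measurable_fun setT (fun w => f w / g w).
Proof.
move=> mf mg; apply: measurable_funM => //.
by apply: (measurableT_comp (@measurable_inv R) mg).
Qed.

(** * Bernstein approximation on the unit square *)

Section bernstein.
Context {R : realType}.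
Implicit Types (f g : nat -> R) (x y : R).

(** The mean of [f] at a binomial variable with parameters [n] and [x], by
    conditioning on the first trial; no binomial coefficient appears. *)
Fixpoint bernstein n f x : R :=
  if n is m.+1 then
    x * bernstein m (fun i => f i.+1) x + (1 - x) * bernstein m f x
  else f 0%N.

Lemma bernsteinD n f g x :
  bernstein n (fun i => f i + g i) x = bernstein n f x + bernstein n g x.
Proof. by elim: n f g => //= n IH f g; rewrite !IH; ring. Qed.

Lemma bernsteinZ n (c : R) f x :
  bernstein n (fun i => c * f i) x = c * bernstein n f x.
Proof. by elim: n f => //= n IH f; rewrite !IH; ring. Qed.

Lemma bernstein_cst n (c : R) x : bernstein n (fun=> c) x = c.
Proof. by elim: n => //= n IH; rewrite !IH; ring. Qed.

Lemma bernstein_le n f g x : 0 <= x <= 1 ->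
  (forall i, (i <= n)%N -> f i <= g i) -> bernstein n f x <= bernstein n g x.
Proof.
move=> x01; have /andP[x0 x1] := x01.
elim: n f g => /= [f g fg|n IH f g fg]; first exact: fg.
apply: lerD; apply: ler_wpM2l; rewrite ?subr_ge0//; apply: IH => i ni.
  exact: fg.
exact/fg/leqW.
Qed.

Lemma bernstein_variance n (c : R) x :
  bernstein n (fun i => (i%:R - c) ^+ 2) x
  = n%:R * (x * (1 - x)) + (n%:R * x - c) ^+ 2.
Proof.
elim: n c => /= [c|n IH c]; first by ring.
have -> : (fun i => (i.+1%:R - c) ^+ 2) = (fun i => (i%:R - (c - 1)) ^+ 2).
  by apply/funext => i; rewrite -natr1; congr (_ ^+ 2); ring.
by rewrite !IH -natr1; ring.
Qed.

(** Chebyshev's argument: a function within [e] of [v], up to a quadratic error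
    that the variance of the binomial variable absorbs, has its Bernstein mean
    close to [v]. *)
Lemma bernstein_approx n f x (v e C : R) : 0 <= x <= 1 -> 0 <= C ->
  (forall i, (i <= n.+1)%N ->
     `|v - f i| <= e + C * (i%:R / n.+1%:R - x) ^+ 2) ->
  `|v - bernstein n.+1 f x| <= e + C / n.+1%:R.
Proof.
move=> x01 C0 fv; set N := n.+1 in fv *; have N0 : 0 < N%:R :> R by rewrite ltr0n.
have /andP[x0 x1] := x01.
pose h i : R := e + (C / N%:R ^+ 2) * (i%:R - N%:R * x) ^+ 2.
have hE i : e + C * (i%:R / N%:R - x) ^+ 2 = h i.
  by rewrite /h; field; rewrite gt_eqF.
have Bh : bernstein N h x <= e + C / N%:R.
  rewrite bernsteinD bernstein_cst bernsteinZ bernstein_variance subrr expr0n.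
  rewrite addr0 lerD2l.
  have -> : C / N%:R ^+ 2 * (N%:R * (x * (1 - x))) = C / N%:R * (x * (1 - x)).
    by field; rewrite gt_eqF.
  by apply: ler_piMr; [rewrite divr_ge0// ltW|nra].
rewrite ler_distlC; apply/andP; split.
- rewrite lerBlDl -lerBlDr; apply: le_trans Bh.
  rewrite -[v](bernstein_cst N v x) -mulN1r -bernsteinZ -bernsteinD.
  apply: bernstein_le => // i iN; have := fv i iN.
  by rewrite hE ler_norml => /andP[_]; rewrite mulN1r.
- rewrite -lerBlDl; apply: le_trans Bh.
  rewrite -[v](bernstein_cst N v x) -mulN1r -bernsteinZ -bernsteinD.
  apply: bernstein_le => // i iN; have := fv i iN.
  by rewrite hE distrC ler_norml => /andP[_]; rewrite mulN1r.
Qed.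

Lemma compact_uniform_continuous (V : normedModType R) (K : set V)
    (f : V -> R) : compact K -> continuous f ->
  forall e : R, 0 < e -> exists2 r : R, 0 < r &
    forall u v, K u -> `|u - v| < r -> `|f u - f v| < e.
Proof.
move=> /compact_near_coveringP cK cf e e0.
have : \forall r \near 0^'+, K `<=`
    [set u | forall v, `|u - v| < r -> `|f u - f v| < e].
  apply: cK => u Ku.
  have e2 : 0 < e / 2 by rewrite divr_gt0.
  have /cvgrPdist_lt /(_ _ e2) /nbhs_ballP [s /= s0 fs] := cf u.
  have s2 : 0 < s / 2 by rewrite divr_gt0.
  exists (ball u (s / 2), [set r : R | r < s / 2]).
    split => /=; first exact: nbhsx_ballx.
    exact: nbhs_right_lt.
  move=> [w r] /= [uw rs] v wv.
  have h1 : `|f u - f w| < e / 2.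
    apply: fs; rewrite -ball_normE/= in uw *.
    by apply: lt_trans uw _; lra.
  have h2 : `|f u - f v| < e / 2.
    apply: fs; rewrite -ball_normE/= in uw *.
    apply: le_lt_trans (ler_distD w u v) _; rewrite [s]splitr ltrD//.
    exact: lt_trans rs.
  apply: le_lt_trans (ler_distD (f u) (f w) (f v)) _.
  by rewrite [e]splitr distrC ltrD.
move=> H; near (0 : R)^'+ => r; exists r => //.
by move=> u v Ku; move: u Ku v; near: r.
Unshelve. all: by end_near. Qed.

(** A modulus of continuity in the form required by Chebyshev's argument: points
    that are not close contribute at most a multiple of their squared
    distance. *)
Lemma unit_square_modulus (H : R * R -> R) : continuous H ->
  forall e : R, 0 < e -> exists2 C : R, 0 <= C & forall x y x' y',
    0 <= x <= 1 -> 0 <= y <= 1 -> 0 <= x' <= 1 -> 0 <= y' <= 1 ->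
    `|H (x, y) - H (x', y')| <= e + C * ((x' - x) ^+ 2 + (y' - y) ^+ 2).
Proof.
move=> cH e e0; pose K : set (R * R) := `[0, 1] `*` `[0, 1].
have cK : compact K by apply: compact_setX; exact: segment_compact.
have KE x y : K (x, y) = ((0 <= x <= 1) /\ (0 <= y <= 1)) :> Prop.
  by rewrite /K /setX/= !in_itv.
have [r r0 Hr] := compact_uniform_continuous cK cH e0.
have [M M0 HM] : exists2 M, 0 <= M & forall z, K z -> `|H z| <= M.
  have : bounded_set (H @` K).
    apply: compact_bounded; apply: continuous_compact => //.
    exact: continuous_subspaceT.
  case=> M [_ HM]; exists (`|M| + 1); first by rewrite addr_ge0.
  by move=> z Kz; apply: (HM (`|M| + 1)); [rewrite ltr_pwDr// ler_norm|exists z].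
exists (2 * M / r ^+ 2); first by apply: divr_ge0; [exact: mulr_ge0|exact: sqr_ge0].
move=> x y x' y' hx hy hx' hy'.
have Kz : K (x, y) by rewrite KE.
have Kz' : K (x', y') by rewrite KE.
have sq0 : 0 <= (x' - x) ^+ 2 + (y' - y) ^+ 2 by rewrite addr_ge0 ?sqr_ge0.
have C0 : 0 <= 2 * M / r ^+ 2 by apply: divr_ge0; [exact: mulr_ge0|exact: sqr_ge0].
have [near|far] := ltP `|(x, y) - (x', y')| r.
  apply: (le_trans (ltW (Hr _ _ Kz near))).
  by rewrite lerDl mulr_ge0.
have far2 : r ^+ 2 <= (x' - x) ^+ 2 + (y' - y) ^+ 2.
  move: far; rewrite prod_normE/= le_max => /orP[] h.
    apply: (@le_trans _ _ ((x' - x) ^+ 2)); last by rewrite lerDl sqr_ge0.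
    by rewrite -(real_normK (num_real (x' - x))) distrC lerXn2r// nnegrE ltW.
  apply: (@le_trans _ _ ((y' - y) ^+ 2)); last by rewrite lerDr sqr_ge0.
  by rewrite -(real_normK (num_real (y' - y))) distrC lerXn2r// nnegrE ltW.
apply: (@le_trans _ _ (2 * M)).
  rewrite (le_trans (ler_normB _ _))// mulr_natl mulr2n.
  by rewrite lerD ?HM.
rewrite -[X in X <= _]add0r lerD ?(ltW e0)//.
by rewrite mulrAC ler_pdivlMr ?exprn_gt0// ler_wpM2l// mulr_ge0.
Qed.

Lemma bernstein_unit_square (H : R * R -> R) : continuous H ->
  forall e : R, 0 < e -> exists n, forall x y, 0 <= x <= 1 -> 0 <= y <= 1 ->
    `|H (x, y) - bernstein n.+1 (fun i => bernstein n.+1 (fun j =>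
         H (i%:R / n.+1%:R, j%:R / n.+1%:R)) y) x| <= e.
Proof.
move=> cH e e0; have e2 : 0 < e / 2 by rewrite divr_gt0.
have [C C0 HC] := unit_square_modulus cH e2.
have [n nC] : exists n, C / n.+1%:R <= e / 4.
  near \oo => n; exists n.
  rewrite ler_pdivrMr ?ltr0n// mulrC -ler_pdivrMr ?divr_gt0//.
  apply: (@le_trans _ _ n%:R); last by rewrite ler_nat.
  by near: n; exact: nbhs_infty_ger.
exists n => x y x01 y01.
have in01 i : (i <= n.+1)%N -> 0 <= (i%:R / n.+1%:R : R) <= 1.
  move=> ?; rewrite divr_ge0//= ler_pdivrMr ?ltr0n// mul1r ler_nat//.
apply: (@le_trans _ _ (e / 2 + C / n.+1%:R + C / n.+1%:R)); last first.
  by move: nC; set q := C / _; lra.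
apply: bernstein_approx => // i iN.
rewrite addrAC.
apply: (@bernstein_approx n _ y _ (e / 2 + C * (i%:R / n.+1%:R - x) ^+ 2) C)
  => // j jN.
rewrite -addrA -mulrDr; apply: HC => //; exact: in01.
Unshelve. all: by end_near. Qed.

End bernstein.

Section cvg_mean_moments.
Context {d d'} {T : measurableType d} {T' : measurableType d'} {R : realType}.
Context (P : probability T R) (P' : probability T' R).
Context {I : Type} (F : set_system I) {FF : ProperFilter F}.

Definition cvg_bounded_mean (f : I -> T -> R) (f0 : T' -> R) : Prop :=
  [/\ forall t, bounded_mfun (f t), bounded_mfun f0
    & \int[P]_w f t w @[t --> F] --> \int[P']_w f0 w].

Lemma eq_cvg_bounded_mean f g f0 g0 : (forall t w, f t w = g t w) ->
  (forall w, f0 w = g0 w) -> cvg_bounded_mean f f0 -> cvg_bounded_mean g g0.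
Proof.
move=> fg fg0; have -> : g = f.
  by apply/funext => t; apply/funext => w; rewrite fg.
by have -> // : g0 = f0; apply/funext => w; rewrite fg0.
Qed.

Lemma cvg_bounded_meanD f g f0 g0 :
  cvg_bounded_mean f f0 -> cvg_bounded_mean g g0 ->
  cvg_bounded_mean (fun t w => f t w + g t w) (fun w => f0 w + g0 w).
Proof.
move=> [bf bf0 cf] [bg bg0 cg]; split => [t||].
- exact: bounded_mfunD.
- exact: bounded_mfunD.
- rewrite meanD//; under eq_fun do rewrite meanD//.
  exact: cvgD.
Qed.

Lemma cvg_bounded_meanZ (c : R) f f0 : cvg_bounded_mean f f0 ->
  cvg_bounded_mean (fun t w => c * f t w) (fun w => c * f0 w).
Proof.
move=> [bf bf0 cf]; split => [t||].
- by apply: bounded_mfunM => //; exact: bounded_mfun_cst.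
- by apply: bounded_mfunM => //; exact: bounded_mfun_cst.
- rewrite meanZ//; under eq_fun do rewrite meanZ//.
  by apply: cvgM => //; exact: cvg_cst.
Qed.

Lemma cvg_bounded_mean_bernstein u u0 n (h : nat -> I -> T -> R)
    (h0 : nat -> T' -> R) :
  (forall i a, cvg_bounded_mean (fun t w => u t w ^+ a * h i t w)
                                (fun w => u0 w ^+ a * h0 i w)) ->
  forall a, cvg_bounded_mean
    (fun t w => u t w ^+ a * bernstein n (fun i => h i t w) (u t w))
    (fun w => u0 w ^+ a * bernstein n (fun i => h0 i w) (u0 w)).
Proof.
elim: n h h0 => /= [h h0 H a|n IH h h0 H a]; first exact: H.
have IHS := IH (fun i => h i.+1) (fun i => h0 i.+1) (fun i => H i.+1).
have := cvg_bounded_meanD (cvg_bounded_meanD (IHS a.+1) (IH _ _ H a))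
  (cvg_bounded_meanZ (-1) (IH _ _ H a.+1)).
by apply: eq_cvg_bounded_mean => [t w|w]; rewrite !exprS; ring.
Qed.

(** Moments determine limits of bounded pairs: the mean of a continuous
    function of a pair with values in the unit square is, up to a uniformly
    small error, a combination of finitely many mixed moments. *)
Lemma cvg_mean_moments (x y : I -> T -> R) (x0 y0 : T' -> R) :
  (forall t w, 0 <= x t w <= 1) -> (forall t w, 0 <= y t w <= 1) ->
  (forall w, 0 <= x0 w <= 1) -> (forall w, 0 <= y0 w <= 1) ->
  (forall a b : nat, cvg_bounded_mean (fun t w => x t w ^+ a * y t w ^+ b)
                                      (fun w => x0 w ^+ a * y0 w ^+ b)) ->
  forall H : R * R -> R, continuous H ->
  (forall t, bounded_mfun (fun w => H (x t w, y t w))) ->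
  bounded_mfun (fun w => H (x0 w, y0 w)) ->
  \int[P]_w H (x t w, y t w) @[t --> F] --> \int[P']_w H (x0 w, y0 w).
Proof.
move=> x01 y01 x001 y001 mom H cH bH bH0; apply: cvg_mean_approx => //.
move=> e e0; have e2 : 0 < e / 2 by rewrite divr_gt0.
have [n Hn] := bernstein_unit_square cH e2.
pose c i j : R := H (i%:R / n.+1%:R, j%:R / n.+1%:R).
have inner i a : cvg_bounded_mean
    (fun t w => x t w ^+ a * bernstein n.+1 (c i) (y t w))
    (fun w => x0 w ^+ a * bernstein n.+1 (c i) (y0 w)).
  apply: (@eq_cvg_bounded_mean
      (fun t w => y t w ^+ 0 * bernstein n.+1 (fun j => x t w ^+ a * c i j) (y t w)) _
      (fun w => y0 w ^+ 0 * bernstein n.+1 (fun j => x0 w ^+ a * c i j) (y0 w))).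
  - by move=> t w; rewrite expr0 mul1r bernsteinZ.
  - by move=> w; rewrite expr0 mul1r bernsteinZ.
  apply: (@cvg_bounded_mean_bernstein y y0 n.+1 (fun j t w => x t w ^+ a * c i j)
    (fun j w => x0 w ^+ a * c i j)) => j b.
  by apply: eq_cvg_bounded_mean (cvg_bounded_meanZ (c i j) (mom a b))
    => [t w|w]; ring.
have [bB bB0 cB] : cvg_bounded_mean
    (fun t w => bernstein n.+1 (fun i => bernstein n.+1 (c i) (y t w)) (x t w))
    (fun w => bernstein n.+1 (fun i => bernstein n.+1 (c i) (y0 w)) (x0 w)).
  apply: eq_cvg_bounded_mean (cvg_bounded_mean_bernstein n.+1 inner 0%N)
    => [t w|w]; by rewrite expr0 mul1r.
exists (fun t w => bernstein n.+1 (fun i => bernstein n.+1 (c i) (y t w)) (x t w)).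
exists (fun _ _ => e / 2).
exists (fun w => bernstein n.+1 (fun i => bernstein n.+1 (c i) (y0 w)) (x0 w)).
exists (fun _ => e / 2); split => //.
- by split => // *; exact: bounded_mfun_cst.
- by apply: nearW => t w; exact: Hn.
- by move=> w; exact: Hn.
- rewrite !mean_cst; split; last by rewrite [ltRHS]splitr ltrDl.
  exact: cvg_cst.
Qed.

End cvg_mean_moments.

(** * Convergence in distribution of ratios and perturbed variables *)

Section convergence_in_distribution.
Context {d d'} {T : measurableType d} {T' : measurableType d'} {R : realType}.
Context (P : probability T R) (P' : probability T' R).
Context {I : Type} (F : set_system I) {FF : ProperFilter F}.

Definition cvg_mean_dist (Y : I -> T -> R) (Z : T' -> R) : Prop :=
  forall f : R -> R, continuous f -> (exists M, forall x, `|f x| <= M) ->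
    \int[P]_w f (Y t w) @[t --> F] --> \int[P']_w f (Z w).

Lemma bounded_mfun_continuous {d1} {T1 : measurableType d1} (f : R -> R)
    (Y : T1 -> R) : continuous f -> (exists M, forall x, `|f x| <= M) ->
  measurable_fun setT Y -> bounded_mfun (fun w => f (Y w)).
Proof.
move=> cf [M fM] mY; split; last by exists M => w; exact: fM.
by apply: measurableT_comp => //; exact: continuous_measurable_fun.
Qed.

(** A function of [(expR (- v), expR (- w))] that is continuous on the whole plane
    and equals [f (v / w)] when [v <= M] and [M^-1 <= w <= M]. *)
Definition ratio_cutoff (f : R -> R) (M : R) (z : R * R) : R :=
  f (ln (Num.max z.1 (expR (- M))) /
     ln (Num.max (Num.min z.2 (expR (- M^-1))) (expR (- M)))).

Lemma continuous_ratio_cutoff (f : R -> R) (M : R) : continuous f -> 1 <= M ->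
  continuous (ratio_cutoff f M).
Proof.
move=> cf M1 z; have M0 : 0 < M by exact: lt_le_trans M1.
apply: continuous_comp; last exact: cf.
have e0 : 0 < expR (- M) := expR_gt0 _.
have lt1 u : Num.max (Num.min u (expR (- M^-1))) (expR (- M)) < 1.
  rewrite gt_max gt_min !expR_lt1 !oppr_lt0 invr_gt0 M0 orbT//.
apply: cvgM.
  apply: continuous_comp.
    apply: continuous_max; [exact: cvg_fst|exact: cvg_cst].
  by apply: continuous_ln; rewrite lt_max e0 orbT.
apply: cvgV.
  by rewrite lt_eqF// -ln1 ltr_ln ?posrE ?lt1// lt_max e0 orbT.
apply: continuous_comp; last first.
  by apply: continuous_ln; rewrite lt_max e0 orbT.
apply: continuous_max; last exact: cvg_cst.
by apply: continuous_min; [exact: cvg_snd|exact: cvg_cst].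
Qed.

Lemma ratio_cutoffE (f : R -> R) (M v w : R) : 1 <= M -> v <= M ->
  M^-1 <= w <= M -> ratio_cutoff f M (expR (- v), expR (- w)) = f (v / w).
Proof.
move=> M1 vM /andP[Mw wM]; rewrite /ratio_cutoff/=.
have -> : Num.max (expR (- v)) (expR (- M)) = expR (- v).
  by apply/max_idPl; rewrite ler_expR lerN2.
have -> : Num.min (expR (- w)) (expR (- M^-1)) = expR (- w).
  by apply/min_idPl; rewrite ler_expR lerN2.
have -> : Num.max (expR (- w)) (expR (- M)) = expR (- w).
  by apply/max_idPl; rewrite ler_expR lerN2.
by rewrite !expRK invrN mulrNN.
Qed.

(** Exponential functionals dominate the indicator of the complement of the
    box on which the cutoff is exact, so that the error is controlled by the
    same Laplace transforms as the limit. *)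
Lemma ratio_cutoff_dist (f : R -> R) (K M v w : R) : 1 <= M ->
  (forall x, `|f x| <= K) -> 0 <= v -> 0 <= w ->
  `|f (v / w) - ratio_cutoff f M (expR (- v), expR (- w))| <=
    2 * K * expR 1 * ((1 - expR (- (M^-1 * v))) + (1 - expR (- (M^-1 * w)))
                      + expR (- (M * w))).
Proof.
move=> M1 fK v0 w0; have M0 : 0 < M by exact: lt_le_trans M1.
have K0 : 0 <= K := le_trans (normr_ge0 _) (fK 0).
have e2 : 2 <= expR 1 :> R by have := @expR_ge1Dx R 1; lra.
have tail (u : R) : M < u -> 1 <= expR 1 * (1 - expR (- (M^-1 * u))).
  move=> Mu; have h : expR (- (M^-1 * u)) <= expR (- 1).
    by rewrite ler_expR lerN2 mulrC ler_pdivlMr// mul1r ltW.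
  have : expR 1 * expR (- (M^-1 * u)) <= 1.
    apply: (@le_trans _ _ (expR 1 * expR (- 1))).
      by rewrite ler_wpM2l// expR_ge0.
    by rewrite -expRD subrr expR0.
  by lra.
have le1 (u : R) : 0 <= u -> 0 <= expR 1 * (1 - expR (- (M^-1 * u))).
  move=> u0; rewrite mulr_ge0 ?expR_ge0// subr_ge0 -expR0 ler_expR oppr_le0.
  by rewrite mulr_ge0// invr_ge0 ltW.
have ex0 : 0 <= expR 1 * expR (- (M * w)) by rewrite mulr_ge0// expR_ge0.
have h1 := le1 _ v0; have h2 := le1 _ w0.
set D := `| _ |; set B := (X in _ <= 2 * K * _ * X).
have crude : 1 <= expR 1 * B -> D <= 2 * K * expR 1 * B.
  move=> h; apply: (@le_trans _ _ (2 * K)).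
    by rewrite (le_trans (ler_normB _ _))// mulr_natl mulr2n lerD ?fK.
  by rewrite -mulrA ler_peMr// mulr_ge0.
have [vM|vM] := ltP M v.
  by apply: crude; have := tail _ vM; rewrite /B !mulrDr; lra.
have [wM|wM] := ltP M w.
  by apply: crude; have := tail _ wM; rewrite /B !mulrDr; lra.
have [Mw|Mw] := ltP w M^-1.
  apply: crude; have : 1 <= expR 1 * expR (- (M * w)).
    rewrite -expRD -[X in X <= _]expR0 ler_expR subr_ge0.
    by rewrite -ler_pdivlMl// mulr1 ltW.
  by rewrite /B !mulrDr; lra.
rewrite /D ratio_cutoffE ?Mw//= subrr normr0 -mulrA.
by apply: mulr_ge0; [exact: mulr_ge0|rewrite /B !mulrDr; lra].
Qed.

(** The ratio is a function of the exponentials of the pair, whose mixed moments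
    are values of the joint Laplace transform; this function is continuous
    except where the numerator or the denominator escapes to infinity or the
    denominator vanishes, and the positivity of [L] makes these regions
    negligible in the limit. *)
Lemma cvg_laplace_ratio (V W : I -> T -> R) (U L : T' -> R) :
  (forall t, measurable_fun setT (V t)) ->
  (forall t, measurable_fun setT (W t)) ->
  measurable_fun setT U -> measurable_fun setT L ->
  (forall t w, 0 <= V t w) -> (forall t w, 0 <= W t w) ->
  (forall w, 0 <= U w) -> (forall w, 0 <= L w) ->
  {ae P', forall w, 0 < L w} ->
  (forall r s, 0 <= r -> 0 <= s ->
     \int[P]_w expR (- (r * V t w + s * W t w)) @[t --> F]
       --> \int[P']_w expR (- (r * U w + s * L w))) ->
  cvg_mean_dist (fun t w => V t w / W t w) (fun w => U w / L w).
Proof.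
move=> mV mW mU mL V0 W0 U0 L0 Lpos lap f cf fb.
have bexp d1 (T1 : measurableType d1) (v u : T1 -> R) (r s : R) :
    measurable_fun setT v -> measurable_fun setT u ->
    (forall w, 0 <= v w) -> (forall w, 0 <= u w) -> 0 <= r -> 0 <= s ->
    bounded_mfun (fun w => expR (- (r * v w + s * u w))).
  move=> mv mu v0 u0 r0 s0; apply: bounded_mfun01 => [|w].
    apply: measurableT_comp => //; apply: measurable_funN.
    by apply: measurable_funD; apply: measurable_funM => //; exact: measurable_cst.
  rewrite expR_ge0/= -expR0 ler_expR oppr_le0.
  by rewrite addr_ge0// mulr_ge0.
have lapQ r s : 0 <= r -> 0 <= s ->
    cvg_bounded_mean P P' F (fun t w => expR (- (r * V t w + s * W t w)))
                            (fun w => expR (- (r * U w + s * L w))).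
  move=> r0 s0; split => [t||]; [exact: bexp|exact: bexp|exact: lap].
have [K fK] := fb.
apply: cvg_mean_approx => [t||e e0].
- by apply: bounded_mfun_continuous => //; exact: measurable_fun_div.
- by apply: bounded_mfun_continuous => //; exact: measurable_fun_div.
(* the error of the cutoff at level [n.+1] *)
pose h n (v w : R) : R := 2 * K * expR 1 * ((1 - expR (- (n.+1%:R^-1 * v)))
  + (1 - expR (- (n.+1%:R^-1 * w))) + expR (- (n.+1%:R * w))).
have hQ n : cvg_bounded_mean P P' F (fun t w => h n (V t w) (W t w))
                                    (fun w => h n (U w) (L w)).
  have N0 : 0 <= n.+1%:R :> R by [].
  have Ni : 0 <= n.+1%:R^-1 :> R by rewrite invr_ge0.
  have Q1 := cvg_bounded_meanZ (FF := FF) (-1) (lapQ _ _ Ni (lexx (0 : R))).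
  have Q2 := cvg_bounded_meanZ (FF := FF) (-1) (lapQ _ _ (lexx (0 : R)) Ni).
  have Q3 := lapQ _ _ (lexx (0 : R)) N0.
  have Q0 := cvg_bounded_meanZ (FF := FF) 2 (lapQ _ _ (lexx (0 : R)) (lexx (0 : R))).
  have := cvg_bounded_meanZ (FF := FF) (2 * K * expR 1)
    (cvg_bounded_meanD (FF := FF) (cvg_bounded_meanD (FF := FF) Q0
      (cvg_bounded_meanD (FF := FF) Q1 Q2)) Q3).
  by apply: eq_cvg_bounded_mean => [t w|w];
    rewrite /h !mul0r !add0r !addr0 oppr0 expR0; ring.
have h0 : \int[P']_w h n (U w) (L w) @[n --> \oo] --> 0.
  rewrite -[X in _ --> X](mean_cst P' (0 : R)).
  have K0 : 0 <= K := le_trans (normr_ge0 _) (fK 0).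
  apply: (@bounded_cvg_mean _ _ _ _ _ _ (2 * K * expR 1 * 3)).
  - by move=> n; have [_ []] := hQ n.
  - exact: measurable_cst.
  - move=> n w.
    have ex01 (u : R) : 0 <= u -> 0 <= expR (- u) <= 1.
      by move=> u0; rewrite expR_ge0 -expR0 ler_expR oppr_le0.
    have p1 : 0 <= n.+1%:R^-1 * U w by rewrite mulr_ge0.
    have p2 : 0 <= n.+1%:R^-1 * L w by rewrite mulr_ge0.
    have p3 : 0 <= n.+1%:R * L w by rewrite mulr_ge0.
    have := ex01 _ p1; have := ex01 _ p2; have := ex01 _ p3.
    rewrite /h; set x := expR _; set y := expR _; set z := expR _ => hx hy hz.
    rewrite ger0_norm; last by rewrite !mulr_ge0 ?expR_ge0//; lra.
    by rewrite ler_wpM2l ?mulr_ge0 ?expR_ge0//; lra.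
  - apply: filterS Lpos => w Lw.
    have cvgV0 (u : R) : expR (- (n.+1%:R^-1 * u)) @[n --> \oo] --> (1 : R).
      have : n.+1%:R^-1 * u @[n --> \oo] --> 0 * u.
        by apply: cvgM; [exact: cvg_harmonic|exact: cvg_cst].
      rewrite mul0r => /cvgN; rewrite oppr0 => cu.
      rewrite -[X in _ --> X]expR0.
      by apply: continuous_cvg cu; exact: continuous_expR.
    have cL : expR (- (n.+1%:R * L w)) @[n --> \oo] --> (0 : R).
      have cnL : n.+1%:R * L w @[n --> \oo] --> +oo.
        apply/cvgryPge => A; near=> n; rewrite -ler_pdivrMr//.
        by apply: (@le_trans _ _ n%:R);
          [near: n; exact: nbhs_infty_ger|rewrite ler_nat].
      exact: (cvg_comp _ _ cnL (@cvgr_expR R)).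
    rewrite [X in _ --> X](_ : _ = 2 * K * expR 1 * ((1 - 1) + (1 - 1) + 0)); last by ring.
    apply: cvgMr; apply: cvgD => //; apply: cvgD; apply: cvgB => //; exact: cvg_cst.
have [n hn] : exists n, \int[P']_w h n (U w) (L w) < e.
  near \oo => n; exists n; near: n; exact: cvgr_lt h0 _ e0.
have M1 : 1 <= n.+1%:R :> R by rewrite ler1n.
pose G := ratio_cutoff f n.+1%:R.
have cG : continuous G by exact: continuous_ratio_cutoff.
have bG d1 (T1 : measurableType d1) (v u : T1 -> R) :
    measurable_fun setT v -> measurable_fun setT u ->
    bounded_mfun (fun w => G (expR (- v w), expR (- u w))).
  move=> mv mu; split; last by exists K => w; exact: fK.
  apply: (measurableT_comp (continuous_measurable_fun cf)).
  apply: measurable_fun_div.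
    apply: (measurableT_comp (@measurable_ln R)).
    apply: measurable_maxr; last exact: measurable_cst.
    by apply: (measurableT_comp (@measurable_expR R)); exact: measurable_funN.
  apply: (measurableT_comp (@measurable_ln R)).
  apply: measurable_maxr; last exact: measurable_cst.
  apply: measurable_minr; last exact: measurable_cst.
  by apply: (measurableT_comp (@measurable_expR R)); exact: measurable_funN.
have [bh bh0 ch] := hQ n.
exists (fun t w => G (expR (- V t w), expR (- W t w))).
exists (fun t w => h n (V t w) (W t w)).
exists (fun w => G (expR (- U w), expR (- L w))).
exists (fun w => h n (U w) (L w)).
split => //.
- by split => //; [move=> t|]; exact: bG.
- by apply: nearW => t w; exact: ratio_cutoff_dist.
- by move=> w; exact: ratio_cutoff_dist.
have ex01 (u : R) : 0 <= u -> 0 <= expR (- u) <= 1.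
  by move=> u0; rewrite expR_ge0 -expR0 ler_expR oppr_le0.
apply: (@cvg_mean_moments _ _ _ _ _ P P' _ F _ (fun t w => expR (- V t w))
   (fun t w => expR (- W t w)) (fun w => expR (- U w)) (fun w => expR (- L w))).
- by move=> t w; exact: ex01.
- by move=> t w; exact: ex01.
- by move=> w; exact: ex01.
- by move=> w; exact: ex01.
- move=> a b; apply: eq_cvg_bounded_mean (lapQ a%:R b%:R (ler0n _ _) (ler0n _ _)).
  + by move=> t w; rewrite -!expRM_natl -expRD; congr expR; ring.
  + by move=> w; rewrite -!expRM_natl -expRD; congr expR; ring.
- exact: cG.
- by move=> t; exact: bG.
- exact: bG.
Unshelve. all: by end_near. Qed.

(** A continuous majorant of the indicator of the values at distance at least
    [A + 1] from the origin, supported where the distance is at least [A]: its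
    mean passes to the limit in distribution. *)
Definition tail_weight (A y : R) : R := Num.min 1 (Num.max 0 (`|y| - A)).

Lemma continuous_tail_weight (A : R) : continuous (tail_weight A).
Proof.
move=> y.
apply: (@continuous_min _ _ (fun=> 1) (fun y => Num.max 0 (`|y| - A)) y).
  exact: cvg_cst.
apply: (@continuous_max _ _ (fun=> 0) (fun y => `|y| - A) y).
  exact: cvg_cst.
by apply: cvgB; [exact: norm_continuous|exact: cvg_cst].
Qed.

Lemma tail_weight01 (A y : R) : 0 <= tail_weight A y <= 1.
Proof. by rewrite /tail_weight le_min ler01 le_max lexx ge_min lexx. Qed.

Lemma tail_weight1 (A y : R) : A + 1 <= `|y| -> tail_weight A y = 1.
Proof.
move=> Ay; apply/min_idPl; rewrite le_max; apply/orP; right.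
by rewrite lerBrDl.
Qed.

Lemma bounded_tail_weight (A : R) :
  exists M, forall y, `|tail_weight A y| <= M.
Proof.
by exists 1 => y; have /andP[? ?] := tail_weight01 A y; rewrite ger0_norm.
Qed.

Lemma cvg_mean_tail_weight (Z : T' -> R) : measurable_fun setT Z ->
  \int[P']_w tail_weight n%:R (Z w) @[n --> \oo] --> (0 : R).
Proof.
move=> mZ; rewrite -[X in _ --> X](mean_cst P' (0 : R)).
apply: (@bounded_cvg_mean _ _ _ _ _ _ 1) => [n||n w|].
- apply: (measurableT_comp _ mZ).
  by apply: continuous_measurable_fun; exact: continuous_tail_weight.
- exact: measurable_cst.
- by have /andP[? ?] := tail_weight01 n%:R (Z w); rewrite ger0_norm.
apply: aeW => w; apply: cvg_near_cst; near=> n; apply/eqP.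
have Zn : `|Z w| <= n%:R by near: n; exact: nbhs_infty_ger.
by rewrite /tail_weight (max_idPl _) ?subr_le0// (min_idPr _).
Unshelve. all: by end_near. Qed.

(** Tightness of [Z] makes [b * Z] negligible, and tightness of [Y] restricts
    the test function to a compact set, on which it is uniformly
    continuous. *)
Lemma cvg_mean_dist_perturb (Y Z : I -> T -> R) (Y0 Z0 : T' -> R)
    (b : I -> R) :
  (forall t, measurable_fun setT (Y t)) ->
  (forall t, measurable_fun setT (Z t)) ->
  measurable_fun setT Y0 -> measurable_fun setT Z0 ->
  cvg_mean_dist Y Y0 -> cvg_mean_dist Z Z0 -> b t @[t --> F] --> (0 : R) ->
  cvg_mean_dist (fun t w => Y t w + b t * Z t w) Y0.
Proof.
move=> mY mZ mY0 mZ0 cY cZ b0 f cf fb; have [K fK] := fb.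
have K0 : 0 <= K := le_trans (normr_ge0 _) (fK 0).
have bf d1 (T1 : measurableType d1) (Y1 : T1 -> R) : measurable_fun setT Y1 ->
  bounded_mfun (fun w => f (Y1 w)) by exact: bounded_mfun_continuous.
have bw (A : R) d1 (T1 : measurableType d1) (Y1 : T1 -> R) :
    measurable_fun setT Y1 -> bounded_mfun (fun w => tail_weight A (Y1 w)).
  apply: bounded_mfun_continuous; first exact: continuous_tail_weight.
  exact: bounded_tail_weight.
apply: cvg_mean_approx => [t||e e0].
- apply: bf; apply: measurable_funD => //; apply: measurable_funM => //.
- exact: bf.
have e4 : 0 < e / 4 by rewrite divr_gt0.
have [A [Y0A Z0A]] : exists A : R,
    2 * K * \int[P']_w tail_weight A (Y0 w) < e / 4 /\
    2 * K * \int[P']_w tail_weight A (Z0 w) < e / 4.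
  have small (X0 : T' -> R) : measurable_fun setT X0 ->
      \forall n \near \oo,
        2 * K * \int[P']_w tail_weight n%:R (X0 w) < e / 4.
    move=> mX0; apply: cvgr_lt e4.
    rewrite -[X in _ --> X](mulr0 (2 * K)).
    by apply: cvgM; [exact: cvg_cst|exact: cvg_mean_tail_weight].
  by near \oo => n; exists n%:R; split; near: n; exact: small.
have [r r0 fr] : exists2 r : R, 0 < r & forall u v,
    `[- (A + 1), A + 1]%classic u -> `|u - v| < r -> `|f u - f v| < e / 4.
  exact: compact_uniform_continuous (@segment_compact _ _ _) cf _ e4.
pose h X1 X2 : R := e / 4 + 2 * K * (tail_weight A X1 + tail_weight A X2).
have hQ : cvg_bounded_mean P P' F (fun t w => h (Y t w) (Z t w))
                                  (fun w => h (Y0 w) (Z0 w)).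
  have Q (X1 : I -> T -> R) (X0 : T' -> R) :
      (forall t, measurable_fun setT (X1 t)) -> measurable_fun setT X0 ->
      cvg_mean_dist X1 X0 ->
      cvg_bounded_mean P P' F (fun t w => tail_weight A (X1 t w))
                              (fun w => tail_weight A (X0 w)).
    move=> m1 m0 c; split=> [t||]; [exact: bw|exact: bw|].
    apply: c; first exact: continuous_tail_weight.
    exact: bounded_tail_weight.
  apply: cvg_bounded_meanD; last first.
    by apply: cvg_bounded_meanZ; apply: cvg_bounded_meanD; exact: Q.
  by split=> [t||]; [exact: bounded_mfun_cst|exact: bounded_mfun_cst|];
    rewrite !mean_cst; exact: cvg_cst.
have [bh bh0 ch] := hQ.
exists (fun t w => f (Y t w)), (fun t w => h (Y t w) (Z t w)).
exists (fun w => f (Y0 w)), (fun w => h (Y0 w) (Z0 w)).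
split.
- by split => // [t|]; exact: bf.
- have bA : \forall t \near F, `|b t| * (`|A| + 2) < r.
    have : `|b t| * (`|A| + 2) @[t --> F] --> 0 * (`|A| + 2).
      apply: cvgM; last exact: cvg_cst.
      by rewrite -[X in _ --> X](@normr0 R R); exact: cvg_norm.
    by rewrite mul0r => /cvgr_lt; exact.
  apply: filterS bA => t bA w.
  have /andP[wY0 wY1] := tail_weight01 A (Y t w).
  have /andP[wZ0 wZ1] := tail_weight01 A (Z t w).
  have crude : tail_weight A (Y t w) = 1 \/ tail_weight A (Z t w) = 1 ->
      `|f (Y t w + b t * Z t w) - f (Y t w)| <= h (Y t w) (Z t w).
    move=> w1; rewrite -[X in X <= _]add0r lerD ?(ltW e4)//.
    apply: (@le_trans _ _ (2 * K)).
      by rewrite (le_trans (ler_normB _ _))// mulr_natl mulr2n lerD ?fK.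
    by rewrite ler_peMr ?mulr_ge0//; case: w1 => ->; lra.
  have [YA|YA] := leP (A + 1) `|Y t w|.
    by apply: crude; left; exact: tail_weight1.
  have [ZA|ZA] := leP (A + 1) `|Z t w|.
    by apply: crude; right; exact: tail_weight1.
  apply: (@le_trans _ _ (e / 4)); last first.
    by rewrite lerDl mulr_ge0 ?mulr_ge0// addr_ge0.
  rewrite distrC ltW//; apply: fr.
    by rewrite /= in_itv/= -ler_norml ltW.
  rewrite opprD addNKr normrN normrM; apply: le_lt_trans bA.
  rewrite ler_wpM2l// (le_trans (ltW ZA))//.
  by rewrite (_ : 2 = 1 + 1)// addrA lerD2r ler_wpDr ?ler_norm.
- move=> w; rewrite subrr normr0 addr_ge0 ?(ltW e4)// mulr_ge0 ?mulr_ge0//.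
  by have /andP[? _] := tail_weight01 A (Y0 w);
    have /andP[? _] := tail_weight01 A (Z0 w); rewrite addr_ge0.
- exact: cY.
- split => //; rewrite /h meanD; last 2 first.
  + exact: bounded_mfun_cst.
  + apply: bounded_mfunM; first exact: bounded_mfun_cst.
    by apply: bounded_mfunD; exact: bw.
  rewrite mean_cst meanZ; last by apply: bounded_mfunD; exact: bw.
  rewrite meanD; [|exact: bw|exact: bw].
  by rewrite mulrDr; move: Y0A Z0A; set p := 2 * K * _; set q := 2 * K * _; lra.
Unshelve. all: by end_near. Qed.

End convergence_in_distribution.

Section cvg_in_distribution_mean.
Context {d d'} {T : measurableType d} {T' : measurableType d'} {R : realType}.
Context (P : probability T R) (P' : probability T' R).
Variables (Y : R -> T -> R) (Z : T' -> R).
Hypotheses (mY : forall t, measurable_fun setT (Y t))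
  (mZ : measurable_fun setT Z).

Lemma cvg_in_distributionP :
  cvg_in_distribution P P' Y Z <-> cvg_mean_dist P P' +oo Y Z.
Proof.
split=> H f cf fb.
  have := H f cf fb.
  rewrite mean_expectation; last exact: bounded_mfun_continuous.
  move=> /fine_cvg/=; apply: cvg_trans.
  apply: near_eq_cvg; apply: nearW => t.
  by rewrite /= mean_expectation//; exact: bounded_mfun_continuous.
rewrite mean_expectation; last exact: bounded_mfun_continuous.
apply: cvg_EFin.
  apply: nearW => t; rewrite mean_expectation//.
  exact: bounded_mfun_continuous.
apply: cvg_trans (H f cf fb); apply: near_eq_cvg; apply: nearW => t.
by rewrite /= mean_expectation//; exact: bounded_mfun_continuous.
Qed.

End cvg_in_distribution_mean.

(** * Products of functions of independent variables, up to a random index *)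

Section staircase.
Context {R : realType}.

Lemma sum_nat_lt (n m : nat) : (m <= n)%N ->
  \sum_(k < n) ((k < m)%N%:R : R) = m%:R.
Proof.
move=> mn; rewrite (eq_bigr (fun k : 'I_n => if (k < m)%N then 1 else 0)).
  by rewrite -big_mkcond -(big_ord_widen n (fun=> 1)) // sumr_const card_ord.
by move=> k _; case: ifP.
Qed.

(** The uniform staircase below the identity of the unit interval: writing a
    function with values in this interval as an almost convex combination of
    indicators of its superlevel sets. *)
Lemma staircase_approx (n : nat) (u : R) : 0 <= u <= 1 ->
  `|u - n.+1%:R^-1 * \sum_(k < n.+1) ((k.+1%:R <= n.+1%:R * u)%R%:R : R)|
    <= n.+1%:R^-1.
Proof.
move=> /andP[u0 u1]; set N : R := n.+1%:R.
have N0 : 0 < N by rewrite ltr0n.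
have Nu0 : 0 <= N * u by rewrite mulr_ge0// ltW.
set m := Num.truncn (N * u).
have -> : \sum_(k < n.+1) ((k.+1%:R <= N * u)%R%:R : R) = m%:R.
  under eq_bigr do rewrite -truncn_gt_nat.
  apply: sum_nat_lt; rewrite -(ler_nat R).
  apply: (@le_trans _ _ (N * u)); first by rewrite truncn_le.
  by rewrite ler_piMr// ltW.
have /andP[mu um] := truncn_itv Nu0; rewrite -/m in mu um.
rewrite ler_distl; apply/andP; split.
- rewrite lerBlDr -(ler_pM2l N0) mulrDr !mulrA divff ?gt_eqF// !mul1r.
  by rewrite (le_trans mu)// lerDl.
- rewrite -(ler_pM2l N0) mulrDr !mulrA divff ?gt_eqF// !mul1r.
  by rewrite natr1 ltW.
Qed.

End staircase.

Section independent_products.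
Context {d} {T : measurableType d} {R : realType} (P : probability T R).

Lemma mean_indic (A : set T) : measurable A -> \int[P]_w \1_A w = fine (P A).
Proof.
move=> mA; rewrite /Rintegral; congr fine.
by rewrite integral_indic// setIT.
Qed.

Lemma bounded_mfun_indic_preimage (Y : T -> R) (B : set R) :
  measurable_fun setT Y -> measurable B ->
  bounded_mfun (fun w => \1_B (Y w) : R).
Proof.
move=> mY mB; apply: bounded_mfun01 => [|w].
  by apply: (measurableT_comp _ mY); exact: measurable_indic.
by rewrite indicE; case: (_ \in _); rewrite lexx ler01.
Qed.

(** Factorization of means passes from indicators of [Y] to functions of [Y],
    uniform limits of staircases of such indicators. *)
Lemma mean_mul_indep (h Y : T -> R) (g : R -> R) :
  (forall w, 0 <= h w <= 1) -> measurable_fun setT h -> measurable_fun setT Y ->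
  (forall B : set R, measurable B -> \int[P]_w (h w * \1_B (Y w))
     = \int[P]_w h w * \int[P]_w \1_B (Y w)) ->
  (forall x, 0 <= g x <= 1) -> measurable_fun setT g ->
  \int[P]_w (h w * g (Y w)) = \int[P]_w h w * \int[P]_w g (Y w).
Proof.
move=> h01 mh mY hY g01 mg.
have bh : bounded_mfun h by exact: bounded_mfun01.
have bg : bounded_mfun (fun w => g (Y w)).
  by apply: bounded_mfun01 => //; exact: measurableT_comp.
pose B n k : set R := [set x | (k.+1%:R <= n.+1%:R * g x)%R].
have mB n k : measurable (B n k).
  rewrite (_ : B n k = (fun x => n.+1%:R * g x) @^-1` `[k.+1%:R, +oo[).
    have mNg : measurable_fun setT (fun x => n.+1%:R * g x).
      by apply: measurable_funM => //; exact: measurable_cst.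
    by rewrite -[X in measurable X]setTI; exact: mNg.
  by apply/seteqP; split => x; rewrite /B/= in_itv/= andbT.
have BE n (k : 'I_n.+1) w :
    (k.+1%:R <= n.+1%:R * g (Y w))%R%:R = \1_(B n k) (Y w) :> R.
  by rewrite indicE mem_setE.
pose s n w : R := n.+1%:R^-1 * \sum_(k < n.+1) \1_(B n k) (Y w).
have bB n k : bounded_mfun (fun w => \1_(B n k) (Y w) : R).
  exact: bounded_mfun_indic_preimage.
have bsum n (D : nat -> T -> R) : (forall k, bounded_mfun (D k)) ->
    bounded_mfun (fun w => \sum_(k < n) D k w) /\
    \int[P]_w (\sum_(k < n) D k w) = \sum_(k < n) \int[P]_w D k w.
  move=> bD; elim: n => [|n [IH1 IH2]].
    split; last by under eq_Rintegral do rewrite big_ord0; rewrite mean_cst big_ord0.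
    rewrite (_ : (fun w => _) = fun=> 0); first exact: bounded_mfun_cst.
    by apply/funext => w; rewrite big_ord0.
  rewrite (_ : (fun w => _) = fun w => \sum_(k < n) D k w + D n w); last first.
    by apply/funext => w; rewrite big_ord_recr.
  split; first exact: bounded_mfunD.
  by rewrite meanD// IH2 big_ord_recr.
have bs n : bounded_mfun (s n).
  apply: bounded_mfunM; first exact: bounded_mfun_cst.
  by have [] := bsum n.+1 _ (bB n).
have hs n : \int[P]_w (h w * s n w) = \int[P]_w h w * \int[P]_w s n w.
  rewrite /s meanZ; last by have [] := bsum n.+1 _ (bB n).
  have [_ ->] := bsum n.+1 _ (bB n).
  rewrite mulrCA mulr_sumr.
  under eq_bigr do rewrite -hY//.
  have [bD <-] := bsum n.+1 (fun k w => h w * \1_(B n k) (Y w))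
    (fun k => bounded_mfunM bh (bB n k)).
  rewrite -meanZ//; apply: eq_Rintegral => w _.
  by rewrite mulrCA mulr_sumr.
have sg n w : `|g (Y w) - s n w| <= n.+1%:R^-1.
  have := staircase_approx n (g01 (Y w)).
  by under eq_bigr do rewrite BE.
have near n : `|\int[P]_w (h w * g (Y w)) - \int[P]_w h w * \int[P]_w g (Y w)|
    <= n.+1%:R^-1 + n.+1%:R^-1.
  have /andP[Eh0 Eh1] := mean01 P bh h01.
  rewrite -(subrKA (\int[P]_w (h w * s n w))) (le_trans (ler_normD _ _))// lerD//.
    rewrite -(mean_cst P n.+1%:R^-1); apply: mean_dist.
    - exact: bounded_mfunM.
    - exact: bounded_mfunM.
    - exact: bounded_mfun_cst.
    - move=> w; rewrite -mulrBr normrM.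
      have /andP[? ?] := h01 w; rewrite ger0_norm//.
      by apply: le_trans (sg n w); rewrite ler_piMl.
  rewrite hs -mulrBr normrM ger0_norm//.
  apply: (@le_trans _ _ `|\int[P]_w s n w - \int[P]_w g (Y w)|).
    by rewrite ler_piMl.
  rewrite -(mean_cst P n.+1%:R^-1); apply: mean_dist => //.
  - exact: bounded_mfun_cst.
  - by move=> w; rewrite distrC.
apply/eqP; rewrite -subr_eq0 -normr_le0.
have c0 : n.+1%:R^-1 + n.+1%:R^-1 @[n --> \oo] --> (0 + 0 : R).
  by apply: cvgD; exact: cvg_harmonic.
rewrite addr0 in c0.
apply: (@ler_cvg_to _ _ _ _ (fun=> _) _ _ _ (cvg_cst _) c0).
by apply: nearW => n; exact: near.
Qed.

(** An event that is independent of the sequence may be carried along as a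
    factor.  Indicators are replaced by general functions one variable at a
    time, the remaining factors forming the weight of the preceding lemma. *)
Lemma mean_indic_prod (Xs : nat -> T -> R) (A : set T) (n : nat)
    (g : nat -> R -> R) :
  (forall i, measurable_fun setT (Xs i)) -> measurable A ->
  (forall B : nat -> set R, (forall i, measurable (B i)) ->
     \int[P]_w (\1_A w * \prod_(i < n) \1_(B i) (Xs i w)) =
     fine (P A) * \prod_(i < n) \int[P]_w \1_(B i) (Xs i w)) ->
  (forall i, measurable_fun setT (g i)) -> (forall i x, 0 <= g i x <= 1) ->
  \int[P]_w (\1_A w * \prod_(i < n) g i (Xs i w)) =
  fine (P A) * \prod_(i < n) \int[P]_w g i (Xs i w).
Proof.
move=> mX mA HB mg g01.
have mprod (G : nat -> R -> R) (Q : pred 'I_n) :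
    (forall i, measurable_fun setT (G i)) ->
    measurable_fun setT (fun w => \prod_(i < n | Q i) G i (Xs i w)).
  move=> mG; rewrite (_ : (fun w => _) =
      fun w => \prod_(i <- index_enum 'I_n | Q i) G i (Xs i w))//.
  elim: (index_enum _) => [|i s IH].
    by under eq_fun do rewrite big_nil; exact: measurable_cst.
  under eq_fun do rewrite big_cons; case: (Q i) => //.
  by apply: measurable_funM => //; exact: measurableT_comp.
have prod01 (G : nat -> R -> R) (Q : pred 'I_n) w :
    (forall i x, 0 <= G i x <= 1) ->
    0 <= \prod_(i < n | Q i) G i (Xs i w) <= 1.
  move=> G01; apply/andP; split.
    by apply: prodr_ge0 => i _; have /andP[] := G01 i (Xs i w).
  by apply: prodr_ile1 => i _; exact: G01.
suff S k : (k <= n)%N -> forall G : nat -> R -> R,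
    (forall i, measurable_fun setT (G i)) -> (forall i x, 0 <= G i x <= 1) ->
    (forall i, (k <= i)%N -> exists2 B, measurable B & G i = \1_B) ->
    \int[P]_w (\1_A w * \prod_(i < n) G i (Xs i w)) =
    fine (P A) * \prod_(i < n) \int[P]_w G i (Xs i w).
  pose G i := if (i < n)%N then g i else \1_[set: R].
  have GE (i : 'I_n) : G i = g i by rewrite /G ltn_ord.
  have := S n (leqnn n) G _ _ _.
  rewrite (eq_bigr (fun i : 'I_n => \int[P]_w g i (Xs i w))); last first.
    by move=> i _; rewrite GE.
  move=> <-.
  - by apply: eq_Rintegral => w _; congr (_ * _); apply: eq_bigr => i _; rewrite GE.
  - by move=> i; rewrite /G; case: ifP => // _; exact: measurable_indic.
  - move=> i x; rewrite /G; case: ifP => // _.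
    by rewrite indicE; case: (_ \in _); rewrite lexx ler01.
  - by move=> i ni; exists setT => //; rewrite /G ltnNge ni.
elim: k => [_ G mG G01 GB|k IH kn G mG G01 GB].
  have /choice[B GBE] : forall i, exists B, measurable B /\ G i = \1_B.
    by move=> i; have [B mB ->] := GB i (leq0n i); exists B.
  have := HB B (fun i => (GBE i).1).
  rewrite (eq_bigr (fun i : 'I_n => \int[P]_w G i (Xs i w))); last first.
    by move=> i _; rewrite (GBE i).2.
  move=> <-; apply: eq_Rintegral => w _; congr (_ * _).
  by apply: eq_bigr => i _; rewrite (GBE i).2.
pose k0 := Ordinal kn.
pose h w : R := \1_A w * \prod_(i < n | i != k0) G i (Xs i w).
have mh : measurable_fun setT h.
  by apply: measurable_funM; [exact: measurable_indic|exact: mprod].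
have h01 w : 0 <= h w <= 1.
  have /andP[p0 p1] := prod01 G (fun i => i != k0) w G01.
  rewrite /h indicE; case: (_ \in _); rewrite ?mul1r ?mul0r ?p0//.
  by rewrite lexx ler01.
pose c := fine (P A) * \prod_(i < n | i != k0) \int[P]_w G i (Xs i w).
have hB (B : set R) : measurable B ->
    \int[P]_w (h w * \1_B (Xs k w)) = c * \int[P]_w \1_B (Xs k w).
  move=> mB; pose G' i := if i == k then (\1_B : R -> R) else G i.
  have G'E (i : 'I_n) : i != k0 -> G' i = G i.
    by rewrite /G' => ik; case: eqP => // ik'; move/eqP: ik; case; exact: val_inj.
  have G'k : G' k = \1_B by rewrite /G' eqxx.
  have := IH (ltnW kn) G' _ _ _.
  rewrite (bigD1 k0)//= G'k (eq_bigr (fun i : 'I_n => \int[P]_w G i (Xs i w))).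
    move=> E; rewrite /c mulrAC -mulrA -E.
    - apply: eq_Rintegral => w _; rewrite /h [in RHS](bigD1 k0)//= G'k.
      rewrite [LHS]mulrC mulrCA; congr (_ * (_ * _)).
      by apply: eq_bigr => i ik; rewrite G'E.
    - by move=> i; rewrite /G'; case: ifP => // _; exact: measurable_indic.
    - move=> i x; rewrite /G'; case: ifP => // _.
      by rewrite indicE; case: (_ \in _); rewrite lexx ler01.
    - move=> i ki; rewrite /G'; case: eqP => [_|ik]; first by exists B.
      by apply: GB; rewrite ltn_neqAle eq_sym ki andbT; exact/eqP.
  by move=> i ik; rewrite G'E.
have hT : \int[P]_w h w = c.
  have := hB setT measurableT.
  under eq_Rintegral do rewrite indicT mulr1.
  by under [in RHS]eq_Rintegral do rewrite indicT; rewrite mean_cst mulr1.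
rewrite [in RHS](bigD1 k0)//= mulrCA -/c -hT mulrC -mean_mul_indep//.
- by apply: eq_Rintegral => w _; rewrite (bigD1 k0)//= /h mulrAC mulrA.
- by move=> B mB; rewrite hB// hT.
Qed.

End independent_products.

Section random_index.
Context {d} {T : measurableType d} {R : realType} (P : probability T R).

Lemma measurable_random_index {M : T -> nat} {f : nat -> T -> R} :
  measurable_fun setT M -> (forall n, measurable_fun setT (f n)) ->
  measurable_fun setT (fun w => f (M w) w).
Proof.
move=> mM mf _ B mB; rewrite setTI.
rewrite (_ : _ @^-1` B = \bigcup_n (M @^-1` [set n] `&` f n @^-1` B)).
  apply: bigcup_measurable => n _; apply: measurableI.
    by rewrite -[X in measurable X]setTI; exact: mM.
  by rewrite -[X in measurable X]setTI; exact: mf.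
apply/seteqP; split => w /=; first by move=> h; exists (M w).
by move=> [n _ [/= <-]].
Qed.

(** Means of variables with a random index are determined by the means over the
    events on which the index is constant. *)
Lemma mean_random_index (M : T -> nat) (f g : nat -> T -> R) :
  measurable_fun setT M ->
  (forall n, measurable_fun setT (f n)) ->
  (forall n, measurable_fun setT (g n)) ->
  (forall n w, 0 <= f n w <= 1) -> (forall n w, 0 <= g n w <= 1) ->
  (forall n, \int[P]_w (\1_(M @^-1` [set n]) w * f n w) =
             \int[P]_w (\1_(M @^-1` [set n]) w * g n w)) ->
  \int[P]_w f (M w) w = \int[P]_w g (M w) w.
Proof.
move=> mM mf mg f01 g01 fg.
have mMn n : measurable (M @^-1` [set n]).
  by rewrite -[X in measurable X]setTI; exact: mM.
pose tr (h : nat -> T -> R) m w : R :=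
  \sum_(n < m) \1_(M @^-1` [set (n : nat)]) w * h n w.
have trE (h : nat -> T -> R) m w : tr h m w = if (M w < m)%N then h (M w) w else 0.
  rewrite /tr; case: ifPn => Mm.
    rewrite (bigD1 (Ordinal Mm))//= big1.
      by rewrite addr0 indicE mem_set ?mul1r.
    move=> i iM; rewrite indicE memNset ?mul0r//= => Mi.
    by move/eqP: iM; apply; exact: val_inj.
  rewrite big1// => i _; rewrite indicE memNset ?mul0r//= => Mi.
  by move: Mm; rewrite Mi ltn_ord.
have b1 (h : nat -> T -> R) n : measurable_fun setT (h n) ->
    (forall n w, 0 <= h n w <= 1) ->
    bounded_mfun (fun w => \1_(M @^-1` [set n]) w * h n w).
  move=> mh h01; apply: bounded_mfunM; first exact: bounded_mfun_indic.
  exact: bounded_mfun01.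
have btr (h : nat -> T -> R) m : (forall n, measurable_fun setT (h n)) ->
    (forall n w, 0 <= h n w <= 1) -> bounded_mfun (tr h m).
  move=> mh h01; elim: m => [|m IH].
    rewrite (_ : tr h 0%N = fun=> 0); first exact: bounded_mfun_cst.
    by apply/funext => w; rewrite /tr big_ord0.
  rewrite (_ : tr h m.+1 =
      fun w => tr h m w + \1_(M @^-1` [set m]) w * h m w).
    by apply: bounded_mfunD => //; exact: b1.
  by apply/funext => w; rewrite /tr big_ord_recr.
have trfg m : \int[P]_w tr f m w = \int[P]_w tr g m w.
  elim: m => [|m IH]; first by apply: eq_Rintegral => w _; rewrite /tr !big_ord0.
  under eq_Rintegral do rewrite /tr big_ord_recr/=.
  under [RHS]eq_Rintegral do rewrite /tr big_ord_recr/=.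
  rewrite !meanD ?IH ?fg//; try exact: btr; exact: b1.
have ctr (h : nat -> T -> R) : (forall n, measurable_fun setT (h n)) ->
    (forall n w, 0 <= h n w <= 1) ->
    \int[P]_w tr h m w @[m --> \oo] --> \int[P]_w h (M w) w.
  move=> mh h01; apply: (@bounded_cvg_mean _ _ _ _ _ _ 1).
  - by move=> m; have [] := btr h m mh h01.
  - exact: measurable_random_index.
  - move=> m w; rewrite trE; case: ifP; rewrite ?normr0// => _.
    by have /andP[? ?] := h01 (M w) w; rewrite ger0_norm.
  - apply: aeW => w; apply: cvg_near_cst.
    exists (M w).+1 => // m /= Mm; rewrite trE ifT//.
have cf := ctr f mf f01; have cg := ctr g mg g01.
rewrite (_ : (fun m => _) = (fun m => \int[P]_w tr g m w)) in cf; last first.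
  by apply/funext => m; rewrite trfg.
exact: cvg_unique cf cg.
Qed.

Lemma identically_distributed_mean (X Y : {RV P >-> R}) (g : R -> R) :
  identically_distributed X Y -> measurable_fun setT g ->
  (forall x, 0 <= g x) -> \int[P]_w g (X w) = \int[P]_w g (Y w).
Proof.
move=> XY mg g0; rewrite /Rintegral; congr fine.
have := @ge0_integral_distribution _ _ _ _ _ P X (EFin \o g).
move=> <-; [|exact/measurable_EFinP|by move=> y; rewrite lee_fin].
have := @ge0_integral_distribution _ _ _ _ _ P Y (EFin \o g).
move=> <-; [|exact/measurable_EFinP|by move=> y; rewrite lee_fin].
by apply: eq_measure_integral => A mA _; exact: XY.
Qed.

(** Given the index, the product of independent identically distributed factors
    has for mean a power of the common mean. *)
Lemma mean_random_prod (X : {RV P >-> R}) (Xs : nat -> {RV P >-> R})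
    (N : R -> {RV P >-> nat}) (t : R) (g : R -> R) :
  iid_copies X Xs -> process_independent N Xs -> 0 <= t ->
  measurable_fun setT g -> (forall x, 0 <= g x <= 1) ->
  \int[P]_w \prod_(i < N t w) g (Xs i w) =
  \int[P]_w (\int[P]_w' g (X w')) ^+ N t w.
Proof.
move=> [indep ident] NX t0 mg g01.
have mX i : measurable_fun setT (Xs i) by exact: measurable_funP.
have mN : measurable_fun setT (N t) by exact: measurable_funP.
have mNn n : measurable (N t @^-1` [set n]).
  by rewrite -[X in measurable X]setTI; exact: mN.
have Eg01 : 0 <= \int[P]_w g (X w) <= 1.
  by apply: mean01 => //; apply: bounded_mfun01 => //; exact: measurableT_comp.
apply: (@mean_random_index (N t) (fun n w => \prod_(i < n) g (Xs i w))
   (fun n _ => (\int[P]_w' g (X w')) ^+ n)) => //.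
- elim=> [|n IH]; first by under eq_fun do rewrite big_ord0; exact: measurable_cst.
  under eq_fun do rewrite big_ord_recr/=.
  by apply: measurable_funM => //; exact: measurableT_comp.
- move=> n w; apply/andP; split.
    by apply: prodr_ge0 => i _; have /andP[] := g01 (Xs i w).
  by apply: prodr_ile1 => i _; exact: g01.
- by move=> n _; have /andP[? ?] := Eg01; rewrite exprn_ge0//= exprn_ile1.
move=> n.
rewrite (mean_indic_prod (Xs := fun i => Xs i) (g := fun=> g))//; last first.
  move=> B mB; set A := N t @^-1` [set n].
  have PB i : fine (P (Xs i @^-1` B i)) = \int[P]_w \1_(B i) (Xs i w).
    have mXB : measurable (Xs i @^-1` B i).
      by rewrite -[X in measurable X]setTI; exact: mX.
    by rewrite -(mean_indic P mXB); apply: eq_Rintegral => w _; rewrite !indicE.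
  pose C := \bigcap_(i in [set` iota 0 n]) (Xs i @^-1` B i).
  have mC : measurable C.
    apply: bigcap_measurableType => i _.
    by rewrite -[X in measurable X]setTI; exact: mX.
  transitivity (fine (P (A `&` C))).
    rewrite -mean_indic; last exact: (measurableI _ _ (mNn n) mC).
    apply: eq_Rintegral => w _; rewrite indicI/=; congr (_ * _).
    have [Cw|Cw] := pselect (C w).
      rewrite [RHS]indicE mem_set// big1// => i _; rewrite indicE mem_set//.
      by apply: Cw; rewrite /= mem_iota add0n ltn_ord.
    rewrite [RHS]indicE memNset//; apply/eqP/prodf_eq0.
    have /existsNP[i /not_implyP[/= i_n Bi]] := Cw.
    rewrite mem_iota add0n in i_n.
    by exists (Ordinal i_n) => //=; rewrite indicE memNset.
  rewrite NX.
  - have fA : P A \is a fin_num by apply: fin_num_measure; exact: mNn.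
    have fC : P C \is a fin_num by exact: fin_num_measure.
    rewrite fineM//; congr (_ * _).
    rewrite /C indep ?iota_uniq//.
    rewrite (_ : iota 0 n = index_iota 0 n); last by rewrite /index_iota subn0.
    rewrite (_ : (\prod_(0 <= i < n) P (Xs i @^-1` B i))%E =
        (\prod_(0 <= i < n) fine (P (Xs i @^-1` B i)))%:E).
      by rewrite /= big_mkord; apply: eq_bigr => i _; rewrite PB.
    rewrite -prodEFin; apply: eq_bigr => i _; rewrite fineK// fin_num_measure//.
    by rewrite -[X in measurable X]setTI; exact: mX.
  - apply: sub_sigma_algebra; exists t => //=; exists [set n] => //.
    by rewrite setTI.
  - apply: (@bigcap_measurableType _ (g_sigma_algebraType
      (\bigcup_(i in setT) preimage_set_system setT (Xs i) measurable))) => i _.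
    apply: sub_sigma_algebra; exists i => //=; exists (B i) => //.
    by rewrite setTI.
transitivity (\int[P]_w ((\int[P]_w' g (X w')) ^+ n * \1_(N t @^-1` [set n]) w)).
  rewrite meanZ; last exact: bounded_mfun_indic.
  rewrite mean_indic// mulrC; congr (_ * _).
  rewrite (eq_bigr (fun=> \int[P]_w g (X w))).
    by rewrite prodr_const card_ord.
  move=> i _; apply: identically_distributed_mean => //.
  by move=> x; have /andP[] := g01 x.
by apply: eq_Rintegral => w _; rewrite mulrC.
Qed.

End random_index.

Section random_power.
Context {d d'} {T : measurableType d} {T' : measurableType d'} {R : realType}.
Context (P : probability T R) (P' : probability T' R).

(** The distance of two exponentials of linear functions is bounded uniformly on
    the half-line, since [x * expR (- (c / 2 * x))] is bounded. *)
Lemma expRN_dist (k c x : R) : 0 < c -> c / 2 <= k -> 0 <= x ->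
  `|expR (- (k * x)) - expR (- (c * x))| <= `|k - c| * (2 / c).
Proof.
move=> c0 ck x0.
have key u v : (c / 2) * x <= u -> u <= v ->
    `|expR (- u) - expR (- v)| <= (v - u) * expR (- (c / 2 * x)).
  move=> cu uv; rewrite ger0_norm ?subr_ge0 ?ler_expR ?lerN2//.
  have -> : - v = - u + (u - v) by ring.
  rewrite expRD -{1}[expR (- u)]mulr1 -mulrBr mulrC.
  apply: ler_pM; rewrite ?expR_ge0 ?ler_expR ?lerN2//.
    by rewrite subr_ge0 -expR0 ler_expR subr_le0.
  by have := expR_ge1Dx (u - v); lra.
have xe : x * expR (- (c / 2 * x)) <= 2 / c.
  have h : c / 2 * x <= expR (c / 2 * x).
    by have := expR_ge1Dx (c / 2 * x); lra.
  rewrite expRN ler_pdivrMr ?expR_gt0//.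
  apply: (@le_trans _ _ (2 / c * (c / 2 * x))).
    by rewrite mulrA (_ : 2 / c * (c / 2) = 1) ?mul1r//; field; rewrite gt_eqF.
  by rewrite ler_wpM2l// divr_ge0// ltW.
have fin (D : R) : 0 <= D -> D * x * expR (- (c / 2 * x)) <= D * (2 / c).
  by move=> D0; rewrite -mulrA ler_wpM2l.
have c2x : c / 2 * x <= c * x by rewrite ler_wpM2r//; lra.
have k2x : c / 2 * x <= k * x by rewrite ler_wpM2r.
have [kc|kc] := leP k c.
- apply: le_trans (key _ _ k2x _) _; first by rewrite ler_wpM2r.
  by rewrite -mulrBl distrC ger0_norm ?subr_ge0// fin// subr_ge0.
- rewrite distrC; apply: le_trans (key _ _ c2x _) _.
    by rewrite ler_wpM2r// ltW.
  by rewrite -mulrBl gtr0_norm ?subr_gt0// fin// subr_ge0 ltW.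
Qed.

Lemma cvg_rate1 (g : R -> R) (c : R) :
  t * (1 - g t) @[t --> +oo] --> c -> g t @[t --> +oo] --> (1 : R).
Proof.
move=> gc.
have inv0 : (t : R)^-1 @[t --> +oo] --> (0 : R).
  by apply/gtr0_cvgV0; [exact: nbhs_pinfty_gt|exact: cvg_id].
have h : 1 - t^-1 * (t * (1 - g t)) @[t --> +oo] --> 1 - 0 * c.
  by apply: cvgB; [exact: cvg_cst|exact: cvgM].
rewrite mul0r subr0 in h; apply: cvg_trans h; apply: near_eq_cvg.
near=> t; have t0 : t != 0 :> R by rewrite gt_eqF.
by rewrite mulKf//; ring.
Unshelve. all: by end_near. Qed.

Lemma cvg_ln_rate (g : R -> R) (c : R) :
  t * (1 - g t) @[t --> +oo] --> c -> t * - ln (g t) @[t --> +oo] --> c.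
Proof.
move=> gc; have g1 := cvg_rate1 gc.
apply: (@squeeze_cvgr _ _ _ _ (fun t => t * (1 - g t))
   (fun t => t * (1 - g t) / g t)) => //; last first.
  rewrite -[X in _ --> X]divr1; apply: cvgM => //.
  by apply: cvgV => //; exact: oner_neq0.
near=> t.
have t0 : 0 < t by [].
have g0 : 0 < g t by near: t; apply: (cvgr_gt _ g1); exact: ltr01.
have lnle (x : R) : 0 < x -> ln x <= x - 1.
  move=> x0; have := @le_ln1Dx R (x - 1); rewrite subrKC; apply; lra.
rewrite -mulrA !ler_pM2l//; apply/andP; split.
  by have := lnle _ g0; lra.
rewrite -lnV ?posrE//; apply: le_trans (lnle _ _) _; first by rewrite invr_gt0.
by rewrite mulrBl mul1r divff ?gt_eqF.
Unshelve. all: by end_near. Qed.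

(** With [c t] equal to [- t * ln (g t)], the random power is the value at
    [M / t] of the exponential of rate [c t], and these exponentials converge
    uniformly on the half-line. *)
Lemma cvg_mean_random_power (M : R -> T -> nat) (L : T' -> R) (g : R -> R)
    (c : R) : 0 < c ->
  (forall t, measurable_fun setT (M t)) -> measurable_fun setT L ->
  (forall w, 0 <= L w) -> (forall t, 0 <= g t <= 1) ->
  t * (1 - g t) @[t --> +oo] --> c ->
  cvg_mean_dist P P' +oo (fun t w => (M t w)%:R / t) L ->
  \int[P]_w g t ^+ M t w @[t --> +oo] --> \int[P']_w expR (- (c * L w)).
Proof.
move=> c0 mM mL L0 g01 gc cM.
pose f (x : R) := expR (- (c * Num.max x 0)).
have cf : continuous f.
  move=> x; apply: continuous_comp; last exact: continuous_expR.
  apply: cvgN; apply: cvgM; first exact: cvg_cst.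
  exact: (@continuous_max _ _ id (fun=> 0) x (@cvg_id _ _) (cvg_cst _)).
have f01 x : 0 <= f x <= 1.
  rewrite expR_ge0/= -expR0 ler_expR oppr_le0.
  by rewrite mulr_ge0 ?(ltW c0)// le_max lexx orbT.
have fb : exists K, forall x, `|f x| <= K.
  by exists 1 => x; have /andP[? ?] := f01 x; rewrite ger0_norm.
have mMt t : measurable_fun setT (fun w => (M t w)%:R / t : R).
  apply: measurable_funM; last exact: measurable_cst.
  apply: (@measurable_random_index _ _ _ (M t) (fun n _ => n%:R)) => // n.
have -> : (fun w => expR (- (c * L w))) = (fun w => f (L w)).
  by apply/funext => w; rewrite /f (max_idPl _).
apply: cvg_mean_approx => [t||e e0].
- apply: bounded_mfun01 => [|w].
    apply: (@measurable_random_index _ _ _ (M t) (fun n _ => g t ^+ n)) => // n.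
  by have /andP[? ?] := g01 t; rewrite exprn_ge0//= exprn_ile1.
- exact: bounded_mfun_continuous.
exists (fun t w => f ((M t w)%:R / t)), (fun _ _ => e / 2).
exists (fun w => f (L w)), (fun _ => e / 2).
have e2 : 0 < e / 2 by rewrite divr_gt0.
split.
- by split => [t|t||]; try exact: bounded_mfun_cst; exact: bounded_mfun_continuous.
- have ck := cvg_ln_rate gc.
  have kc0 : `|t * - ln (g t) - c| * (2 / c) @[t --> +oo] --> 0 * (2 / c).
    apply: cvgM; last exact: cvg_cst.
    rewrite -[X in _ --> X](@normr0 R R) -(subrr c); apply: cvg_norm.
    by apply: cvgB => //; exact: cvg_cst.
  rewrite mul0r in kc0.
  near=> t => w.
  have t0 : 0 < t by [].
  have gt0 : 0 < g t.
    by near: t; apply: (cvgr_gt _ (cvg_rate1 gc)); exact: ltr01.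
  rewrite -[g t]lnK ?posrE// -expRM_natl /f (max_idPl _); last first.
    by rewrite divr_ge0// ltW.
  have -> : (M t w)%:R * ln (g t) = - ((t * - ln (g t)) * ((M t w)%:R / t)).
    by field; rewrite gt_eqF.
  apply: (@le_trans _ _ (`|t * - ln (g t) - c| * (2 / c))).
    apply: expRN_dist => //; last by rewrite divr_ge0// ltW.
    by near: t; apply: (cvgr_ge _ ck); lra.
  by near: t; apply: (cvgr_le _ kc0).
- by move=> w; rewrite subrr normr0 ltW.
- exact: cM.
- rewrite !mean_cst; split; [exact: cvg_cst|by rewrite [ltRHS]splitr ltrDl].
Unshelve. all: by end_near. Qed.

End random_power.

(** * Regularly varying tails of index one and their truncated means *)

Section dyadic.
Context {R : realType}.

(** Regular variation compares values at [x] and [2 * x]; this principle turns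
    such comparisons into bounds at infinity. *)
Lemma dyadic_induction (Q : R -> Prop) (x0 : R) : 0 < x0 ->
  (forall x, x0 <= x <= 2 * x0 -> Q x) ->
  (forall x, x0 <= x -> Q x -> Q (2 * x)) -> forall x, x0 <= x -> Q x.
Proof.
move=> x00 base step x x0x.
suff H n : forall y, x0 <= y <= 2 ^+ n.+1 * x0 -> Q y.
  near \oo => n; apply: (H n); rewrite x0x/= -ler_pdivrMr//.
  have le2 k : k%:R <= 2 ^+ k :> R by rewrite -natrX ler_nat ltnW// ltn_expl.
  apply: (@le_trans _ _ n.+1%:R) => //; apply: (@le_trans _ _ n%:R).
    by near: n; exact: nbhs_infty_ger.
  by rewrite ler_nat.
elim: n => [|n IH] y /andP[xy yn]; first by apply: base; rewrite xy.
have [y2|y2] := leP y (2 * x0); first by apply: base; rewrite xy.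
rewrite (_ : y = 2 * (y / 2)); last by field.
have xy2 : x0 <= y / 2 by lra.
apply: step => //; apply: IH; rewrite xy2/=.
by move: yn; rewrite exprS -mulrA; set z := 2 ^+ _ * _; lra.
Unshelve. all: by end_near. Qed.

End dyadic.

Section tail.
Context {d} {T : measurableType d} {R : realType} (P : probability T R).
Variable X : {RV P >-> R}.

Definition tail (x : R) : R := fine (P [set w | x < X w]).

(** Truncating the positive part from above gives means that are finite and
    that increase with the threshold by integrals of the tail. *)
Definition cap (x u : R) : R := Num.min (Num.max u 0) x.

Definition tmean (x : R) : R := \int[P]_w cap x (X w).

Definition tsquare (x : R) : R := \int[P]_w (cap x (X w) ^+ 2).

Lemma measurable_gt x : measurable [set w | x < X w].
Proof.
rewrite (_ : [set w | _] = X @^-1` `]x, +oo[).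
  exact: measurable_funPTI.
by apply/seteqP; split => w /=; rewrite in_itv/= andbT.
Qed.

Let mX : measurable_fun setT X := measurable_funP X.

Lemma tailE x : tail x = \int[P]_w (\1_[set w | x < X w] w).
Proof. by rewrite mean_indic//; exact: measurable_gt. Qed.

Lemma tail_distribution_function x : 1 - distribution_function X x = tail x.
Proof.
rewrite /distribution_function /tail.
have -> : P [set w | x < X w] = ccdf X x.
  rewrite /ccdf /distribution /pushforward; congr (P _).
  by apply/seteqP; split => w /=; rewrite in_itv/= andbT.
by rewrite ccdf_1_cdf fineB//; exact: fin_num_measure.
Qed.

Lemma tail_ge0 x : 0 <= tail x.
Proof. by rewrite /tail fine_ge0. Qed.

Lemma tail_noninc x y : x <= y -> tail y <= tail x.
Proof.
move=> xy; rewrite /tail fine_le ?fin_num_measure//; try exact: measurable_gt.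
apply: le_measure; rewrite ?inE; try exact: measurable_gt.
by move=> w /=; exact: le_lt_trans.
Qed.

Lemma cap_ge0 x u : 0 <= x -> 0 <= cap x u <= x.
Proof. by move=> x0; rewrite /cap le_min le_max lexx orbT x0 ge_min lexx orbT. Qed.

Lemma measurable_cap x : measurable_fun setT (fun w => cap x (X w)).
Proof.
apply: measurable_minr; last exact: measurable_cst.
by apply: measurable_maxr => //; exact: measurable_cst.
Qed.

Lemma bounded_cap x : 0 <= x -> bounded_mfun (fun w => cap x (X w)).
Proof.
move=> x0; split; first exact: measurable_cap.
by exists x => w; have /andP[? ?] := cap_ge0 (X w) x0; rewrite ger0_norm.
Qed.

Lemma bounded_gt x : bounded_mfun (fun w => \1_[set w | x < X w] w : R).
Proof. exact/bounded_mfun_indic/measurable_gt. Qed.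

Lemma cap_incr x y u : 0 <= x -> x <= y ->
  (y - x) * (y < u)%R%:R <= cap y u - cap x u <= (y - x) * (x < u)%R%:R.
Proof.
move=> x0 xy; rewrite /cap /Num.min /Num.max.
by case: (ltP u 0) => u0; repeat case: ltP => ? /=; rewrite ?mulr1 ?mulr0; lra.
Qed.

Lemma indic_gt x w : \1_[set w | x < X w] w = (x < X w)%R%:R :> R.
Proof. by rewrite indicE mem_setE. Qed.

Lemma tmean_incr x y : 0 <= x -> x <= y ->
  (y - x) * tail y <= tmean y - tmean x <= (y - x) * tail x.
Proof.
move=> x0 xy; have y0 : 0 <= y by exact: le_trans xy.
have bx := bounded_cap x0; have by_ := bounded_cap y0.
have bxy := bounded_mfunB by_ bx.
have bg z : bounded_mfun (fun w => (y - x) * \1_[set w | z < X w] w).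
  by apply: bounded_mfunM; [exact: bounded_mfun_cst|exact: bounded_gt].
rewrite !tailE -!meanZ ?(bounded_gt _)//; try exact: bounded_gt.
rewrite -meanB//; apply/andP; split; apply: le_mean => // w;
  by rewrite indic_gt; have /andP[] := cap_incr (X w) x0 xy.
Qed.

Lemma tmean_ge0 x : 0 <= x -> 0 <= tmean x.
Proof.
by move=> x0; apply: Rintegral_ge0 => w _; have /andP[] := cap_ge0 (X w) x0.
Qed.

Lemma tmean0 : tmean 0 = 0.
Proof.
rewrite /tmean -[RHS](mean_cst P (0 : R)); apply: eq_Rintegral => w _.
by apply/min_idPr; rewrite le_max lexx orbT.
Qed.

Lemma le_tmean x y : 0 <= x -> x <= y -> tmean x <= tmean y.
Proof.
move=> x0 xy; have /andP[h _] := tmean_incr x0 xy.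
by rewrite -subr_ge0 (le_trans _ h)// mulr_ge0 ?tail_ge0// subr_ge0.
Qed.

Lemma tail_le_tmean x : 0 <= x -> x * tail x <= tmean x.
Proof.
by move=> x0; have /andP[+ _] := tmean_incr (lexx 0) x0; rewrite tmean0 !subr0.
Qed.

(** The truncated mean is concave and vanishes at the origin. *)
Lemma tmean_scale x y : 0 < x -> x <= y -> x * tmean y <= y * tmean x.
Proof.
move=> x0 xy; have y0 : 0 < y by exact: lt_le_trans xy.
rewrite /tmean -!meanZ; [|exact/bounded_cap/ltW|exact/bounded_cap/ltW].
apply: le_mean => [||w].
- by apply: bounded_mfunM; [exact: bounded_mfun_cst|exact/bounded_cap/ltW].
- by apply: bounded_mfunM; [exact: bounded_mfun_cst|exact/bounded_cap/ltW].
rewrite /cap; set v := Num.max _ _; have v0 : 0 <= v by rewrite le_max lexx orbT.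
by rewrite /Num.min; case: ltP => vx; case: ltP => vy; nra.
Qed.

Lemma tsquare_incr x : 0 <= x -> tsquare (2 * x) <= tsquare x + 3 * x ^+ 2 * tail x.
Proof.
move=> x0; have x2 : 0 <= 2 * x by rewrite mulr_ge0.
have b1 := bounded_mfunX 2 (bounded_cap x0).
have b2 : bounded_mfun (fun w => 3 * x ^+ 2 * \1_[set w | x < X w] w).
  by apply: bounded_mfunM; [exact: bounded_mfun_cst|exact: bounded_gt].
rewrite tailE -meanZ; last exact: bounded_gt.
rewrite /tsquare -meanD//; apply: le_mean.
- exact: (bounded_mfunX 2 (bounded_cap x2)).
- exact: bounded_mfunD.
move=> w; rewrite indic_gt.
have /andP[h0 h1] := cap_ge0 (X w) x0; have /andP[k0 k1] := cap_ge0 (X w) x2.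
have xx : x <= 2 * x by lra.
have /andP[i0 i1] := cap_incr (X w) x0 xx.
by move: i1; case: (x < X w); rewrite ?mulr1 ?mulr0 => i1; nra.
Qed.

Lemma tsquare_le x : 0 <= x -> tsquare x <= x ^+ 2.
Proof.
move=> x0; rewrite -[leRHS](mean_cst P); apply: le_mean.
- exact: (bounded_mfunX 2 (bounded_cap x0)).
- exact: bounded_mfun_cst.
by move=> w; have /andP[h0 h1] := cap_ge0 (X w) x0; rewrite lerXn2r ?nnegrE.
Qed.

Hypothesis tail_rv : forall c : R, 0 < c ->
  tail (c * x) / tail x @[x --> +oo] --> c^-1.
Hypothesis tail_gt0 : forall x, 0 < tail x.

Lemma tmean_gt0 x : 0 < x -> 0 < tmean x.
Proof.
move=> x0; apply: lt_le_trans (tail_le_tmean (ltW x0)).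
by rewrite mulr_gt0.
Qed.

(** Each of the dyadic shells below [x] contributes asymptotically the same
    multiple of [x * tail x] to the truncated mean, and there are arbitrarily
    many of them. *)
Lemma tail_over_tmean (e : R) : 0 < e ->
  \forall x \near +oo, x * tail x <= e * tmean x.
Proof.
move=> e0.
have shells K : \forall x \near +oo,
    K%:R * (x * tail x) <= 4 * (tmean x - tmean (x / 2 ^+ K)).
  elim: K => [|K IH].
    by near=> x; rewrite mul0r expr0 divr1 subrr mulr0.
  have rvK : \forall x \near +oo,
      2 ^+ K / 2 <= tail ((2 ^+ K)^-1 * x) / tail x.
    have K0 : 0 < (2 ^+ K)^-1 :> R by rewrite invr_gt0 exprn_gt0.
    apply: (cvgr_ge _ (tail_rv K0)); rewrite invrK.
    by rewrite ltr_pdivrMr// ltr_pMr ?exprn_gt0// ltr1n.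
  near=> x.
  have x0 : 0 < x by [].
  have IHx : K%:R * (x * tail x) <= 4 * (tmean x - tmean (x / 2 ^+ K)).
    by near: x.
  set y := x / 2 ^+ K in IHx.
  have y0 : 0 < y by rewrite divr_gt0// exprn_gt0.
  have -> : x / 2 ^+ K.+1 = y / 2 by rewrite exprSr invfM mulrA.
  have /andP[hy _] : (y - y / 2) * tail y <= tmean y - tmean (y / 2)
      <= (y - y / 2) * tail (y / 2).
    by apply: tmean_incr; lra.
  have : 2 ^+ K / 2 <= tail y / tail x.
    by rewrite /y [x / _]mulrC; near: x.
  rewrite ler_pdivlMr// => ty.
  have xty : x * tail x <= 2 * (y * tail y).
    apply: (@le_trans _ _ (2 * (y * (2 ^+ K / 2 * tail x)))).
      rewrite /y (_ : 2 * _ = x * tail x)//; field.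
      by rewrite expf_neq0.
    by rewrite ler_pM2l// ler_pM2l.
  rewrite -[K.+1%:R]natr1 mulrDl mul1r.
  move: hy IHx xty; rewrite (_ : y - y / 2 = y / 2); last by field.
  rewrite mulrAC; set A := _ * (x * _); set B := x * tail x.
  by set D := y * tail y; lra.
near \oo => K.
have Ke : 4 <= K%:R * e.
  by rewrite -ler_pdivrMr//; near: K; exact: nbhs_infty_ger.
have K0 : (0 < K%:R :> R).
  by rewrite ltNge; apply/negP => K0; move: Ke; rewrite leNgt; move/negP; apply; nra.
apply: filterS2 (shells K) (nbhs_pinfty_gt (num_real 0)) => x sh x0.
have my : 0 <= tmean (x / 2 ^+ K).
  by rewrite tmean_ge0// divr_ge0 ?exprn_ge0// ltW.
rewrite -(ler_pM2l K0) (le_trans sh)// mulrA.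
apply: (@le_trans _ _ (4 * tmean x)); first by rewrite ler_pM2l// gerBl.
by rewrite ler_wpM2r// tmean_ge0// ltW.
Unshelve. all: by end_near. Qed.

Lemma near_scale (c : R) (Q : R -> Prop) : 0 < c ->
  (\forall x \near +oo, Q x) -> \forall x \near +oo, Q (c * x).
Proof. by move=> c0; exact: (gt0_cvgMry c0 (@cvg_id _ _)). Qed.

(** The increment of the truncated mean between [x] and [c * x] is bounded by a
    multiple of the value of [x * tail x] at the smaller threshold. *)
Lemma tmean_sv (c : R) : 0 < c -> tmean (c * x) / tmean x @[x --> +oo] --> (1 : R).
Proof.
move=> c0; apply/cvgrPdist_le => e e0.
have ec : 0 < e / c by rewrite divr_gt0.
have ec' : 0 < e * c by rewrite mulr_gt0.
have near1 := tail_over_tmean ec.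
have near2 := near_scale c0 (tail_over_tmean ec').
near=> x.
have x0 : 0 < x by [].
have m0 : 0 < tmean x by exact: tmean_gt0.
have -> : 1 - tmean (c * x) / tmean x = (tmean x - tmean (c * x)) / tmean x.
  by rewrite mulrBl divff// gt_eqF.
rewrite normrM normfV (gtr0_norm m0) ler_pdivrMr//.
have [c1|c1] := leP 1 c.
- have xcx : x <= c * x by rewrite ler_peMl// ltW.
  rewrite distrC ger0_norm; last by rewrite subr_ge0 le_tmean// ltW.
  have /andP[_ h] := tmean_incr (ltW x0) xcx.
  have nx : x * tail x <= e / c * tmean x by near: x.
  apply: (le_trans h); apply: (@le_trans _ _ (c * (x * tail x))).
    by rewrite mulrA ler_wpM2r ?tail_ge0// gerBl ltW.
  apply: (@le_trans _ _ (c * (e / c * tmean x))); first by rewrite ler_pM2l.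
  by rewrite mulrA mulrCA divff ?mulr1// gt_eqF.
- have cxx : c * x <= x by rewrite ler_piMl// ltW.
  have cx0 : 0 <= c * x by rewrite mulr_ge0// ltW.
  rewrite ger0_norm; last by rewrite subr_ge0 le_tmean.
  have /andP[_ h] := tmean_incr cx0 cxx.
  have nx : c * x * tail (c * x) <= e * c * tmean (c * x) by near: x.
  apply: (le_trans h); apply: (@le_trans _ _ (c^-1 * (c * x * tail (c * x)))).
    by rewrite !mulrA mulVf ?gt_eqF// mul1r ler_wpM2r ?tail_ge0// gerBl.
  apply: (@le_trans _ _ (c^-1 * (e * c * tmean (c * x)))).
    by rewrite ler_pM2l// invr_gt0.
  rewrite (_ : c^-1 * _ = e * tmean (c * x)); last by field; rewrite gt_eqF.
  by rewrite ler_pM2l// le_tmean.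
Unshelve. all: by end_near. Qed.

Lemma near_pinfty_ge (Q : R -> Prop) : (\forall x \near +oo, Q x) ->
  exists2 x0, 0 < x0 & forall x, x0 <= x -> Q x.
Proof.
move=> [M [_ HM]]; exists (`|M| + 1); first by rewrite ltr_wpDl.
by move=> x Mx; apply: HM; apply: lt_le_trans Mx; rewrite ltr_pwDr// ler_norm.
Qed.

(** Doubling the threshold multiplies [x ^+ 2 * tail x] by about 2, hence
    eventually by more than [4 / 3], which absorbs the increments of the
    truncated second moment. *)
Lemma tsquare_bound : exists2 C, 0 < C &
  \forall x \near +oo, tsquare x <= C * (x ^+ 2 * tail x).
Proof.
have two : \forall x \near +oo, 3^-1 <= tail (2 * x) / tail x.
  have two0 : 0 < 2 :> R by [].
  apply: (cvgr_ge _ (tail_rv two0)); lra.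
have [x0 x00 Hx0'] := near_pinfty_ge two.
have Hx0 x : x0 <= x -> tail x <= 3 * tail (2 * x).
  by move=> /Hx0'; rewrite ler_pdivlMr// => h; lra.
pose C := 9 + 4 / tail (2 * x0).
have C0 : 0 < 4 / tail (2 * x0) by rewrite divr_gt0.
exists C; first by rewrite /C; lra.
apply: filterS (nbhs_pinfty_ge (num_real x0)).
apply: (dyadic_induction x00) => [x /andP[x0x xx0]|x x0x IH].
  have xx : 0 < x by exact: lt_le_trans x0x.
  apply: (le_trans (tsquare_le (ltW xx))).
  rewrite mulrCA ler_peMr ?sqr_ge0//.
  apply: (@le_trans _ _ (4 / tail (2 * x0) * tail x)).
    rewrite mulrAC ler_pdivlMr// mul1r.
    by have := tail_noninc xx0; have := tail_ge0 (2 * x0); lra.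
  by rewrite ler_wpM2r ?tail_ge0// /C; lra.
have xx : 0 < x by exact: lt_le_trans x0x.
apply: (le_trans (tsquare_incr (ltW xx))).
have h : x ^+ 2 * tail x <= x ^+ 2 * (3 * tail (2 * x)).
  by rewrite ler_wpM2l ?sqr_ge0// Hx0.
have -> : C * ((2 * x) ^+ 2 * tail (2 * x))
    = C * 4 / 3 * (x ^+ 2 * (3 * tail (2 * x))) by field.
have q0 : 0 <= x ^+ 2 * tail x by rewrite mulr_ge0 ?sqr_ge0 ?tail_ge0.
rewrite -mulrA; move: IH h q0; set q := x ^+ 2 * tail x; set q2 := x ^+ 2 * _.
have C9 : 9 < C by rewrite /C; lra.
by move=> *; nra.
Unshelve. all: by end_near. Qed.

(** A slowly varying function is bounded by every positive power; the exponent
    1 / 10 leaves room in the comparison of the two norming functions. *)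
Lemma tmean_growth : exists2 C, 0 < C &
  \forall x \near +oo, tmean x ^+ 10 <= C * x.
Proof.
have two0 : 0 < 2 :> R by [].
have two : \forall x \near +oo, (tmean (2 * x) / tmean x) ^+ 10 <= 2.
  have : (tmean (2 * x) / tmean x) ^+ 10 @[x --> +oo] --> (1 ^+ 10 : R).
    apply: (@continuous_cvg _ _ _ _ _ _ (fun x : R => x ^+ 10)).
      exact: exprn_continuous.
    exact: tmean_sv.
  by rewrite expr1n => /cvgr_le; apply; rewrite ltr1n.
have [x0 x00 Hx0] := near_pinfty_ge two.
have step x : x0 <= x -> tmean (2 * x) ^+ 10 <= 2 * tmean x ^+ 10.
  move=> x0x; have m0 : 0 < tmean x by apply: tmean_gt0; exact: lt_le_trans x0x.
  by have := Hx0 x x0x; rewrite expr_div_n ler_pdivrMr// exprn_gt0.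
have mx0 : 0 < tmean (2 * x0) by apply: tmean_gt0; rewrite mulr_gt0.
exists (tmean (2 * x0) ^+ 10 / x0); first by rewrite divr_gt0// exprn_gt0.
apply: filterS (nbhs_pinfty_ge (num_real x0)).
apply: (dyadic_induction x00) => [x /andP[x0x xx0]|x x0x IH].
  have xx : 0 < x by exact: lt_le_trans x0x.
  apply: (@le_trans _ _ (tmean (2 * x0) ^+ 10)).
    by rewrite lerXn2r ?nnegrE ?tmean_ge0 ?le_tmean// ltW// mulr_gt0.
  by rewrite mulrAC ler_pdivlMr// ler_wpM2l// exprn_ge0// ltW.
apply: (le_trans (step _ x0x)).
by move: IH; set K := _ / x0; set m := tmean x ^+ 10; lra.
Unshelve. all: by end_near. Qed.

(** Similarly [x * tail x] is slowly varying, hence is bounded below by a small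
    negative power. *)
Lemma tail_growth : exists2 C, 0 < C &
  \forall x \near +oo, 1 <= C * (x * (x * tail x) ^+ 10).
Proof.
have two0 : 0 < 2 :> R by [].
have two : \forall x \near +oo, 2^-1 <= (2 * (tail (2 * x) / tail x)) ^+ 10.
  have : (2 * (tail (2 * x) / tail x)) ^+ 10 @[x --> +oo] --> ((2 * 2^-1) ^+ 10 : R).
    apply: (@continuous_cvg _ _ _ _ _ _ (fun x : R => x ^+ 10)).
      exact: exprn_continuous.
    by apply: cvgM; [exact: cvg_cst|exact: tail_rv].
  rewrite divff// expr1n => /cvgr_ge; apply; lra.
have [x0 x00 Hx0] := near_pinfty_ge two.
have step x : x0 <= x -> (x * tail x) ^+ 10 <= 2 * (2 * x * tail (2 * x)) ^+ 10.
  move=> x0x; have xx : 0 < x by exact: lt_le_trans x0x.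
  have := Hx0 x x0x.
  have -> : 2 * (tail (2 * x) / tail x) = (2 * x * tail (2 * x)) / (x * tail x).
    by field; rewrite !gt_eqF.
  rewrite expr_div_n ler_pdivlMr ?exprn_gt0 ?mulr_gt0//.
  by set u := _ ^+ 10; set v := _ ^+ 10; lra.
pose L := x0 * (x0 * tail (2 * x0)) ^+ 10.
have L0 : 0 < L by rewrite mulr_gt0 ?exprn_gt0 ?mulr_gt0.
exists L^-1; first by rewrite invr_gt0.
apply: filterS (nbhs_pinfty_ge (num_real x0)).
apply: (dyadic_induction x00) => [x /andP[x0x xx0]|x x0x IH].
  have xx : 0 < x by exact: lt_le_trans x0x.
  rewrite mulrC ler_pdivlMr// mul1r; apply: ler_pM => //; first exact: ltW.
    by rewrite exprn_ge0// mulr_ge0 ?tail_ge0// ltW.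
  rewrite lerXn2r ?nnegrE ?mulr_ge0 ?tail_ge0 ?(ltW x00) ?(ltW xx)//.
  by rewrite ler_pM ?tail_ge0 ?tail_noninc// ltW.
have xx : 0 < x by exact: lt_le_trans x0x.
apply: (le_trans IH); rewrite ler_pM2l ?invr_gt0//.
apply: (@le_trans _ _ (x * (2 * (2 * x * tail (2 * x)) ^+ 10))).
  by rewrite ler_pM2l// step.
by rewrite mulrA (mulrC x).
Unshelve. all: by end_near. Qed.

End tail.

(** * Exponential means at small rates *)

Section exponential_bounds.
Context {R : realType}.
Implicit Types u v e : R.

Lemma onesub_expR_ge0 v : 0 <= v -> 0 <= 1 - expR (- v) <= 1.
Proof.
move=> v0; rewrite subr_ge0 -{1}expR0 ler_expR oppr_le0 v0/=.
by rewrite gerBl expR_ge0.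
Qed.

Lemma onesub_expR_le v : 1 - expR (- v) <= v.
Proof. by have := expR_ge1Dx (- v); lra. Qed.

Lemma onesub_expR_ge e v : 0 < e < 1 -> 0 <= v ->
  (1 - e) * Num.min v e <= 1 - expR (- v).
Proof.
move=> /andP[e0 e1] v0.
have key (x : R) : 0 <= x -> x * (1 - x) <= 1 - expR (- x).
  move=> x0; have -> : 1 - expR (- x) = (expR x - 1) * expR (- x).
    by rewrite mulrBl mul1r -expRD subrr expR0.
  have [x1|x1] := leP x 1.
    apply: ler_pM => //; first by rewrite subr_ge0.
      by have := expR_ge1Dx x; lra.
    by have := expR_ge1Dx (- x); lra.
  apply: (@le_trans _ _ 0); first by nra.
  by rewrite mulr_ge0 ?expR_ge0// subr_ge0 -expR0 ler_expR.
rewrite /Num.min; case: ltP => ve.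
  by have := key _ v0; nra.
apply: (@le_trans _ _ (1 - expR (- e))).
  by rewrite mulrC; apply: key; exact: ltW.
by rewrite lerD2l lerN2 ler_expR lerN2.
Qed.

End exponential_bounds.

Section linear_laplace.
Context {d} {T : measurableType d} {R : realType} (P : probability T R).
Variable X : {RV P >-> R}.
Let mX : measurable_fun setT X := measurable_funP X.

Definition pos_part (u : R) : R := Num.max u 0.

Lemma pos_part_ge0 u : 0 <= pos_part u.
Proof. by rewrite le_max lexx orbT. Qed.

Lemma measurable_pos_part : measurable_fun setT (fun w => pos_part (X w)).
Proof. by apply: measurable_maxr => //; exact: measurable_cst. Qed.

Lemma bounded_onesub_expR (f : T -> R) : measurable_fun setT f ->
  (forall w, 0 <= f w) -> bounded_mfun (fun w => 1 - expR (- f w)).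
Proof.
move=> mf f0; apply: bounded_mfun01 => [|w]; last exact: onesub_expR_ge0.
apply: measurable_funB; first exact: measurable_cst.
by apply: (measurableT_comp (@measurable_expR R)); exact: measurable_funN.
Qed.

Variables (a' : R -> R).
Hypothesis tail_rv : forall c : R, 0 < c ->
  tail X (c * x) / tail X x @[x --> +oo] --> c^-1.
Hypothesis tail_gt0 : forall x, 0 < tail X x.
Hypothesis a'_infty : a' t @[t --> +oo] --> +oo.
Hypothesis a'_norm : t / a' t * tmean X (a' t) @[t --> +oo] --> (1 : R).

Let a'_gt0 : \forall t \near +oo, 0 < a' t.
Proof. by move/cvgryPgt : a'_infty; exact. Qed.

Lemma tmean_norm (c : R) : 0 < c ->
  t / a' t * tmean X (c * a' t) @[t --> +oo] --> (1 : R).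
Proof.
move=> c0; rewrite -[X in _ --> X](mulr1 (1 : R)).
have sv := cvg_comp _ _ a'_infty (tmean_sv tail_rv tail_gt0 c0).
apply: cvg_trans (cvgM a'_norm sv); apply: near_eq_cvg; near=> t.
have m0 : 0 < tmean X (a' t) by apply: tmean_gt0 => //; near: t.
by rewrite /= mulrCA mulfK ?gt_eqF// mulrC.
Unshelve. all: by end_near. Qed.

(** The truncated mean enters because [1 - expR (- v)] lies between
    [(1 - e) * min v e] and [min v 1]; its slow variation makes the choice of
    the truncation level irrelevant. *)
Lemma cvg_linear_laplace (s : R) : 0 < s ->
  t * \int[P]_w (1 - expR (- (s * (pos_part (X w) / a' t)))) @[t --> +oo] --> s.
Proof.
move=> s0.
have bE t : 0 < a' t ->
    bounded_mfun (fun w => 1 - expR (- (s * (pos_part (X w) / a' t)))).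
  move=> a0; apply: bounded_onesub_expR => [|w].
    apply: measurable_funM; first exact: measurable_cst.
    by apply: measurable_funM; [exact: measurable_pos_part|exact: measurable_cst].
  by rewrite mulr_ge0 ?(ltW s0)// divr_ge0 ?pos_part_ge0// ltW.
have capE (c A : R) w : 0 < c -> 0 < A ->
    s / A * cap (c / s * A) (X w) = Num.min (s * (pos_part (X w) / A)) c.
  move=> c0 A0; have sA : 0 <= s / A by rewrite divr_ge0// ltW.
  rewrite /cap minr_pMr// [X in Num.min _ X](_ : _ = c).
    by rewrite mulrAC mulrA.
  by field; rewrite !gt_eqF.
have lim (c : R) : 0 < c ->
    t * \int[P]_w (s / a' t * cap (c / s * a' t) (X w)) @[t --> +oo] --> s.
  move=> c0; have cs : 0 < c / s by rewrite divr_gt0.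
  have : s * (t / a' t * tmean X (c / s * a' t)) @[t --> +oo] --> s * 1.
    by apply: cvgM; [exact: cvg_cst|exact: tmean_norm].
  rewrite mulr1; apply: cvg_trans; apply: near_eq_cvg; near=> t.
  rewrite meanZ ?/tmean; first by ring.
  apply: bounded_cap; rewrite mulr_ge0 ?(ltW cs)// ltW//.
  by near: t.
apply/cvgrPdist_lt => e e0.
pose h : R := Num.min 2^-1 (e / (2 * s)).
have h0 : 0 < h.
  by rewrite lt_min; apply/andP; split; [lra|rewrite divr_gt0// mulr_gt0].
have h1 : h < 1 by rewrite gt_min; apply/orP; left; lra.
have hs : h * s <= e / 2.
  apply: (@le_trans _ _ (e / (2 * s) * s)).
    by rewrite ler_pM2r// ge_min lexx orbT.
  by rewrite invfM mulrA mulfVK ?gt_eqF.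
have low : (1 - h) * (t * \int[P]_w (s / a' t * cap (h / s * a' t) (X w)))
    @[t --> +oo] --> (1 - h) * s.
  by apply: cvgM; [exact: cvg_cst|exact: lim].
near=> t.
have a0 : 0 < a' t by near: t.
have t0 : 0 < t by [].
have U : t * \int[P]_w (s / a' t * cap (1 / s * a' t) (X w)) < s + e.
  by near: t; apply: (cvgr_lt _ (lim 1 ltr01)); lra.
have L : s - e < (1 - h) * (t * \int[P]_w (s / a' t * cap (h / s * a' t) (X w))).
  by near: t; apply: (cvgr_gt _ low); lra.
have bcap (c : R) : 0 < c -> bounded_mfun (fun w => s / a' t * cap (c / s * a' t) (X w)).
  move=> c0; apply: bounded_mfunM; first exact: bounded_mfun_cst.
  by apply: bounded_cap; rewrite mulr_ge0// ?divr_ge0// ltW.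
rewrite distrC ltr_norml; apply/andP; split.
- rewrite ltrBrDl; apply: (lt_le_trans L).
  rewrite mulrCA ler_pM2l// -meanZ; last exact: bcap.
  apply: le_mean; [|exact: bE|].
    by apply: bounded_mfunM; [exact: bounded_mfun_cst|exact: bcap].
  move=> w; rewrite capE//; apply: onesub_expR_ge; first by rewrite h0.
  by rewrite mulr_ge0 ?(ltW s0)// divr_ge0 ?pos_part_ge0// ltW.
- rewrite ltrBlDl; apply: le_lt_trans U.
  rewrite ler_pM2l//; apply: le_mean; [exact: bE|exact: bcap|move=> w].
  rewrite capE// le_min onesub_expR_le gerBl expR_ge0//.
Unshelve. all: by end_near. Qed.

End linear_laplace.

Section gauss_layers.
Context {R : realType}.
Local Notation mu := (@lebesgue_measure R).

(** The derivative of [1 - gauss_fun], that is the density of the layers in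
    [1 - gauss_fun v]. *)
Definition gauss_slope (y : R) : R := 2 * y * gauss_fun y.

Lemma continuous_gauss_slope : continuous gauss_slope.
Proof.
move=> y; apply: cvgM; last exact: continuous_gauss_fun.
by apply: cvgM; [exact: cvg_cst|exact: cvg_id].
Qed.

Lemma is_derive_gauss (y : R) : is_derive y 1 (fun y => - gauss_fun y) (gauss_slope y).
Proof.
rewrite /gauss_slope /gauss_fun.
apply: is_derive_eq.
by rewrite /GRing.scale/= ?mulr1; ring.
Qed.

Lemma integral_gauss_slope (e v : R) : e < v ->
  (\int[mu]_(y in `]e, v[) (gauss_slope y)%:E
     = (gauss_fun e - gauss_fun v)%:E)%E.
Proof.
move=> ev.
have ms (D : set R) : measurable_fun D gauss_slope.
  by apply: measurable_funTS; apply: continuous_measurable_fun;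
     exact: continuous_gauss_slope.
rewrite integral_itv_obnd_cbnd; last exact/measurable_EFinP.
rewrite integral_itv_bndo_bndc; last exact/measurable_EFinP.
rewrite (@continuous_FTC2 _ _ (fun y => - gauss_fun y))//.
- by rewrite -EFinB opprK addrC.
- by apply: continuous_subspaceT; exact: continuous_gauss_slope.
- split.
  + by move=> y _; exact: (@ex_derive _ _ _ _ _ _ _ (is_derive_gauss y)).
  + by apply: cvg_at_right_filter; apply: cvgN; exact: continuous_gauss_fun.
  + by apply: cvg_at_left_filter; apply: cvgN; exact: continuous_gauss_fun.
- by move=> y _; rewrite derive1E; exact: (@derive_val _ _ _ _ _ _ _ (is_derive_gauss y)).
Qed.

Lemma integrable_gauss_slope (e : R) : 0 < e ->
  mu.-integrable `]e, +oo[ (EFin \o gauss_slope).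
Proof.
move=> e0.
have ms (D : set R) : measurable_fun D gauss_slope.
  by apply: measurable_funTS; apply: continuous_measurable_fun;
     exact: continuous_gauss_slope.
have s0 y : e <= y -> 0 <= gauss_slope y.
  move=> ey; rewrite /gauss_slope mulr_ge0 ?gauss_fun_ge0// mulr_ge0//; lra.
apply/integrableP; split; first by apply/measurable_EFinP; exact: ms.
have -> : (\int[mu]_(y in `]e, +oo[) `|(EFin \o gauss_slope) y|
    = \int[mu]_(y in `]e, +oo[) (gauss_slope y)%:E)%E.
  apply: eq_integral => y; rewrite inE/= in_itv/= andbT => ey.
  by rewrite /= ger0_norm// s0// ltW.
rewrite integral_itv_obnd_cbnd; last exact/measurable_EFinP.
rewrite (@ge0_continuous_FTC2y _ _ (fun y => - gauss_fun y) _ 0)//.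
- by rewrite ltry.
- by apply: continuous_subspaceT; exact: continuous_gauss_slope.
- by rewrite -oppr0; apply: cvgN; exact: cvg_gauss_fun.
- by apply: cvg_at_right_filter; apply: cvgN; exact: continuous_gauss_fun.
- by move=> y _; rewrite derive1E; exact: (@derive_val _ _ _ _ _ _ _ (is_derive_gauss y)).
Qed.

(** The part of [1 - gauss_fun v] made of the layers beyond [e], where the
    rescaled tail is bounded. *)
Definition gauss_cut (e v : R) : R :=
  if e < v then gauss_fun e - gauss_fun v else 0.

Lemma integral_gauss_cut (e v : R) :
  (\int[mu]_(y in `]e, +oo[) (gauss_slope y * (y < v)%R%:R)%:E
     = (gauss_cut e v)%:E)%E.
Proof.
rewrite /gauss_cut; case: ltP => ev; last first.
  apply: integral0_eq => y; rewrite /= in_itv/= andbT => ey.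
  by rewrite ltNge (le_trans ev (ltW ey))/= mulr0.
rewrite -integral_gauss_slope//.
have -> : `]e, v[%classic = `]e, +oo[%classic `&` [set y | y < v] :> set R.
  by apply/seteqP; split => y; rewrite /= !in_itv/= andbT => /andP.
rewrite integral_mkcondr; apply: eq_integral => y _.
rewrite patchE; case: ifPn; rewrite ?inE ?notin_setE/= => yv.
  by rewrite yv mulr1.
by rewrite (negbTE (introN idP yv)) mulr0.
Qed.

(** Half of the Gaussian integral, up to the layers below [e], on which the
    Gaussian is at most 1. *)
Lemma integral_gauss_ge (e : R) : 0 < e ->
  Num.sqrt pi / 2 - e <= \int[mu]_(y in `]e, +oo[) gauss_fun y
    <= Num.sqrt pi / 2.
Proof.
move=> e0.
have ig D : measurable D -> mu.-integrable D (EFin \o (@gauss_fun R)).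
  by move=> mD; apply: (integrableS measurableT mD) => //; exact: integrableT_gauss.
have half : \int[mu]_(y in `[0, +oo[) (gauss_fun y : R) = Num.sqrt pi / 2.
  by rewrite /Rintegral integral0y_gauss.
have <- : \int[mu]_(y in `[0, +oo[) (gauss_fun y : R) -
    \int[mu]_(y in `[0, e]) gauss_fun y = \int[mu]_(y in `]e, +oo[) gauss_fun y.
  apply: Rintegral_itvB => //; first exact: ig.
  by rewrite bnd_simp ltW.
rewrite half; set I := Rintegral _ _ _.
have I0 : 0 <= I by apply: Rintegral_ge0 => y _; exact: gauss_fun_ge0.
have Ie : I <= e.
  have : I <= \int[mu]_(y in `[0, e]) (1 : R).
    apply: le_Rintegral => //.
    - exact: ig.
    - by apply: continuous_compact_integrable;
        [exact: segment_compact|apply: continuous_subspaceT => y; exact: cvg_cst].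
    - by move=> y _; exact: gauss_fun_le1.
  have mu0e : fine (mu `[0, e]%classic) = e.
    by rewrite lebesgue_measure_itv/= lte_fin e0 oppr0 adde0.
  rewrite Rintegral_cst// mul1r => /le_trans; apply.
  by rewrite le_eqVlt; apply/orP; left; apply/eqP; exact: mu0e.
lra.
Qed.

End gauss_layers.

Section layer_cake.
Context {d} {T : measurableType d} {R : realType} (P : probability T R).
Local Notation mu := (@lebesgue_measure R).

Lemma measurable_ltr_indic d1 (T1 : measurableType d1) (f g : T1 -> R) :
  measurable_fun setT f -> measurable_fun setT g ->
  measurable_fun setT (fun z => (f z < g z)%R%:R : R).
Proof.
move=> mf mg.
rewrite (_ : (fun z => _) = \1_[set z | f z < g z]).
  apply: measurable_indic.
  have := measurable_fun_ltr mf mg.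
  by move=> /(_ measurableT [set true]); rewrite setTI; exact.
by apply/funext => z; rewrite indicE mem_setE.
Qed.

(** Tonelli's theorem for the region under the graph of [Y]. *)
Lemma layer_cake (h : R -> R) (D : set R) (Y : T -> R) :
  measurable D -> measurable_fun setT h -> (forall y, D y -> 0 <= h y) ->
  measurable_fun setT Y ->
  (\int[P]_w \int[mu]_(y in D) (h y * (y < Y w)%R%:R)%:E =
   \int[mu]_(y in D) (h y * \int[P]_w ((y < Y w)%R%:R : R))%:E)%E.
Proof.
move=> mD mh h0 mY.
pose f (z : T * measurableTypeR R) : \bar R :=
  (h z.2 * \1_D z.2 * (z.2 < Y z.1)%R%:R)%:E.
have f0 z : (0 <= f z)%E.
  rewrite lee_fin mulr_ge0// indicE.
  by have [/[!inE] Dz|_] := boolP (z.2 \in D); rewrite ?mulr0// mulr1 h0.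
have mf : measurable_fun setT f.
  apply/measurable_EFinP; apply: measurable_funM.
    apply: (measurableT_comp (f := fun y : R => h y * \1_D y)) => //.
    by apply: measurable_funM => //; exact: measurable_indic.
  apply: measurable_ltr_indic => //.
  exact: (measurableT_comp mY).
have := fubini_tonelli (m1 := P) (m2 := mu) f mf f0.
rewrite (_ : (\int[P]_w _)%E = (\int[P]_w \int[mu]_(y in D) (h y * (y < Y w)%R%:R)%:E)%E).
  move=> ->; rewrite [RHS]integral_mkcond; apply: eq_integral => y _.
  rewrite patchE /f /=; case: ifPn => yD; last first.
    rewrite integral0_eq// => w _.
    by rewrite indicE (negbTE yD) mulr0 mul0r.
  rewrite indicE yD mulr1.
  rewrite -meanZ; last first.
    apply: bounded_mfun01 => [|w].
      by apply: measurable_ltr_indic => //; exact: measurable_cst.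
    by case: (_ < _); rewrite lexx ler01.
  rewrite /Rintegral fineK//.
  apply: integrable_fin_num => //; apply: bounded_mfun_integrable.
  apply: bounded_mfunM; first exact: bounded_mfun_cst.
  apply: bounded_mfun01 => [|w].
    by apply: measurable_ltr_indic => //; exact: measurable_cst.
  by case: (_ < _); rewrite lexx ler01.
apply: eq_integral => w _; rewrite [RHS]integral_mkcond.
apply: eq_integral => y _; rewrite patchE /f /= indicE.
by case: ifPn => yD; rewrite ?mulr1// mulr0 mul0r.
Qed.

End layer_cake.

Section quadratic_laplace.
Context {d} {T : measurableType d} {R : realType} (P : probability T R).
Variable X : {RV P >-> R}.
Local Notation mu := (@lebesgue_measure R).
Let mX : measurable_fun setT X := measurable_funP X.

Hypothesis tail_rv : forall c : R, 0 < c ->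
  tail X (c * x) / tail X x @[x --> +oo] --> c^-1.
Hypothesis tail_gt0 : forall x, 0 < tail X x.
Variables (b : R -> R) (c : R).
Hypothesis c_gt0 : 0 < c.
Hypothesis b_ge0 : forall t, 0 <= b t.
Hypothesis b_infty : b t @[t --> +oo] --> +oo.
Hypothesis b_tail : forall z, 0 < z -> t * tail X (b t * z) @[t --> +oo] --> c / z.

Let b_gt0 : \forall t \near +oo, 0 < b t.
Proof. by move/cvgryPgt : b_infty; exact. Qed.

Lemma measurable_tail_scale (k : R) : measurable_fun setT (fun y => tail X (k * y)).
Proof.
have mt : measurable_fun setT (tail X).
  by apply: nonincreasing_measurable => // x y *; exact: tail_noninc.
apply: (measurableT_comp mt).
by apply: measurable_funM => //; exact: measurable_cst.
Qed.

(** The layers below [e] contribute at most the square of [v] truncated at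
    [e]. *)
Lemma gauss_cut_le (e v : R) : 0 < e -> 0 <= v ->
  0 <= gauss_cut e v <= 1 - gauss_fun v /\
  1 - gauss_fun v <= gauss_cut e v + Num.min v e ^+ 2.
Proof.
move=> e0 v0.
have g01 (u : R) : 0 <= gauss_fun u <= 1 by rewrite gauss_fun_ge0 gauss_fun_le1.
have gu (u : R) : 1 - gauss_fun u <= u ^+ 2 by exact: onesub_expR_le.
have /andP[gv0 gv1] := g01 v; have /andP[ge0 ge1] := g01 e.
rewrite /gauss_cut /Num.min; case: ltP => ev.
  have gev : gauss_fun v <= gauss_fun e.
    by rewrite ler_expR lerN2 lerXn2r ?nnegrE ?(ltW e0) ?(ltW ev).
  rewrite ltNge (ltW ev)/=; have := gu e.
  by split; [apply/andP; split|]; lra.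
rewrite lexx subr_ge0 gv1; split => //; rewrite add0r.
case: ltP => ve; first exact: gu.
by rewrite (_ : e = v) ?gu//; apply/le_anti; rewrite ve ev.
Qed.

Lemma measurable_gauss_cut (e : R) : measurable_fun setT (gauss_cut e).
Proof.
rewrite (_ : gauss_cut e =
    fun v => (e < v)%R%:R * (gauss_fun e - gauss_fun v)).
  apply: measurable_funM.
    by apply: measurable_ltr_indic => //; exact: measurable_cst.
  apply: measurable_funB; first exact: measurable_cst.
  exact: measurable_gauss_fun.
by apply/funext => v; rewrite /gauss_cut; case: ifP; rewrite ?mul1r ?mul0r.
Qed.

Let mXb t : measurable_fun setT (fun w => X w / b t).
Proof. by apply: measurable_funM => //; exact: measurable_cst. Qed.

Lemma mean_gauss_cut (e t : R) : 0 < e -> 0 < b t ->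
  t * \int[P]_w gauss_cut e (X w / b t) =
  \int[mu]_(y in `]e, +oo[) (gauss_slope y * (t * tail X (b t * y))).
Proof.
move=> e0 b0.
have sl0 y : e < y -> 0 <= gauss_slope y.
  by move=> ey; rewrite /gauss_slope mulr_ge0 ?gauss_fun_ge0// mulr_ge0//; lra.
have msl D : measurable_fun D (@gauss_slope R).
  by apply: measurable_funTS; apply: continuous_measurable_fun;
     exact: continuous_gauss_slope.
have tE y : \int[P]_w ((y < X w / b t)%R%:R : R) = tail X (b t * y).
  rewrite tailE; apply: eq_Rintegral => w _.
  by rewrite indic_gt ltr_pdivlMr// mulrC.
have -> : \int[P]_w gauss_cut e (X w / b t) =
    \int[mu]_(y in `]e, +oo[) (gauss_slope y * tail X (b t * y)).
  have LC := @layer_cake _ _ _ P gauss_slope `]e, +oo[%classic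
    (fun w => X w / b t) _ (msl _) _ (mXb t).
  congr fine; transitivity (\int[P]_w \int[mu]_(y in `]e, +oo[)
      (gauss_slope y * (y < X w / b t)%R%:R)%:E)%E.
    by apply: eq_integral => w _; rewrite integral_gauss_cut.
  rewrite LC//; first by apply: eq_integral => y _; rewrite tE.
  by move=> y; rewrite /= in_itv/= andbT => /sl0.
rewrite -RintegralZl//.
  by apply: eq_Rintegral => y _; rewrite mulrCA.
apply: (le_integrable _ _ _ (integrable_gauss_slope e0)) => //.
  apply/measurable_EFinP; apply: measurable_funM; first exact: msl.
  by apply: measurable_funTS; exact: measurable_tail_scale.
move=> y; rewrite /= in_itv/= andbT => ey.
rewrite lee_fin normrM ler_piMr// ger0_norm ?tail_ge0// tailE.
rewrite -[leRHS](mean_cst P); apply: le_mean; [exact: bounded_gt|exact: bounded_mfun_cst|].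
by move=> w; rewrite indic_gt; case: (_ < _).
Qed.

(** The rescaled tail tends to [c / y], and [gauss_slope y / y] is twice the
    Gaussian function, which is where [Num.sqrt pi] comes from. *)
Lemma cvg_gauss_cut (e : R) : 0 < e ->
  t * \int[P]_w gauss_cut e (X w / b t) @[t --> +oo] -->
  c * (2 * \int[mu]_(y in `]e, +oo[) gauss_fun y).
Proof.
move=> e0.
have sl0 y : e < y -> 0 <= gauss_slope y.
  by move=> ey; rewrite /gauss_slope mulr_ge0 ?gauss_fun_ge0// mulr_ge0//; lra.
have msl D : measurable_fun D (@gauss_slope R).
  by apply: measurable_funTS; apply: continuous_measurable_fun;
     exact: continuous_gauss_slope.
have ig D : measurable D -> mu.-integrable D (EFin \o (@gauss_fun R)).
  by move=> mD; apply: (integrableS measurableT mD) => //; exact: integrableT_gauss.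
suff : \int[mu]_(y in `]e, +oo[) (gauss_slope y * (t * tail X (b t * y)))
    @[t --> +oo] --> c * (2 * \int[mu]_(y in `]e, +oo[) gauss_fun y).
  apply: cvg_trans; apply: near_eq_cvg; near=> t.
  by rewrite mean_gauss_cut//; near: t.
apply/cvg_pinftyP => u uoo.
have [M HM] : exists M, forall n, `|u n * tail X (b (u n) * e)| <= M.
  have : bounded_fun (fun n => u n * tail X (b (u n) * e)).
    apply: cvg_seq_bounded; apply/cvg_ex; exists (c / e).
    exact: (cvg_comp _ _ uoo (b_tail e0)).
  case=> M [_ HM]; exists (`|M| + 1) => n.
  by apply: (HM (`|M| + 1)); rewrite // ltr_pwDr// ler_norm.
have lim := @dominated_convergence _ _ _ mu `]e, +oo[%classic _
  (fun n y => (gauss_slope y * (u n * tail X (b (u n) * y)))%:E)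
  (fun y => (2 * c * gauss_fun y)%:E) (fun y => (gauss_slope y * M)%:E).
have [||||||_ _ cv] := lim.
- by [].
- move=> n; apply/measurable_EFinP; apply: measurable_funM; first exact: msl.
  apply: measurable_funM; first exact: measurable_cst.
  by apply: measurable_funTS; exact: measurable_tail_scale.
- apply/measurable_EFinP; apply: measurable_funM; first exact: measurable_cst.
  by apply: measurable_funTS; exact: measurable_gauss_fun.
- apply: aeW => y; rewrite /= in_itv/= andbT => ey.
  have y0 : 0 < y by exact: lt_trans ey.
  apply: cvg_EFin; first exact: nearW.
  rewrite (_ : 2 * c * gauss_fun y = gauss_slope y * (c / y)); last first.
    by rewrite /gauss_slope; field; rewrite gt_eqF.
  apply: cvgM; first exact: cvg_cst.
  exact: (cvg_comp _ _ uoo (b_tail y0)).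
- by apply: (integrableZr _ M (integrable_gauss_slope e0)).
- apply: aeW => y n; rewrite /= in_itv/= andbT => ey.
  rewrite lee_fin normrM (ger0_norm (sl0 _ ey)) ler_wpM2l ?sl0//.
  apply: le_trans (HM n); rewrite !normrM ler_wpM2l// !ger0_norm ?tail_ge0//.
  by apply: tail_noninc; rewrite ler_wpM2l// ltW.
rewrite (_ : c * _ = fine (\int[mu]_(x in `]e, +oo[) (2 * c * gauss_fun x)%:E)%E).
  apply: fine_cvg; rewrite fineK//.
  apply: integrable_fin_num => //.
  by apply: (integrableZl _ (2 * c) (ig _ _)).
rewrite mulrA (mulrC c) -RintegralZl//; exact: ig.
Unshelve. all: by end_near. Qed.

(** The region where [X] is small relative to [b t] is negligible by the bound
    on truncated second moments; elsewhere the tail is dominated by a multiple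
    of [1 / t] and the limit passes under the Gaussian integral. *)
Lemma cvg_quadratic_laplace :
  t * \int[P]_w (1 - gauss_fun (pos_part (X w) / b t)) @[t --> +oo]
    --> c * Num.sqrt pi.
Proof.
have [C C0 HC] := tsquare_bound tail_rv tail_gt0.
have bg t : bounded_mfun (fun w => 1 - gauss_fun (pos_part (X w) / b t)).
  apply: bounded_onesub_expR => [|w]; last exact: sqr_ge0.
  apply: measurable_funX; apply: measurable_funM; last exact: measurable_cst.
  exact: measurable_pos_part.
have cutE e t w : 0 < e ->
    gauss_cut e (X w / b t) = gauss_cut e (pos_part (X w) / b t).
  move=> e0; rewrite /pos_part /Num.max; case: ltP => // X0.
  rewrite /gauss_cut mul0r [in RHS]ltNge (ltW e0)/= ltNge (le_trans _ (ltW e0))//.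
  by rewrite mulr_le0_ge0 ?invr_ge0// ltW.
have bcut e t : 0 < e -> bounded_mfun (fun w => gauss_cut e (X w / b t)).
  move=> e0; apply: bounded_mfun01 => [|w].
    by apply: (measurableT_comp (measurable_gauss_cut e)).
  rewrite cutE//.
  have pb0 : 0 <= pos_part (X w) / b t by rewrite divr_ge0// pos_part_ge0.
  have [/andP[-> h] _] := gauss_cut_le e0 pb0.
  by apply: (le_trans h); rewrite gerBl gauss_fun_ge0.
apply/cvgrPdist_lt => e e0.
pose h := e / (4 * c + 2 * C * c).
have den : 0 < 4 * c + 2 * C * c by rewrite addr_gt0 ?mulr_gt0.
have h0 : 0 < h by rewrite divr_gt0.
have hE : h * (4 * c + 2 * C * c) = e by rewrite mulfVK// gt_eqF.
have lowlim := cvg_gauss_cut h0.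
have uplim : t * \int[P]_w gauss_cut h (X w / b t)
      + C * h ^+ 2 * (t * tail X (b t * h)) @[t --> +oo]
    --> c * (2 * \int[mu]_(y in `]h, +oo[) gauss_fun y) + C * h ^+ 2 * (c / h).
  by apply: cvgD => //; apply: cvgM; [exact: cvg_cst|exact: b_tail].
rewrite (_ : C * h ^+ 2 * (c / h) = C * h * c) in uplim; last first.
  by field; rewrite gt_eqF.
have /andP[J1 J2] := integral_gauss_ge h0.
set J := Rintegral _ _ _ in J1 J2 lowlim uplim.
have cJ1 : c * (Num.sqrt pi / 2 - h) <= c * J by rewrite ler_pM2l.
have cJ2 : c * J <= c * (Num.sqrt pi / 2) by rewrite ler_pM2l.
have hc : 0 < h * c by rewrite mulr_gt0.
have hCc : 0 < C * h * c by rewrite mulr_gt0// mulr_gt0.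
have hE' : 4 * (h * c) + 2 * (C * h * c) = e by rewrite -hE; ring.
have Qb : \forall t \near +oo, tsquare X (h * b t)
    <= C * ((h * b t) ^+ 2 * tail X (h * b t)).
  have Q1 := near_scale h0 HC; have Q2 := b_infty Q1; exact: Q2.
near=> t.
have b0 : 0 < b t by near: t.
have t0 : 0 < t by [].
have L : c * Num.sqrt pi - e < t * \int[P]_w gauss_cut h (X w / b t).
  by near: t; apply: (cvgr_gt _ lowlim); lra.
have U : t * \int[P]_w gauss_cut h (X w / b t)
      + C * h ^+ 2 * (t * tail X (b t * h)) < c * Num.sqrt pi + e.
  by near: t; apply: (cvgr_lt _ uplim); lra.
rewrite distrC ltr_distl; apply/andP; split.
  apply: (lt_le_trans L); rewrite ler_pM2l//; apply: le_mean => // [|w].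
    exact: bcut.
  rewrite cutE//.
  have pb0 : 0 <= pos_part (X w) / b t by rewrite divr_ge0// pos_part_ge0.
  by have [/andP[_ ->] _] := gauss_cut_le h0 pb0.
have hb0 : 0 <= h * b t by rewrite mulr_ge0// ltW.
have bsq : bounded_mfun (fun w => (b t ^+ 2)^-1 * cap (h * b t) (X w) ^+ 2).
  apply: bounded_mfunM; first exact: bounded_mfun_cst.
  by apply: bounded_mfunX; exact: bounded_cap.
apply: le_lt_trans U.
apply: (@le_trans _ _ (t * (\int[P]_w (gauss_cut h (X w / b t)
    + (b t ^+ 2)^-1 * cap (h * b t) (X w) ^+ 2)))).
  rewrite ler_pM2l//; apply: le_mean => // [|w].
    by apply: bounded_mfunD => //; exact: bcut.
  rewrite cutE//.
  have pb0 : 0 <= pos_part (X w) / b t by rewrite divr_ge0// pos_part_ge0.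
  have [_ h2] := gauss_cut_le h0 pb0; apply: (le_trans h2).
  rewrite lerD2l -exprVn -exprMn /cap minr_pMr ?invr_ge0//.
  by rewrite mulrC mulrCA mulVf ?mulr1 ?gt_eqF.
rewrite meanD//; last exact: bcut.
rewrite meanZ; last by apply: bounded_mfunX; exact: bounded_cap.
rewrite mulrDr lerD2l.
have Qbt : tsquare X (h * b t) <= C * ((h * b t) ^+ 2 * tail X (h * b t)).
  by near: t; exact: Qb.
rewrite [leRHS]mulrCA ler_pM2l// mulrC ler_pdivrMr ?exprn_gt0//.
apply: (le_trans Qbt); rewrite (mulrC (b t) h) exprMn.
by rewrite le_eqVlt; apply/orP; left; apply/eqP; ring.
Unshelve. all: by end_near. Qed.

End quadratic_laplace.

(** * The joint Laplace transform of one normalized summand *)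

Section joint_rate.
Context {d} {T : measurableType d} {R : realType} (P : probability T R).
Variable X : {RV P >-> R}.
Let mX : measurable_fun setT X := measurable_funP X.

Hypothesis tail_rv : forall c : R, 0 < c ->
  tail X (c * x) / tail X x @[x --> +oo] --> c^-1.
Hypothesis tail_gt0 : forall x, 0 < tail X x.
Variables a a' : R -> R.
Hypothesis a_ge0 : forall t, 0 <= a t.
Hypothesis a'_ge0 : forall t, 0 <= a' t.
Hypothesis a_infty : a t @[t --> +oo] --> +oo.
Hypothesis a'_infty : a' t @[t --> +oo] --> +oo.
Hypothesis a_norm : t * tail X (a t) @[t --> +oo] --> (1 : R).
Hypothesis a'_norm : t / a' t * tmean X (a' t) @[t --> +oo] --> (1 : R).

Let a_gt0 : \forall t \near +oo, 0 < a t.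
Proof. by move/cvgryPgt : a_infty; exact. Qed.

Let a'_gt0 : \forall t \near +oo, 0 < a' t.
Proof. by move/cvgryPgt : a'_infty; exact. Qed.

Lemma tail_norm (z : R) : 0 < z -> t * tail X (a t * z) @[t --> +oo] --> z^-1.
Proof.
move=> z0.
have sv := cvg_comp _ _ a_infty (tail_rv z0).
rewrite -[X in _ --> X]mul1r.
apply: cvg_trans (cvgM a_norm sv); apply: near_eq_cvg; apply: nearW => t.
by rewrite /= (mulrC (a t) z); field; rewrite gt_eqF.
Qed.

Let t_tail_ge : \forall t \near +oo, 2^-1 <= t * tail X (a t).
Proof. by apply: (cvgr_ge _ a_norm); lra. Qed.

Let t_tail_le : \forall t \near +oo, t * tail X (a t) <= 2.
Proof. by apply: (cvgr_le _ a_norm); lra. Qed.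

Let t_tmean_ge : \forall t \near +oo, a' t <= 2 * t * tmean X (a' t).
Proof.
have h : \forall t \near +oo, 2^-1 <= t / a' t * tmean X (a' t).
  by apply: (cvgr_ge _ a'_norm); lra.
near=> t; have a0 : 0 < a' t by near: t.
have : 2^-1 <= t / a' t * tmean X (a' t) by near: t.
rewrite mulrAC ler_pdivlMr//; set u := t * _.
by rewrite -mulrA -/u; lra.
Unshelve. all: by end_near. Qed.

Let t_tmean_le : \forall t \near +oo, t * tmean X (a' t) <= 2 * a' t.
Proof.
have h : \forall t \near +oo, t / a' t * tmean X (a' t) <= 2.
  by apply: (cvgr_le _ a'_norm); lra.
near=> t; have a0 : 0 < a' t by near: t.
have : t / a' t * tmean X (a' t) <= 2 by near: t.
by rewrite mulrAC ler_pdivrMr.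
Unshelve. all: by end_near. Qed.

(** If [a' t] were at most [K * a t], monotonicity of [x / tmean x] would bound
    [tmean (a t)] by a multiple of [a t * tail (a t)], against
    [tail_over_tmean]. *)
Lemma a_over_a' : a t / a' t @[t --> +oo] --> (0 : R).
Proof.
apply/cvgr0Pnorm_le => e e0.
pose K := 1 + e^-1.
have K0 : 0 < K by rewrite /K addr_gt0// invr_gt0.
have K1 : 1 <= K by rewrite /K lerDl invr_ge0 ltW.
have k0 : 0 < (8 * K)^-1 by rewrite invr_gt0 mulr_gt0.
have smallE := tail_over_tmean tail_rv tail_gt0 k0.
have small : \forall t \near +oo,
    a t * tail X (a t) <= (8 * K)^-1 * tmean X (a t) := a_infty smallE.
near=> t.
have a0 : 0 < a t by near: t.
have a'0 : 0 < a' t by near: t.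
have t0 : 0 < t by [].
rewrite ger0_norm ?divr_ge0//.
suff Ka : K * a t <= a' t.
  rewrite ler_pdivrMr//.
  have : e * (K * a t) <= e * a' t by rewrite ler_pM2l.
  apply: le_trans; rewrite mulrA ler_peMl ?(ltW a0)//.
  by rewrite /K mulrDr mulr1 divff ?gt_eqF// lerDr ltW.
rewrite leNgt; apply/negP => Ka.
have sm : a t * tail X (a t) <= (8 * K)^-1 * tmean X (a t) by near: t.
have tg : 2^-1 <= t * tail X (a t) by near: t.
have tm : t * tmean X (a' t) <= 2 * a' t by near: t.
have m0 : 0 < tmean X (a t) by apply: tmean_gt0.
have aKa : a t <= K * a t by rewrite ler_peMl// ltW.
have mm : tmean X (a t) <= tmean X (K * a t) by rewrite le_tmean// ltW.
have sc := tmean_scale X a'0 (ltW Ka).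
have h1 : a' t * (t * tmean X (a t)) <= a' t * (2 * (K * a t)).
  apply: (@le_trans _ _ (t * (a' t * tmean X (K * a t)))).
    by rewrite mulrCA ler_pM2l// ler_pM2l.
  apply: (@le_trans _ _ (t * (K * a t * tmean X (a' t)))); first by rewrite ler_pM2l.
  have -> : t * (K * a t * tmean X (a' t)) = K * a t * (t * tmean X (a' t)).
    by ring.
  have -> : a' t * (2 * (K * a t)) = K * a t * (2 * a' t) by ring.
  by rewrite ler_pM2l// mulr_gt0.
rewrite ler_pM2l// in h1.
have h2 : t * (8 * K * (a t * tail X (a t))) <= t * tmean X (a t).
  by rewrite ler_pM2l// -ler_pdivlMl ?mulr_gt0.
have h3 : 8 * K * a t * (t * tail X (a t)) <= 2 * (K * a t).
  by apply: le_trans h1; apply: le_trans h2; rewrite le_eqVlt; apply/orP; left; apply/eqP; ring.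
have h4 : 8 * K * a t * 2^-1 <= 8 * K * a t * (t * tail X (a t)).
  by rewrite ler_pM2l// !mulr_gt0.
have Kat : 0 < K * a t by rewrite mulr_gt0.
by move: h3 h4; rewrite -!(mulrA 8); set z := K * a t; move: Kat; rewrite -/z; lra.
Unshelve. all: by end_near. Qed.

(** Slow variation bounds both [tmean (a' t)] and [a t * tail (a t)] by small
    powers, which makes the squared ratio of the norming functions grow less
    than linearly.  With [m] and [L] for these two quantities and [B] for the
    whole expression, [B * t * L ^+ 2 <= 16 * m ^+ 2]; the tenth-power bounds on
    [m] and [L] turn this into [(B * t) ^+ 5 <= C * (a t * a' t)], and since
    [a t ^+ 9] and [a' t ^+ 9] are at most multiples of [t ^+ 10], [(B * t) ^+ 45]
    is at most a multiple of [t ^+ 20]. *)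
Lemma a'_sq_over : a' t ^+ 2 / (t * a t ^+ 2) @[t --> +oo] --> (0 : R).
Proof.
have [C C0 HC] := tmean_growth tail_rv tail_gt0.
have [D D0 HD] := tail_growth tail_rv tail_gt0.
have g1 : \forall t \near +oo, tmean X (a' t) ^+ 10 <= C * a' t := a'_infty HC.
have g2 : \forall t \near +oo, tmean X (a t) ^+ 10 <= C * a t := a_infty HC.
have g3 : \forall t \near +oo, 1 <= D * (a t * (a t * tail X (a t)) ^+ 10)
  := a_infty HD.
pose E := 2 ^+ 10 * C; have E0 : 0 < E by rewrite mulr_gt0.
pose K := (16 ^+ 5 * C * D) ^+ 9 * (E * E).
have K0 : 0 < K by rewrite mulr_gt0 ?exprn_gt0 ?mulr_gt0// exprn_gt0.
apply/cvgr0Pnorm_le => e e0.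
near=> t.
have a0 : 0 < a t by near: t.
have a'0 : 0 < a' t by near: t.
have t1 : 1 <= t by near: t; exact: nbhs_pinfty_ge (num_real _).
have t0 : 0 < t by exact: lt_le_trans t1.
have tK : K / e ^+ 45 <= t by near: t; exact: nbhs_pinfty_ge (num_real _).
have f1 : a' t <= 2 * t * tmean X (a' t) by near: t.
have f2 : tmean X (a' t) ^+ 10 <= C * a' t by near: t.
have f3 : tmean X (a t) ^+ 10 <= C * a t by near: t.
have f4 : 1 <= D * (a t * (a t * tail X (a t)) ^+ 10) by near: t.
have f5 : 2^-1 <= t * tail X (a t) by near: t.
have f6 : t * tail X (a t) <= 2 by near: t.
set m := tmean X (a' t) in f1 f2; set L := a t * tail X (a t) in f4.
have m0 : 0 <= m by exact: tmean_ge0.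
have L0 : 0 < L by rewrite /L mulr_gt0.
have f7 : a t <= 2 * t * L.
  have -> : 2 * t * L = 2 * (t * tail X (a t)) * a t by rewrite /L; ring.
  by rewrite ler_peMl ?(ltW a0)//; lra.
have f8 : t * L <= 2 * a t.
  have -> : t * L = t * tail X (a t) * a t by rewrite /L; ring.
  by rewrite ler_pM2r.
set B := a' t ^+ 2 / (t * a t ^+ 2).
have B0 : 0 <= B by rewrite divr_ge0 ?sqr_ge0// mulr_ge0 ?sqr_ge0// ltW.
rewrite ger0_norm//.
have pow9 u v : 0 < u -> 0 <= v -> u <= 2 * t * v -> v ^+ 10 <= C * u ->
    u ^+ 9 <= E * t ^+ 10.
  move=> u0 v0 uv vu.
  have : u ^+ 10 <= E * t ^+ 10 * u.
    apply: (@le_trans _ _ ((2 * t * v) ^+ 10)).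
      by rewrite lerXn2r ?nnegrE ?mulr_ge0// ltW.
    have -> : E * t ^+ 10 * u = (2 * t) ^+ 10 * (C * u).
      by rewrite /E; ring.
    by rewrite exprMn ler_pM2l// exprn_gt0// mulr_gt0.
  by rewrite exprSr ler_pM2r.
have a9 : a t ^+ 9 <= E * t ^+ 10.
  apply: (pow9 _ (tmean X (a t))) => //; first by rewrite tmean_ge0.
  apply: (le_trans f7); rewrite ler_pM2l ?mulr_gt0//.
  by rewrite tail_le_tmean// ltW.
have a'9 : a' t ^+ 9 <= E * t ^+ 10 by exact: (pow9 _ m).
have s1 : B * t * L ^+ 2 <= 16 * m ^+ 2.
  have -> : B * t * L ^+ 2 = (a' t * (t * L)) ^+ 2 / (t * a t) ^+ 2.
    by rewrite /B; field; rewrite !gt_eqF.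
  rewrite ler_pdivrMr ?exprn_gt0 ?mulr_gt0//.
  have -> : 16 * m ^+ 2 * (t * a t) ^+ 2 = (2 * t * m * (2 * a t)) ^+ 2 by ring.
  have tL : 0 <= t * L by rewrite mulr_ge0// ltW.
  apply: lerXn2r; rewrite ?nnegrE; first by rewrite mulr_ge0// ltW.
    by rewrite !mulr_ge0// ltW.
  by apply: ler_pM => //; exact: ltW.
have s2 : B ^+ 5 * t ^+ 5 * L ^+ 10 <= 16 ^+ 5 * m ^+ 10.
  have -> : B ^+ 5 * t ^+ 5 * L ^+ 10 = (B * t * L ^+ 2) ^+ 5 by ring.
  have -> : 16 ^+ 5 * m ^+ 10 = (16 * m ^+ 2) ^+ 5 by ring.
  apply: lerXn2r => //; rewrite nnegrE; last by rewrite mulr_ge0// sqr_ge0.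
  by rewrite mulr_ge0 ?sqr_ge0// mulr_ge0// ltW.
have s3 : B ^+ 5 * t ^+ 5 <= 16 ^+ 5 * C * D * (a t * a' t).
  have Bt : 0 <= B ^+ 5 * t ^+ 5 by rewrite mulr_ge0 ?exprn_ge0// ltW.
  apply: (@le_trans _ _ (B ^+ 5 * t ^+ 5 * (D * (a t * L ^+ 10)))).
    by rewrite ler_peMr.
  have -> : B ^+ 5 * t ^+ 5 * (D * (a t * L ^+ 10))
      = D * a t * (B ^+ 5 * t ^+ 5 * L ^+ 10) by ring.
  apply: (@le_trans _ _ (D * a t * (16 ^+ 5 * (C * a' t)))).
    rewrite ler_pM2l ?mulr_gt0//; apply: (le_trans s2).
    by rewrite ler_pM2l// exprn_gt0.
  by rewrite le_eqVlt; apply/orP; left; apply/eqP; ring.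
have s4 : (B * t) ^+ 45 <= K * t ^+ 20.
  have -> : (B * t) ^+ 45 = (B ^+ 5 * t ^+ 5) ^+ 9.
    by rewrite -exprMn -exprM.
  apply: (@le_trans _ _ ((16 ^+ 5 * C * D * (a t * a' t)) ^+ 9)).
    apply: lerXn2r => //; rewrite nnegrE.
      by rewrite mulr_ge0 ?exprn_ge0// ltW.
    by rewrite !mulr_ge0 ?exprn_ge0// ltW.
  have CD0 : 0 < 16 ^+ 5 * C * D by rewrite !mulr_gt0// exprn_gt0.
  rewrite (exprMn 9 _ (a t * a' t)) (exprMn 9 (a t)) /K.
  set G := (16 ^+ 5 * C * D) ^+ 9.
  have -> : G * (E * E) * t ^+ 20 = G * ((E * t ^+ 10) * (E * t ^+ 10)) by ring.
  rewrite ler_pM2l; last by rewrite exprn_gt0.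
  by apply: ler_pM => //; rewrite exprn_ge0// ltW.
have s5 : B ^+ 45 * t <= K.
  have s6 : B ^+ 45 * t ^+ 25 <= K.
    have : B ^+ 45 * t ^+ 25 * t ^+ 20 <= K * t ^+ 20.
      by rewrite -mulrA -exprD -exprMn.
    by rewrite ler_pM2r// exprn_gt0.
  apply: le_trans s6; rewrite ler_wpM2l ?exprn_ge0//.
  by rewrite -[leLHS]expr1 ler_eXn2l.
rewrite leNgt; apply/negP => eB.
have : e ^+ 45 * t < B ^+ 45 * t.
  by rewrite ltr_pM2r// ltrXn2r// ?nnegrE ltW.
move=> /lt_le_trans/(_ s5); rewrite ltNge => /negP; apply.
by rewrite mulrC -ler_pdivrMr// exprn_gt0.
Unshelve. all: by end_near. Qed.

End joint_rate.

Section joint_laplace.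
Context {d} {T : measurableType d} {R : realType} (P : probability T R).
Variable X : {RV P >-> R}.
Let mX : measurable_fun setT X := measurable_funP X.

Hypothesis tail_rv : forall c : R, 0 < c ->
  tail X (c * x) / tail X x @[x --> +oo] --> c^-1.
Hypothesis tail_gt0 : forall x, 0 < tail X x.
Variables a a' : R -> R.
Hypothesis a_ge0 : forall t, 0 <= a t.
Hypothesis a'_ge0 : forall t, 0 <= a' t.
Hypothesis a_infty : a t @[t --> +oo] --> +oo.
Hypothesis a'_infty : a' t @[t --> +oo] --> +oo.
Hypothesis a_norm : t * tail X (a t) @[t --> +oo] --> (1 : R).
Hypothesis a'_norm : t / a' t * tmean X (a' t) @[t --> +oo] --> (1 : R).

Let a_gt0 : \forall t \near +oo, 0 < a t.
Proof. by move/cvgryPgt : a_infty; exact. Qed.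

Let a'_gt0 : \forall t \near +oo, 0 < a' t.
Proof. by move/cvgryPgt : a'_infty; exact. Qed.

Let A r t w : R := r * (pos_part (X w) / a t) ^+ 2.
Let B s t w : R := s * (pos_part (X w) / a' t).

Let A_ge0 r t w : 0 <= r -> 0 <= A r t w.
Proof. by move=> r0; rewrite mulr_ge0// sqr_ge0. Qed.

Let B_ge0 s t w : 0 <= s -> 0 <= B s t w.
Proof. by move=> s0; rewrite mulr_ge0// divr_ge0// pos_part_ge0. Qed.

Let mA r t : measurable_fun setT (A r t).
Proof.
apply: measurable_funM; first exact: measurable_cst.
apply: measurable_funX; apply: measurable_funM; last exact: measurable_cst.
exact: measurable_pos_part.
Qed.

Let mB s t : measurable_fun setT (B s t).
Proof.
apply: measurable_funM; first exact: measurable_cst.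
apply: measurable_funM; last exact: measurable_cst.
exact: measurable_pos_part.
Qed.

Let bA r t : 0 <= r -> bounded_mfun (fun w => 1 - expR (- A r t w)).
Proof. by move=> r0; apply: bounded_onesub_expR => // w; exact: A_ge0. Qed.

Let bB s t : 0 <= s -> bounded_mfun (fun w => 1 - expR (- B s t w)).
Proof. by move=> s0; apply: bounded_onesub_expR => // w; exact: B_ge0. Qed.

Lemma quadratic_rate (r : R) : 0 <= r ->
  t * \int[P]_w (1 - expR (- A r t w)) @[t --> +oo] --> Num.sqrt (r * pi).
Proof.
rewrite le_eqVlt => /orP[/eqP <-|r0].
  rewrite mul0r sqrtr0 (_ : (fun t => _) = fun=> 0); first exact: cvg_cst.
  apply/funext => t; rewrite (_ : Rintegral _ _ _ = 0) ?mulr0//.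
  rewrite -[RHS](mean_cst P (0 : R)); apply: eq_Rintegral => w _.
  by rewrite /A mul0r oppr0 expR0 subrr.
have s0 : 0 < Num.sqrt r by rewrite sqrtr_gt0.
rewrite sqrtrM ?(ltW r0)//.
have := @cvg_quadratic_laplace _ _ _ P X tail_rv tail_gt0
  (fun t => a t / Num.sqrt r) (Num.sqrt r) s0 _ _ _.
rewrite (_ : (fun t => _) = fun t => t * \int[P]_w (1 - expR (- A r t w))).
  apply.
  - by move=> t; rewrite divr_ge0// ltW.
  - by apply: gt0_cvgMly => //; rewrite invr_gt0.
  - move=> z z0; rewrite (_ : Num.sqrt r / z = (z / Num.sqrt r)^-1); last first.
      by rewrite invf_div.
    have zs0 : 0 < z / Num.sqrt r by rewrite divr_gt0.
    have := tail_norm tail_rv tail_gt0 a_infty a_norm zs0.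
    by under eq_fun do rewrite mulrA (mulrAC _ z).
apply/funext => t; congr (_ * _); apply: eq_Rintegral => w _.
rewrite /gauss_fun /A; congr (1 - expR (- _)).
by rewrite invf_div mulrA mulrAC exprMn sqr_sqrtr ?ltW// mulrC.
Qed.

Lemma linear_rate (s : R) : 0 <= s ->
  t * \int[P]_w (1 - expR (- B s t w)) @[t --> +oo] --> s.
Proof.
rewrite le_eqVlt => /orP[/eqP <-|s0]; last first.
  exact: (cvg_linear_laplace tail_rv tail_gt0 a'_infty a'_norm s0).
rewrite (_ : (fun t => _) = fun=> 0); first exact: cvg_cst.
apply/funext => t; rewrite (_ : Rintegral _ _ _ = 0) ?mulr0//.
rewrite -[RHS](mean_cst P (0 : R)); apply: eq_Rintegral => w _.
by rewrite /B mul0r oppr0 expR0 subrr.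
Qed.

(** A summand is of order [a t] when its square matters, and is then
    negligible on the scale [a' t]. *)
Lemma cross_rate (r s : R) : 0 <= r -> 0 <= s ->
  t * \int[P]_w ((1 - expR (- A r t w)) * (1 - expR (- B s t w))) @[t --> +oo]
    --> (0 : R).
Proof.
move=> r0 s0; apply/cvgr0Pnorm_le => e e0.
pose K := 4 / e; have K0 : 0 < K by rewrite divr_gt0.
have h1 : s * K * (a t / a' t) * (t * \int[P]_w (1 - expR (- A r t w)))
    @[t --> +oo] --> s * K * 0 * Num.sqrt (r * pi).
  apply: cvgM; last exact: quadratic_rate.
  apply: cvgM; first exact: cvg_cst.
  exact: (@a_over_a' _ _ _ P X).
rewrite mulr0 mul0r in h1.
have h2 := tail_norm tail_rv tail_gt0 a_infty a_norm K0.
have KE : K^-1 = e / 4 by rewrite /K invf_div.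
near=> t.
have a0 : 0 < a t by near: t.
have a'0 : 0 < a' t by near: t.
have t0 : 0 < t by [].
have n1 : s * K * (a t / a' t) * (t * \int[P]_w (1 - expR (- A r t w))) <= e / 2.
  by near: t; apply: (cvgr_le _ h1); lra.
have n2 : t * tail X (a t * K) <= e / 2.
  by near: t; apply: (cvgr_le _ h2); rewrite KE; lra.
have bI : bounded_mfun (fun w => \1_[set w | a t * K < X w] w : R).
  exact: bounded_gt.
have bAc : bounded_mfun (fun w => s * K * (a t / a' t) * (1 - expR (- A r t w))).
  by apply: bounded_mfunM; [exact: bounded_mfun_cst|exact: bA].
have bAB : bounded_mfun (fun w => (1 - expR (- A r t w)) * (1 - expR (- B s t w))).
  by apply: bounded_mfunM; [exact: bA|exact: bB].
rewrite ger0_norm; last first.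
  rewrite mulr_ge0 ?(ltW t0)//; apply: Rintegral_ge0 => w _.
  have /andP[? _] := onesub_expR_ge0 (A_ge0 t w r0).
  have /andP[? _] := onesub_expR_ge0 (B_ge0 t w s0).
  exact: mulr_ge0.
apply: (@le_trans _ _ (t * \int[P]_w (s * K * (a t / a' t) * (1 - expR (- A r t w))
    + \1_[set w | a t * K < X w] w))).
  rewrite ler_pM2l//; apply: le_mean => // [|w].
    exact: bounded_mfunD.
  have /andP[x0 x1] := onesub_expR_ge0 (A_ge0 t w r0).
  have /andP[y0 y1] := onesub_expR_ge0 (B_ge0 t w s0).
  rewrite indic_gt; case: ltP => XK.
    rewrite -[leLHS]add0r lerD//; last by rewrite mulr_ile1.
    by rewrite mulr_ge0// mulr_ge0 ?divr_ge0// mulr_ge0// ltW.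
  rewrite addr0 mulrC ler_wpM2r//.
  apply: (le_trans (onesub_expR_le _)).
  rewrite /B -mulrA ler_wpM2l// mulrA ler_pM2r ?invr_gt0//.
  by rewrite /pos_part ge_max mulrC XK mulr_ge0// ltW.
rewrite meanD// meanZ; last exact: bA.
rewrite -tailE mulrDr mulrCA.
by rewrite [e]splitr lerD.
Unshelve. all: by end_near. Qed.

(** One minus a product of exponentials is the sum of the single rates up to the
    cross term.  The deterministic term [k / t] carries the number of summands
    into the transform of the random sum. *)
Lemma joint_rate (r s k : R) : 0 <= r -> 0 <= s -> 0 <= k ->
  t * (1 - \int[P]_w expR (- (r * (pos_part (X w) / a t) ^+ 2
     + s * (pos_part (X w) / a' t) + k / `|t|))) @[t --> +oo]
    --> Num.sqrt (r * pi) + s + k.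
Proof.
move=> r0 s0 k0.
pose psi t := \int[P]_w expR (- (A r t w + B s t w)).
have bE t : bounded_mfun (fun w => expR (- (A r t w + B s t w))).
  apply: bounded_mfun01 => [|w].
    apply: (measurableT_comp (@measurable_expR R)); apply: measurable_funN.
    exact: measurable_funD.
  by rewrite expR_ge0 -expR0 ler_expR oppr_le0 addr_ge0 ?A_ge0 ?B_ge0.
have psi_rate : t * (1 - psi t) @[t --> +oo] --> Num.sqrt (r * pi) + s.
  rewrite -[X in _ --> X]subr0.
  rewrite (_ : (fun t => _) = fun t => t * \int[P]_w (1 - expR (- A r t w))
      + t * \int[P]_w (1 - expR (- B s t w))
      - t * \int[P]_w ((1 - expR (- A r t w)) * (1 - expR (- B s t w)))).
    apply: cvgB; last exact: cross_rate.
    by apply: cvgD; [exact: quadratic_rate|exact: linear_rate].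
  apply/funext => t; rewrite -mulrDr -mulrBr; congr (_ * _).
  rewrite -[X in X - psi t](mean_cst P) -meanB//; last exact: bounded_mfun_cst.
  rewrite -meanD; [|exact: bA|exact: bB].
  rewrite -meanB; last 2 first.
    - by apply: bounded_mfunD; [exact: bA|exact: bB].
    - by apply: bounded_mfunM; [exact: bA|exact: bB].
  by apply: eq_Rintegral => w _; rewrite opprD expRD; ring.
have inv0 : (t : R)^-1 @[t --> +oo] --> (0 : R).
  by apply/gtr0_cvgV0; [exact: nbhs_pinfty_gt|exact: cvg_id].
have ek1 : expR (- (k * t^-1)) @[t --> +oo] --> (1 : R).
  rewrite -[X in _ --> X]expR0; apply: continuous_cvg; first exact: continuous_expR.
  rewrite -oppr0; apply: cvgN; rewrite -[X in _ --> X](mulr0 k).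
  by apply: cvgM => //; exact: cvg_cst.
have ek2 : t * (1 - expR (- (k * t^-1))) @[t --> +oo] --> k.
  apply: (@squeeze_cvgr _ _ _ _ (fun t => k * expR (- (k * t^-1))) (fun=> k)).
  - near=> t; have t0 : 0 < t by [].
    apply/andP; split.
      have -> : 1 - expR (- (k * t^-1)) = (expR (k * t^-1) - 1) * expR (- (k * t^-1)).
        by rewrite mulrBl mul1r -expRD subrr expR0.
      rewrite mulrA ler_pM2r ?expR_gt0// -ler_pdivrMl// mulrC.
      by have := expR_ge1Dx (k * t^-1); lra.
    rewrite -ler_pdivlMl// mulrC; exact: onesub_expR_le.
  - by rewrite -[X in _ --> X]mulr1; apply: cvgM => //; exact: cvg_cst.
  - exact: cvg_cst.
have main : expR (- (k * t^-1)) * (t * (1 - psi t)) + t * (1 - expR (- (k * t^-1)))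
    @[t --> +oo] --> 1 * (Num.sqrt (r * pi) + s) + k.
  by apply: cvgD => //; exact: cvgM.
rewrite mul1r in main; apply: cvg_trans main; apply: near_eq_cvg.
near=> t; have t0 : 0 < t by [].
rewrite (_ : \int[P]_w _ = expR (- (k * t^-1)) * psi t); first by ring.
rewrite -meanZ//; apply: eq_Rintegral => w _.
by rewrite gtr0_norm// -expRD; congr expR; rewrite /A /B; ring.
Unshelve. all: by end_near. Qed.

End joint_laplace.

(** * Tails of Pareto type with index one *)

Section pareto_tail.
Context {d} {T : measurableType d} {R : realType} (P : probability T R).
Variable X : {RV P >-> R}.
Variable l : R -> R.
Local Notation mu := (@lebesgue_measure R).
Let mX : measurable_fun setT X := measurable_funP X.

Hypothesis X_pareto : pareto_type (distribution_function X) 1 l.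

Let l_sv : forall c : R, 0 < c -> l (c * x) / l x @[x --> +oo] --> (1 : R).
Proof. by case: X_pareto => -[]. Qed.

Let l_gt0 : \forall x \near +oo, 0 < l x.
Proof. by case: X_pareto => -[]. Qed.

Lemma tail_equiv : tail X x * x / l x @[x --> +oo] --> (1 : R).
Proof.
case: X_pareto => _; apply: cvg_trans; apply: near_eq_cvg; near=> x.
have x0 : 0 < x by [].
rewrite tail_distribution_function powRN powRr1 ?ltW//.
by rewrite invfM invrK mulrA.
Unshelve. all: by end_near. Qed.

Lemma pareto_tail_gt0 x : 0 < tail X x.
Proof.
have h : \forall y \near +oo, 0 < tail X y.
  have h1 : \forall y \near +oo, 0 < tail X y * y / l y.
    by apply: (cvgr_gt _ tail_equiv); exact: ltr01.
  near=> y; have y0 : 0 < y by [].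
  have ly : 0 < l y by near: y.
  have : 0 < tail X y * y / l y by near: y.
  by rewrite pmulr_lgt0 ?invr_gt0// pmulr_lgt0.
have [y [xy ty]] : exists y, x <= y /\ 0 < tail X y.
  near +oo_R => y; exists y; split; last by near: y.
  by near: y; exact: nbhs_pinfty_ge (num_real _).
exact: lt_le_trans ty (tail_noninc X xy).
Unshelve. all: by end_near. Qed.

Lemma pareto_tail_rv (c : R) : 0 < c ->
  tail X (c * x) / tail X x @[x --> +oo] --> c^-1.
Proof.
move=> c0.
have e1 : tail X (c * x) * (c * x) / l (c * x) @[x --> +oo] --> (1 : R).
  exact: (cvg_comp _ _ (gt0_cvgMry c0 (@cvg_id _ _)) tail_equiv).
have e2 : (tail X x * x / l x)^-1 @[x --> +oo] --> (1^-1 : R).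
  by apply: cvgV tail_equiv; exact: oner_neq0.
have e3 : tail X (c * x) * (c * x) / l (c * x) * (l (c * x) / l x)
    * (tail X x * x / l x)^-1 * c^-1 @[x --> +oo] --> 1 * 1 * 1^-1 * c^-1.
  apply: cvgM; last exact: cvg_cst.
  by apply: cvgM => //; apply: cvgM => //; exact: l_sv.
rewrite invr1 !mul1r in e3; apply: cvg_trans e3; apply: near_eq_cvg.
have lc : \forall x \near +oo, 0 < l (c * x).
  exact: (near_scale c0 l_gt0).
near=> x; have x0 : 0 < x by [].
have lx : 0 < l x by near: x.
have lcx : 0 < l (c * x) by near: x.
have tx := pareto_tail_gt0 x.
by rewrite /=; field; rewrite !gt_eqF.
Unshelve. all: by end_near. Qed.

Hypothesis X_mean : ('E_P[X] = +oo)%E.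

(** Monotone convergence: a bound on the truncated means would bound the mean
    of [X]. *)
Lemma tmean_infty : tmean X x @[x --> +oo] --> +oo.
Proof.
suff H (M : R) : exists2 x, 0 <= x & M < tmean X x.
  apply/cvgryPgt => M; have [x x0 Mx] := H M.
  apply: filterS (nbhs_pinfty_ge (num_real x)) => y xy.
  exact: lt_le_trans Mx (le_tmean X x0 xy).
apply: contrapT => /forall2NP hM.
have {}hM x : 0 <= x -> tmean X x <= M.
  by move=> x0; have [//|/negP] := hM x; rewrite -leNgt.
have mc n : measurable_fun setT (fun w => (cap n%:R (X w))%:E).
  by apply/measurable_EFinP; exact: measurable_cap.
have limc w : limn (fun n => (cap n%:R (X w))%:E) = (pos_part (X w))%:E.
  apply/cvg_lim => //; apply: cvg_near_cst; near=> n; congr EFin.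
  by apply/min_idPl; near: n; exact: nbhs_infty_ger.
have cvgc : (\int[P]_w (cap n%:R (X w))%:E)%E @[n --> \oo] -->
    (\int[P]_w (pos_part (X w))%:E)%E.
  rewrite (eq_integral (fun w => limn (fun n => (cap n%:R (X w))%:E))).
    apply: cvg_monotone_convergence => //.
    - by move=> n w _; rewrite lee_fin; have /andP[] := cap_ge0 (X w) (ler0n R n).
    - move=> w _ m n mn; rewrite lee_fin /cap le_min ge_min lexx ge_min/=.
      by rewrite ler_nat mn orbT.
  by move=> w _; rewrite limc.
have posM : (\int[P]_w (pos_part (X w))%:E <= M%:E)%E.
  rewrite -(cvg_lim _ cvgc)//; apply: lime_le; first by apply/cvg_ex; eexists; exact: cvgc.
  apply: nearW => n; apply: le_trans (_ : (tmean X n%:R)%:E <= _)%E.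
    rewrite /tmean /Rintegral fineK//; apply: integrable_fin_num => //.
    by apply: bounded_mfun_integrable; exact: bounded_cap.
  by rewrite lee_fin hM.
have : ('E_P[X] <= M%:E)%E.
  apply: le_trans posM; rewrite unlock integralE.
  apply: (@le_trans _ _ (\int[P]_w ((fun w => (X w)%:E)^\+ w))%E).
    by apply: geeDl; rewrite oppe_le0 integral_ge0.
  rewrite le_eqVlt; apply/orP; left; apply/eqP; apply: eq_integral => w _.
  by rewrite funeposE -EFin_max.
by rewrite X_mean leye_eq.
Unshelve. all: by end_near. Qed.

End pareto_tail.

Section truncated_mean_integral.
Context {d} {T : measurableType d} {R : realType} (P : probability T R).
Variable X : {RV P >-> R}.
Local Notation mu := (@lebesgue_measure R).
Let mX : measurable_fun setT X := measurable_funP X.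

Lemma measurable_tail D : measurable_fun D (tail X).
Proof.
apply: measurable_funTS.
by apply: nonincreasing_measurable => // x y *; exact: tail_noninc.
Qed.

Lemma integrable_tail x : mu.-integrable `]0, x] (EFin \o tail X).
Proof.
apply: measurable_bounded_integrable => //.
- by rewrite /= lebesgue_measure_itv/=; case: ifP => _; rewrite ?ltry.
- exact: measurable_tail.
exists 1; split; first exact: num_real.
move=> y y1 z _; rewrite /= ger0_norm ?tail_ge0//; apply: le_trans (ltW y1).
rewrite tailE -[leRHS](mean_cst P); apply: le_mean.
- exact: bounded_gt.
- exact: bounded_mfun_cst.
- by move=> w; rewrite indic_gt; case: (_ < _).
Qed.

(** The layer-cake formula with unit density. *)
Lemma tmean_integral x : 0 < x -> tmean X x = \int[mu]_(u in `]0, x]) tail X u.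
Proof.
move=> x0.
have LC := @layer_cake _ _ _ P (fun=> 1) `]0, x]%classic X.
have len b (v : R) : 0 < v ->
    (mu [set` Interval (BRight 0%R) (BSide b v)] = v%:E)%E.
  by move=> v0; rewrite lebesgue_measure_itv/= lte_fin v0 sube0.
have cut (v : R) : (\int[mu]_(y in `]0%R, x]) (1 * (y < v)%R%:R)%:E = (cap x v)%:E)%E.
  have [v0|v0] := leP v 0.
    rewrite /cap (max_idPr v0) (min_idPl (ltW x0)).
    apply: integral0_eq => y; rewrite /= in_itv/= => /andP[y0 _].
    by rewrite ltNge (le_trans v0 (ltW y0)) mulr0.
  rewrite /cap (max_idPl (ltW v0)).
  transitivity (\int[mu]_(y in `]0%R, x]) (\1_`]-oo, v[ y)%:E)%E.
    by apply: eq_integral => y _; rewrite mul1r indicE mem_setE in_itv.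
  rewrite integral_indic//.
  have [vx|vx] := leP v x.
    rewrite (_ : _ `&` _ = `]0, v[%classic).
      exact: len.
    apply/seteqP; split => y; rewrite /= !in_itv/=; first by move=> [-> /andP[->]].
    by move=> /andP[-> yv]; rewrite yv (le_trans (ltW yv)).
  rewrite (_ : _ `&` _ = `]0, x]%classic).
    exact: len.
  apply/seteqP; split => y; rewrite /= !in_itv/=; first by move=> [].
  by move=> /andP[-> yx]; rewrite yx (le_lt_trans yx).
rewrite /tmean; congr fine.
transitivity (\int[P]_w \int[mu]_(y in `]0%R, x]) (1 * (y < X w)%R%:R)%:E)%E.
  by apply: eq_integral => w _; rewrite cut.
rewrite LC//; apply: eq_integral => y _; rewrite mul1r tailE.
by congr EFin; apply: eq_Rintegral => w _; rewrite indic_gt.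
Qed.

End truncated_mean_integral.

Section integrated_slow_variation.
Context {d} {T : measurableType d} {R : realType} (P : probability T R).
Variable X : {RV P >-> R}.
Variable l : R -> R.
Local Notation mu := (@lebesgue_measure R).

Hypothesis X_pareto : pareto_type (distribution_function X) 1 l.
Hypothesis X_mean : ('E_P[X] = +oo)%E.
Hypothesis l_int : forall x : R, 0 < x ->
  mu.-integrable `]0, x] (fun u => (l u / u)%:E).

Let tail_rv := pareto_tail_rv X_pareto.
Let tail_gt0 := pareto_tail_gt0 X_pareto.

Lemma tilde_incr (x y : R) : 0 < x -> x <= y ->
  tilde l y - tilde l x = \int[mu]_(u in `]x, y]) (l u / u).
Proof.
move=> x0 xy; apply: Rintegral_itvB; first by apply: l_int; exact: lt_le_trans xy.
- by rewrite bnd_simp ltW.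
- by rewrite bnd_simp.
Qed.

Lemma tmean_incr_integral (x y : R) : 0 < x -> x <= y ->
  tmean X y - tmean X x = \int[mu]_(u in `]x, y]) tail X u.
Proof.
move=> x0 xy; rewrite !tmean_integral//; last exact: lt_le_trans xy.
apply: Rintegral_itvB; first exact: integrable_tail.
- by rewrite bnd_simp ltW.
- by rewrite bnd_simp.
Qed.

(** The integrands are equivalent at infinity and the common integral
    diverges, so the contribution of bounded intervals is irrelevant. *)
Lemma tilde_equiv : tilde l x / tmean X x @[x --> +oo] --> (1 : R).
Proof.
apply/cvgrPdist_le => e e0.
have e2 : 0 < e / 2 by rewrite divr_gt0.
have inv : (tail X x * x / l x)^-1 @[x --> +oo] --> (1 : R).
  rewrite -[X in _ --> X]invr1.
  by apply: cvgV; [exact: oner_neq0|exact: (tail_equiv X_pareto)].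
have near1 : \forall x \near +oo, `|l x / x - tail X x| <= e / 2 * tail X x.
  move/cvgrPdist_le : inv => /(_ _ e2) inv.
  near=> x; have x0 : 0 < x by [].
  have h : `|1 - (tail X x * x / l x)^-1| <= e / 2 by near: x.
  have tx : 0 < tail X x by exact: tail_gt0.
  have -> : l x / x - tail X x = - ((1 - (tail X x * x / l x)^-1) * tail X x).
    by rewrite invf_div; field; rewrite !gt_eqF.
  by rewrite normrN normrM (gtr0_norm tx) ler_pM2r.
have [x0 x00 Hx0] := near_pinfty_ge near1.
pose D := `|tilde l x0 - tmean X x0|.
have big : \forall x \near +oo, 2 * D / e <= tmean X x.
  by move/cvgryPge : (tmean_infty X_mean); exact.
near=> x.
have x0x : x0 <= x by near: x; exact: nbhs_pinfty_ge (num_real _).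
have xx : 0 < x by exact: lt_le_trans x0x.
have m0 : 0 < tmean X x by exact: tmean_gt0.
have bx : 2 * D / e <= tmean X x by near: x.
have -> : 1 - tilde l x / tmean X x = - ((tilde l x - tmean X x) / tmean X x).
  by field; rewrite gt_eqF.
rewrite normrN normrM normfV (gtr0_norm m0) ler_pdivrMr//.
have sub : `]x0, x]%classic `<=` `]0, x]%classic.
  move=> u; rewrite /= !in_itv/= => /andP[xu ->].
  by rewrite (lt_trans x00 xu).
have il : mu.-integrable `]x0, x] (EFin \o (fun u => l u / u)).
  by apply: (@integrableS _ _ _ mu `]0, x]%classic) => //; exact: l_int.
have it : mu.-integrable `]x0, x] (EFin \o tail X).
  by apply: (@integrableS _ _ _ mu `]0, x]%classic) => //; exact: integrable_tail.
have main : `|(tilde l x - tilde l x0) - (tmean X x - tmean X x0)|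
    <= e / 2 * (tmean X x - tmean X x0).
  rewrite tilde_incr// tmean_incr_integral// -RintegralB// -RintegralZl//.
  apply: le_trans (le_normr_Rintegral _ _) _ => //.
    exact: (integrableB _ il it).
  apply: le_Rintegral => //.
  - apply: (@integrable_norm _ _ _ mu `]x0, x]%classic (fun u => l u / u - tail X u)).
    exact: (integrableB _ il it).
  - exact: (integrableZl _ (e / 2) it).
  - by move=> u; rewrite /= in_itv/= => /andP[xu _]; apply: Hx0; exact: ltW.
have mx0 : 0 <= tmean X x0 by apply: tmean_ge0; exact: ltW.
have -> : tilde l x - tmean X x = (tilde l x0 - tmean X x0) +
    ((tilde l x - tilde l x0) - (tmean X x - tmean X x0)) by ring.
apply: (le_trans (ler_normD _ _)); rewrite -/D.
have De : D <= e / 2 * tmean X x.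
  by move: bx; rewrite ler_pdivrMr// mulrC; lra.
have em : 0 <= e / 2 * tmean X x0 by rewrite mulr_ge0// ltW.
apply: (le_trans (lerD De main)); rewrite mulrBr.
by move: em; set p := _ * tmean X x0; lra.
Unshelve. all: by end_near. Qed.

Lemma measurable_tilde : measurable_fun (`]0, +oo[%classic : set R) (tilde l).
Proof.
pose f u := l u / u.
have fi x : 0 < x -> mu.-integrable `]0, x] (EFin \o f) by exact: l_int.
have mono (g : R -> R) : (forall u, 0 <= g u) ->
    (forall x, 0 < x -> mu.-integrable `]0, x] (EFin \o g)) ->
    measurable_fun (`]0, +oo[%classic : set R)
      (fun x => \int[mu]_(u in `]0, x]) g u).
  move=> g0 ig; apply: nondecreasing_measurable => // x y.
  move=> xy; have [x0|x0] := leP x 0.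
    rewrite set_itv_ge ?bnd_simp -?leNgt// Rintegral_set0.
    by apply: Rintegral_ge0 => u _.
  have y0 : 0 < y by exact: lt_le_trans xy.
  apply: fine_le; [exact: integrable_fin_num (ig _ x0)|exact: integrable_fin_num (ig _ y0)|].
  apply: ge0_subset_integral => //.
  - exact: (measurable_int mu (ig _ y0)).
  - by move=> u _; rewrite lee_fin.
  - move=> u; rewrite /= !in_itv/= => /andP[-> ux].
    exact: le_trans ux xy.
apply: (@eq_measurable_fun _ _ R R _ (fun x : R =>
    \int[mu]_(u in `]0, x]) f^\+ u - \int[mu]_(u in `]0, x]) f^\- u)).
  move=> x; rewrite inE/= in_itv/= andbT => x0.
  rewrite /tilde -RintegralB//.
  - apply: eq_Rintegral => u _.
    exact: (congr1 (fun h : R -> R => h u) (funrposBneg f)).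
  - by apply: integrable_funrpos => //; exact: fi.
  - by apply: integrable_funrneg => //; exact: fi.
apply: measurable_funB.
- apply: mono => [u|x x0]; first exact: funrpos_ge0.
  by apply: integrable_funrpos => //; exact: fi.
- apply: mono => [u|x x0]; first exact: funrneg_ge0.
  by apply: integrable_funrneg => //; exact: fi.
Qed.

Lemma tilde_slowly_varying : slowly_varying (tilde l).
Proof.
split; first exact: measurable_tilde.
  have h : \forall x \near +oo, 0 < tilde l x / tmean X x.
    by apply: (cvgr_gt _ tilde_equiv); exact: ltr01.
  near=> x; have x0 : 0 < x by [].
  have : 0 < tilde l x / tmean X x by near: x.
  by rewrite pmulr_lgt0// invr_gt0; exact: tmean_gt0.
move=> c c0.
have e1 : tilde l (c * x) / tmean X (c * x) @[x --> +oo] --> (1 : R).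
  exact: (cvg_comp _ _ (gt0_cvgMry c0 (@cvg_id _ _)) tilde_equiv).
have e2 : (tilde l x / tmean X x)^-1 @[x --> +oo] --> (1^-1 : R).
  by apply: cvgV tilde_equiv; exact: oner_neq0.
have e3 : tilde l (c * x) / tmean X (c * x) * (tmean X (c * x) / tmean X x) *
    (tilde l x / tmean X x)^-1 @[x --> +oo] --> (1 * 1 * 1^-1 : R).
  apply: cvgM => //; apply: cvgM => //.
  exact: (tmean_sv tail_rv tail_gt0 c0).
rewrite invr1 !mul1r in e3; apply: cvg_trans e3; apply: near_eq_cvg.
near=> x; have x0 : 0 < x by [].
have mx : 0 < tmean X x by exact: tmean_gt0.
have mcx : 0 < tmean X (c * x) by apply: tmean_gt0 => //; exact: mulr_gt0.
rewrite invf_div (mulrA (tilde l (c * x) / _)) mulfVK ?gt_eqF//.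
by rewrite mulrA mulfVK ?gt_eqF.
Unshelve. all: by end_near. Qed.

End integrated_slow_variation.

(** * Random sums and the two statistics *)

Section limit_law.
Context {d'} {T' : measurableType d'} {R : realType} (P' : probability T' R).
Variables U Lam : {RV P' >-> R}.
Hypothesis Lam_gt0 : P' [set w | 0 < Lam w] = 1%E.
Hypothesis U_Lam_law : forall r s : R, 0 < r -> 0 <= s ->
  ('E_P'[fun w => expR (- r * U w - s * Lam w)%R]
   = 'E_P'[fun w => expR (- s * Lam w - Num.sqrt (r * pi) * Lam w)%R])%E.

Let mU : measurable_fun setT U := measurable_funP U.
Let mL : measurable_fun setT Lam := measurable_funP Lam.

Lemma probability1_ae (d1 : measure_display) (T1 : measurableType d1)
    (P1 : probability T1 R) (Y : T1 -> R) : measurable_fun setT Y ->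
  P1 [set w | 0 < Y w] = 1%E -> {ae P1, forall w, 0 < Y w}.
Proof.
move=> mY Y1.
have mA : measurable [set w | 0 < Y w].
  rewrite (_ : [set w | _] = Y @^-1` `]0, +oo[).
    by rewrite -[X in measurable X]setTI; exact: mY.
  by apply/seteqP; split => w /=; rewrite in_itv/= andbT.
exists (~` [set w | 0 < Y w]); split => //; first exact: measurableC.
by rewrite probability_setC// Y1 subee.
Qed.

(** The law of [(U, Lam)] is prescribed through exponential means with
    arbitrarily large rates, which stay bounded by 1; this forces [U] to be
    nonnegative. *)
Lemma U_ge0_ae : {ae P', forall w, 0 <= U w}.
Proof.
have Lpos := probability1_ae mL Lam_gt0.
have bnd (r : R) : 0 < r -> ('E_P'[fun w => expR (- r * U w)%R] <= 1)%E.
  move=> r0; have := U_Lam_law r0 (lexx 0).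
  rewrite (_ : (fun w => expR (- r * U w - 0 * Lam w)) = fun w => expR (- r * U w)).
    move=> ->; rewrite -(expectation_cst P' 1) unlock.
    apply: ae_ge0_le_integral => //.
    - apply/measurable_EFinP; apply: (measurableT_comp (@measurable_expR R)).
      apply: measurable_funB; apply: measurable_funM => //; exact: measurable_cst.
    - by apply/measurable_EFinP; exact: measurable_cst.
    - apply: filterS Lpos => w Lw _; rewrite lee_fin -expR0 ler_expR.
      by rewrite oppr0 mul0r sub0r oppr_le0 mulr_ge0 ?sqrtr_ge0// ltW.
  by apply/funext => w; rewrite mul0r subr0.
pose A n := [set w | U w < - n.+1%:R^-1].
have mA n : measurable (A n).
  rewrite (_ : A n = U @^-1` `]-oo, - n.+1%:R^-1[).
    by rewrite -[X in measurable X]setTI; exact: mU.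
  by apply/seteqP; split => w /=; rewrite in_itv.
have A0 n : P' (A n) = 0%E.
  set p := fine (P' (A n)).
  have pE : P' (A n) = p%:E by rewrite /p fineK// fin_num_measure.
  have p0 : 0 <= p by rewrite fine_ge0.
  have H (r : R) : 0 < r -> p * (1 + r / n.+1%:R) <= 1.
    move=> r0; rewrite -lee_fin; apply: le_trans (bnd _ r0).
    rewrite EFinM -pE muleC unlock.
    apply: (@le_trans _ _ (\int[P']_(w in A n) (1 + r / n.+1%:R)%:E)%E).
      by rewrite integral_cst.
    apply: (@le_trans _ _ (\int[P']_(w in A n) (expR (- r * U w))%:E)%E).
      apply: ge0_le_integral => //.
      - by move=> w _; rewrite lee_fin addr_ge0// divr_ge0// ltW.
      - apply/measurable_EFinP; apply: (measurableT_comp (@measurable_expR R)).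
        apply: measurable_funM; first exact: measurable_cst.
        exact: measurable_funTS.
      - move=> w Aw; rewrite lee_fin; apply: (le_trans (expR_ge1Dx _)).
        rewrite ler_expR mulNr -mulrN ler_pM2l// lerNr ltW//.
    apply: ge0_subset_integral => //.
    apply/measurable_EFinP; apply: (measurableT_comp (@measurable_expR R)).
    by apply: measurable_funM; first exact: measurable_cst.
  rewrite pE; congr EFin; apply/eqP; rewrite eq_le p0 andbT leNgt; apply/negP => pp.
  have r0 : 0 < n.+1%:R / p :> R by rewrite divr_gt0.
  have := H _ r0.
  have -> : p * (1 + n.+1%:R / p / n.+1%:R) = p + 1.
    by field; rewrite !gt_eqF// ltr_wpDr.
  lra.
have : P'.-negligible (\bigcup_n A n).
  by apply: negligible_bigcup => n; exists (A n); split => //; exact: A0.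
move=> [B [mB B0 sB]]; exists B; split => // w /= /negP; rewrite -ltNge => Uw.
apply: sB; have : 0 < - U w by rewrite oppr_gt0.
move=> /ltr_add_invr[n]; rewrite add0r => nU.
by exists n => //; rewrite /A/= ltrNr.
Qed.

(** Only positive rates of [U] are prescribed; the rate 0 is immediate, because
    the square root vanishes there. *)
Lemma limit_laplace (r s : R) : 0 <= r -> 0 <= s ->
  \int[P']_w expR (- (r * pos_part (U w) + s * pos_part (Lam w))) =
  \int[P']_w expR (- ((Num.sqrt (r * pi) + s) * pos_part (Lam w))).
Proof.
move=> r0 s0.
have mE (k1 k2 : R) (f g : T' -> R) : measurable_fun setT f ->
    measurable_fun setT g ->
    measurable_fun setT (fun w => expR (- (k1 * f w + k2 * g w))).
  move=> mf mg; apply: (measurableT_comp (@measurable_expR R)).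
  apply: measurable_funN; apply: measurable_funD; apply: measurable_funM => //;
    exact: measurable_cst.
have mpU : measurable_fun setT (fun w => pos_part (U w)) by exact: measurable_pos_part.
have mpL : measurable_fun setT (fun w => pos_part (Lam w)) by exact: measurable_pos_part.
move: r0; rewrite le_eqVlt => /orP[/eqP <-|r0].
  by apply: eq_Rintegral => w _; rewrite !mul0r sqrtr0 !add0r.
have := U_Lam_law r0 s0; rewrite unlock => /(congr1 fine) E.
have -> : \int[P']_w expR (- (r * pos_part (U w) + s * pos_part (Lam w))) =
    \int[P']_w expR (- r * U w - s * Lam w).
  apply: mean_ae_eq; first exact: mE.
    rewrite (_ : (fun w => _) = fun w => expR (- (r * U w + s * Lam w))).
      exact: mE.
    by apply/funext => w; rewrite opprD mulNr.
  apply: filterS2 U_ge0_ae (probability1_ae mL Lam_gt0) => w Uw Lw.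
  by rewrite /pos_part (max_idPl Uw) (max_idPl (ltW Lw)) opprD mulNr.
rewrite [LHS]E; apply: (@mean_ae_eq _ _ _ P').
- rewrite (_ : (fun w => _) =
      fun w => expR (- (s * Lam w + Num.sqrt (r * pi) * Lam w))).
    exact: mE.
  by apply/funext => w; rewrite opprD mulNr.
- rewrite (_ : (fun w => _) =
      fun w => expR (- (Num.sqrt (r * pi) * pos_part (Lam w) + s * pos_part (Lam w)))).
    exact: mE.
  by apply/funext => w; rewrite mulrDl.
apply: filterS (probability1_ae mL Lam_gt0) => w Lw.
by rewrite /pos_part (max_idPl (ltW Lw)); congr expR; ring.
Qed.

End limit_law.

Section sample_statistics.
Context {R : realType}.
Implicit Types (x : nat -> R) (n : nat).

Lemma sum_scale_sq x n (c : R) :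
  \sum_(i < n) (x i / c) ^+ 2 = (\sum_(i < n) x i ^+ 2) / c ^+ 2.
Proof.
by rewrite mulr_suml; apply: eq_bigr => i _; rewrite exprMn exprVn.
Qed.

(** The quotient of the two scales is the one at which numerator and denominator
    converge together. *)
Lemma C_stat_ratio x n (c c' : R) : c' / c ^+ 2 * C_stat x n =
  (\sum_(i < n) (x i / c) ^+ 2) / (\sum_(i < n) x i / c').
Proof.
rewrite /C_stat; case: ifPn => [_|]; last first.
  by rewrite -leqNgt leqn0 => /eqP ->; rewrite !big_ord0 mulr0 mul0r.
by rewrite sum_scale_sq -mulr_suml invf_div; ring.
Qed.

Lemma dispersion_C_stat x n :
  sample_dispersion x n = C_stat x n - sample_mean x n.
Proof.
rewrite /sample_dispersion /C_stat /sample_mean; case: ifPn => [n0|]; last first.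
  by rewrite -leqNgt leqn0 => /eqP ->; rewrite big_ord0 mul0r subr0.
rewrite /sample_variance /sample_mean.
set S := \sum_(i < n) x i; set Q := \sum_(i < n) x i ^+ 2.
have nz : n%:R != 0 :> R by rewrite pnatr_eq0 -lt0n.
have -> : \sum_(i < n) (x i - S / n%:R) ^+ 2 = Q - S ^+ 2 / n%:R.
  set m := S / n%:R.
  rewrite (eq_bigr (fun i : 'I_n => x i ^+ 2 - (2 * m) * x i + m ^+ 2)).
    rewrite big_split/= sumrB -mulr_sumr -/Q -/S sumr_const card_ord -mulr_natl.
    by rewrite /m; field.
  by move=> i _; ring.
have [->|S0] := eqVneq S 0; first by rewrite !mul0r invr0 !mulr0 subr0.
by field; apply/andP.
Qed.

End sample_statistics.

Section random_sums.
Context {d d'} {T : measurableType d} {T' : measurableType d'} {R : realType}.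
Context (P : probability T R) (P' : probability T' R).
Variables (X : {RV P >-> R}) (Xs : nat -> {RV P >-> R}) (N : R -> {RV P >-> nat}).
Variables (U Lam : {RV P' >-> R}) (a a' : R -> R).
Hypothesis Xs_iid : iid_copies X Xs.
Hypothesis N_indep : process_independent N Xs.
Hypothesis N_avg : D_averages_in_time N Lam.
Hypothesis U_Lam_law : forall r s : R, 0 < r -> 0 <= s ->
  ('E_P'[fun w => expR (- r * U w - s * Lam w)%R]
   = 'E_P'[fun w => expR (- s * Lam w - Num.sqrt (r * pi) * Lam w)%R])%E.
Hypothesis tail_rv : forall c : R, 0 < c ->
  tail X (c * x) / tail X x @[x --> +oo] --> c^-1.
Hypothesis tail_gt0 : forall x, 0 < tail X x.
Hypothesis a_ge0 : forall t, 0 <= a t.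
Hypothesis a'_ge0 : forall t, 0 <= a' t.
Hypothesis a_infty : a t @[t --> +oo] --> +oo.
Hypothesis a'_infty : a' t @[t --> +oo] --> +oo.
Hypothesis a_norm : t * tail X (a t) @[t --> +oo] --> (1 : R).
Hypothesis a'_norm : t / a' t * tmean X (a' t) @[t --> +oo] --> (1 : R).

Let mN t : measurable_fun setT (N t) := measurable_funP (N t).
Let mXs i : measurable_fun setT (Xs i) := measurable_funP (Xs i).
Let mL : measurable_fun setT Lam := measurable_funP Lam.
Let mpL : measurable_fun setT (fun w => pos_part (Lam w)).
Proof. exact: measurable_pos_part. Qed.
Let Lpos : {ae P', forall w, 0 < Lam w} := probability1_ae mL N_avg.1.

(** The sums are taken over positive parts and the time enters through its
    absolute value, so that the three quantities are nonnegative
    everywhere. *)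
Definition sqsum t w : R := \sum_(i < N t w) (pos_part (Xs i w) / a t) ^+ 2.

Definition linsum t w : R := \sum_(i < N t w) pos_part (Xs i w) / a' t.

Definition time_average t w : R := (N t w)%:R / `|t|.

Lemma measurable_random_sum (f : R -> R) t : measurable_fun setT f ->
  measurable_fun setT (fun w => \sum_(i < N t w) f (Xs i w)).
Proof.
move=> mf.
apply: (@measurable_random_index _ _ _ (N t)
  (fun n w => \sum_(i < n) f (Xs i w))) => // n.
elim: n => [|n IH]; first by under eq_fun do rewrite big_ord0; exact: measurable_cst.
under eq_fun do rewrite big_ord_recr/=.
by apply: measurable_funD => //; exact: (measurableT_comp mf (mXs n)).
Qed.

Lemma measurable_pos_part_id : measurable_fun setT (@pos_part R).
Proof. by apply: measurable_maxr => //; exact: measurable_cst. Qed.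

Lemma measurable_sqsum t : measurable_fun setT (sqsum t).
Proof.
apply: (measurable_random_sum (f := fun x => (pos_part x / a t) ^+ 2)).
apply: measurable_funX; apply: measurable_funM; last exact: measurable_cst.
exact: measurable_pos_part_id.
Qed.

Lemma measurable_linsum t : measurable_fun setT (linsum t).
Proof.
apply: (measurable_random_sum (f := fun x => pos_part x / a' t)).
by apply: measurable_funM; [exact: measurable_pos_part_id|exact: measurable_cst].
Qed.

Lemma measurable_time_average t : measurable_fun setT (time_average t).
Proof.
apply: measurable_funM; last exact: measurable_cst.
exact: (@measurable_random_index _ _ _ (N t) (fun n _ => n%:R)).
Qed.

Lemma sqsum_ge0 t w : 0 <= sqsum t w.
Proof. by apply: sumr_ge0 => i _; exact: sqr_ge0. Qed.

Lemma linsum_ge0 t w : 0 <= linsum t w.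
Proof. by apply: sumr_ge0 => i _; rewrite divr_ge0// pos_part_ge0. Qed.

Lemma time_average_ge0 t w : 0 <= time_average t w.
Proof. by rewrite divr_ge0. Qed.

(** Conditionally on [N t], the three normalized sums are built from
    independent identically distributed summands, so their joint Laplace
    transform is the mean of a power of a single mean. *)
Lemma cvg_joint_laplace (r s k : R) : 0 <= r -> 0 <= s -> 0 <= k ->
  \int[P]_w expR (- (r * sqsum t w + s * linsum t w + k * time_average t w))
    @[t --> +oo]
  --> \int[P']_w expR (- ((Num.sqrt (r * pi) + s + k) * pos_part (Lam w))).
Proof.
move=> r0 s0 k0.
pose g t x := expR (- (r * (pos_part x / a t) ^+ 2
     + s * (pos_part x / a' t) + k / `|t|)).
have g01 t x : 0 <= g t x <= 1.
  rewrite expR_ge0 -expR0 ler_expR oppr_le0 !addr_ge0 ?divr_ge0//.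
    by rewrite mulr_ge0// sqr_ge0.
  by rewrite mulr_ge0// divr_ge0// pos_part_ge0.
have mg t : measurable_fun setT (g t).
  apply: (measurableT_comp (@measurable_expR R)); apply: measurable_funN.
  have mp c : measurable_fun setT (fun x : R => pos_part x / c).
    by apply: measurable_funM; [exact: measurable_pos_part_id|exact: measurable_cst].
  apply: measurable_funD; last exact: measurable_cst.
  apply: measurable_funD; apply: measurable_funM => //; try exact: measurable_cst.
  exact: measurable_funX.
have prodE t w : expR (- (r * sqsum t w + s * linsum t w + k * time_average t w)) =
    \prod_(i < N t w) g t (Xs i w).
  rewrite -expR_sum; congr expR.
  rewrite sumrN !big_split/= sumr_const card_ord -!mulr_sumr; congr (- (_ + _)).
  by rewrite /time_average -[RHS]mulr_natl mulrCA.
have c0 : 0 <= Num.sqrt (r * pi) + s + k by rewrite !addr_ge0 ?sqrtr_ge0.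
pose gam t := \int[P]_w g t (X w).
have gam01 t : 0 <= gam t <= 1.
  apply: mean01 => [|w]; last exact: g01.
  apply: bounded_mfun01 => //; apply: (measurableT_comp (mg t)).
  exact: measurable_funP.
have rate : t * (1 - gam t) @[t --> +oo] --> Num.sqrt (r * pi) + s + k.
  exact: (joint_rate tail_rv tail_gt0 a_ge0 a'_ge0 a_infty a'_infty a_norm a'_norm).
have avg : cvg_mean_dist P P' +oo (fun t w => (N t w)%:R / t)
    (fun w => pos_part (Lam w)).
  move=> f cf fb.
  have := (cvg_in_distributionP P P' _ mL).1 N_avg.2 f cf fb.
  rewrite (_ : \int[P']_w f (Lam w) = \int[P']_w f (pos_part (Lam w))).
    apply => t; apply: measurable_funM; last exact: measurable_cst.
    exact: (@measurable_random_index _ _ _ (N t) (fun n _ => n%:R)).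
  have mf := continuous_measurable_fun cf.
  apply: mean_ae_eq; [exact: (measurableT_comp mf mL)|exact: (measurableT_comp mf mpL)|].
  by apply: filterS Lpos => w Lw; rewrite /pos_part (max_idPl (ltW Lw)).
have main : \int[P]_w gam t ^+ N t w @[t --> +oo]
    --> \int[P']_w expR (- ((Num.sqrt (r * pi) + s + k) * pos_part (Lam w))).
  move: c0; rewrite le_eqVlt => /orP[/eqP c0|c0]; last first.
    apply: cvg_mean_random_power => //.
    by move=> w; exact: pos_part_ge0.
  have [rp0 [s00 k00]] : Num.sqrt (r * pi) = 0 /\ s = 0 /\ k = 0.
    by have := sqrtr_ge0 (r * pi); split; [|split]; lra.
  have r00 : r = 0.
    apply/eqP; rewrite eq_le r0 andbT leNgt; apply/negP => rp.
    have : 0 < Num.sqrt (r * pi) by rewrite sqrtr_gt0 mulr_gt0 ?pi_gt0.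
    by rewrite rp0 ltxx.
  rewrite -c0; under [X in _ --> X]eq_Rintegral do rewrite mul0r oppr0 expR0.
  rewrite mean_cst (_ : (fun t => _) = fun=> 1); first exact: cvg_cst.
  apply/funext => t; rewrite (_ : gam t = 1).
    by under eq_Rintegral do rewrite expr1n; rewrite mean_cst.
  rewrite -[RHS](mean_cst P 1); apply: eq_Rintegral => w _.
  by rewrite /g r00 s00 k00 !mul0r !addr0 oppr0 expR0.
apply: cvg_trans main; apply: near_eq_cvg; near=> t.
under [RHS]eq_Rintegral do rewrite prodE.
by rewrite (mean_random_prod Xs_iid N_indep).
Unshelve. all: by end_near. Qed.

Lemma cvg_square_over_linear :
  cvg_mean_dist P P' +oo (fun t w => sqsum t w / linsum t w)
    (fun w => pos_part (U w) / pos_part (Lam w)).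
Proof.
apply: cvg_laplace_ratio.
- exact: measurable_sqsum.
- exact: measurable_linsum.
- exact: measurable_pos_part.
- exact: mpL.
- exact: sqsum_ge0.
- exact: linsum_ge0.
- by move=> w; exact: pos_part_ge0.
- by move=> w; exact: pos_part_ge0.
- by apply: filterS Lpos => w Lw; rewrite /pos_part (max_idPl (ltW Lw)).
move=> r s r0 s0; rewrite (limit_laplace N_avg.1 U_Lam_law r0 s0).
have := cvg_joint_laplace r0 s0 (lexx 0); rewrite addr0.
by under eq_fun do under eq_Rintegral do rewrite mul0r addr0.
Qed.

(** The sum of the variables on the scale [a' t] and the normalized count have
    the same limit jointly, so their ratio is tight, and even tends to 1. *)
Lemma cvg_linear_over_count :
  cvg_mean_dist P P' +oo (fun t w => linsum t w / time_average t w)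
    (fun w => pos_part (Lam w) / pos_part (Lam w)).
Proof.
apply: cvg_laplace_ratio.
- exact: measurable_linsum.
- exact: measurable_time_average.
- exact: mpL.
- exact: mpL.
- exact: linsum_ge0.
- exact: time_average_ge0.
- by move=> w; exact: pos_part_ge0.
- by move=> w; exact: pos_part_ge0.
- by apply: filterS Lpos => w Lw; rewrite /pos_part (max_idPl (ltW Lw)).
move=> r s r0 s0.
have := cvg_joint_laplace (lexx 0) r0 s0.
rewrite mul0r sqrtr0 add0r.
under [X in _ --> X -> _]eq_Rintegral do rewrite mulrDl.
by under eq_fun do under eq_Rintegral do rewrite mul0r add0r.
Qed.

End random_sums.

Section measurable_statistics.
Context {d} {T : measurableType d} {R : realType} (P : probability T R).
Variables (Xs : nat -> {RV P >-> R}) (M : {RV P >-> nat}).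

Let msum (f : R -> R) n : measurable_fun setT f ->
  measurable_fun setT (fun w => \sum_(i < n) f (Xs i w)).
Proof.
move=> mf; elim: n => [|n IH].
  by under eq_fun do rewrite big_ord0; exact: measurable_cst.
under eq_fun do rewrite big_ord_recr/=.
apply: measurable_funD => //; apply: (measurableT_comp mf).
exact: measurable_funP.
Qed.

Let mM : measurable_fun setT M := measurable_funP M.

Lemma measurable_C_stat :
  measurable_fun setT (fun w => C_stat (fun i => Xs i w) (M w)).
Proof.
apply: (@measurable_random_index _ _ _ M
  (fun n w => C_stat (fun i => Xs i w) n)) => // n.
case: n => [|n]; rewrite /C_stat /=; first exact: measurable_cst.
apply: measurable_fun_div; last exact: (msum (f := id)).
by apply: (msum (f := fun x => x ^+ 2)); exact: exprn_measurable.
Qed.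

Lemma measurable_dispersion :
  measurable_fun setT (fun w => sample_dispersion (fun i => Xs i w) (M w)).
Proof.
rewrite (_ : (fun w => _) = fun w => C_stat (fun i => Xs i w) (M w) -
    sample_mean (fun i => Xs i w) (M w)); last first.
  by apply/funext => w; rewrite dispersion_C_stat.
apply: measurable_funB; first exact: measurable_C_stat.
apply: (@measurable_random_index _ _ _ M
  (fun n w => sample_mean (fun i => Xs i w) n)) => // n.
by apply: measurable_fun_div; [exact: (msum (f := id))|exact: measurable_cst].
Qed.

End measurable_statistics.

Section norming.
Context {d} {T : measurableType d} {R : realType} (P : probability T R).
Variables (X : {RV P >-> R}) (l a a' : R -> R).
Hypothesis X_pareto : pareto_type (distribution_function X) 1 l.
Hypothesis X_mean : ('E_P[X] = +oo)%E.
Hypothesis l_int : forall x : R, 0 < x ->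
  (@lebesgue_measure R).-integrable `]0, x] (fun u => (l u / u)%:E).
Hypothesis a_infty : a t @[t --> +oo] --> +oo.
Hypothesis a_norm : t * (a t)^-1 * l (a t) @[t --> +oo] --> (1 : R).
Hypothesis a'_infty : a' t @[t --> +oo] --> +oo.
Hypothesis a'_norm : t * (a' t)^-1 * tilde l (a' t) @[t --> +oo] --> (1 : R).

Lemma cvg_norm_infty (b : R -> R) : b t @[t --> +oo] --> +oo ->
  `|b t| @[t --> +oo] --> +oo.
Proof.
move/cvgryPge => boo; apply/cvgryPge => A; apply: filterS (boo A) => t Ab.
exact: le_trans (ler_norm _).
Qed.

(** Absolute values make the norming functions nonnegative everywhere without
    changing them at large times. *)
Lemma tail_norming : t * tail X `|a t| @[t --> +oo] --> (1 : R).
Proof.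
rewrite -[X in _ --> X]mulr1.
apply: cvg_trans (cvgM a_norm (cvg_comp _ _ a_infty (tail_equiv X_pareto))).
have l0 : \forall x \near +oo, 0 < l x by case: X_pareto => -[].
have la : \forall t \near +oo, 0 < l (a t) := a_infty l0.
have a0 : \forall t \near +oo, 0 < a t by move/cvgryPgt : a_infty; exact.
apply: near_eq_cvg; near=> t.
have lat : 0 < l (a t) by near: t.
have at0 : 0 < a t by near: t.
by rewrite /= gtr0_norm//; field; rewrite !gt_eqF.
Unshelve. all: by end_near. Qed.

Lemma tmean_norming : t / `|a' t| * tmean X `|a' t| @[t --> +oo] --> (1 : R).
Proof.
rewrite -[X in _ --> X]divr1.
have te := tilde_equiv X_pareto X_mean l_int.
apply: cvg_trans (cvgM a'_norm (cvgV (oner_neq0 R) (cvg_comp _ _ a'_infty te))).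
have tl0 : \forall x \near +oo, 0 < tilde l x.
  by case: (tilde_slowly_varying X_pareto X_mean l_int).
have la : \forall t \near +oo, 0 < tilde l (a' t) := a'_infty tl0.
have a0 : \forall t \near +oo, 0 < a' t by move/cvgryPgt : a'_infty; exact.
apply: near_eq_cvg; near=> t.
have lat : 0 < tilde l (a' t) by near: t.
have at0 : 0 < a' t by near: t.
have m0 : 0 < tmean X (a' t).
  by apply: tmean_gt0 => //; exact: (pareto_tail_gt0 X_pareto).
by rewrite /= gtr0_norm//; field; rewrite !gt_eqF.
Unshelve. all: by end_near. Qed.

End norming.

Unset Implicit Arguments.

Theorem mainTheorem14 (R : realType)
  (d : measure_display) (T : measurableType d) (P : probability T R)
  (X : {RV P >-> R}) (Xs : nat -> {RV P >-> R}) (N : R -> {RV P >-> nat})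
  (d' : measure_display) (T' : measurableType d') (P' : probability T' R)
  (U Lam : {RV P' >-> R})
  (l a a' : R -> R)
  (X_pos : P [set w | 0 < X w] = 1%E)
  (Xs_iid : iid_copies X Xs)
  (N_counting : counting_process N)
  (N_indep : process_independent N Xs)
  (X_pareto : pareto_type (distribution_function X) 1 l)
  (X_mean : ('E_P[X] = +oo)%E)
  (N_avg : D_averages_in_time N Lam)
  (l_int : forall x : R, 0 < x ->
     (@lebesgue_measure R).-integrable `]0, x] (fun u => (l u / u)%:E))
  (a_infty : a t @[t --> +oo] --> +oo)
  (a_norm : t * (a t)^-1 * l (a t) @[t --> +oo] --> (1 : R))
  (a'_infty : a' t @[t --> +oo] --> +oo)
  (a'_norm : t * (a' t)^-1 * tilde l (a' t) @[t --> +oo] --> (1 : R))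
  (U_Lam_law : forall r s : R, 0 < r -> 0 <= s ->
     ('E_P'[fun w => expR (- r * U w - s * Lam w)%R]
      = 'E_P'[fun w => expR (- s * Lam w - Num.sqrt (r * pi) * Lam w)%R])%E) :
  [/\ slowly_varying (tilde l),
      cvg_in_distribution P P'
        (fun t w => a' t / a t ^+ 2 * C_stat (fun i => Xs i w) (N t w))
        (fun w => U w / Lam w)
    & cvg_in_distribution P P'
        (fun t w => a' t / a t ^+ 2
                    * sample_dispersion (fun i => Xs i w) (N t w))
        (fun w => U w / Lam w)].
Proof.
have tail_rv c := pareto_tail_rv X_pareto (c := c).
have tail_gt0 := pareto_tail_gt0 X_pareto.
have tsv := tilde_slowly_varying X_pareto X_mean l_int.
pose b t := `|a t|; pose b' t := `|a' t|.
have b0 t : 0 <= b t by exact: normr_ge0.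
have b'0 t : 0 <= b' t by exact: normr_ge0.
have boo : b t @[t --> +oo] --> +oo by exact: cvg_norm_infty.
have b'oo : b' t @[t --> +oo] --> +oo by exact: cvg_norm_infty.
have bn : t * tail X (b t) @[t --> +oo] --> (1 : R).
  exact: (tail_norming X_pareto a_infty a_norm).
have b'n : t / b' t * tmean X (b' t) @[t --> +oo] --> (1 : R).
  exact: (tmean_norming X_pareto X_mean l_int a'_infty a'_norm).
have mU : measurable_fun setT U by exact: measurable_funP.
have mLam : measurable_fun setT Lam by exact: measurable_funP.
have Lpos := probability1_ae mLam N_avg.1.
have Upos := U_ge0_ae N_avg.1 U_Lam_law.
have Xpos : {ae P, forall w i, 0 < Xs i w}.
  apply/ae_foralln => i; apply: probability1_ae; first exact: measurable_funP.
  have mI : measurable (`]0, +oo[%classic : set R) by [].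
  have E (Y : {RV P >-> R}) : [set w | 0 < Y w] = Y @^-1` `]0, +oo[.
    by apply/seteqP; split => w /=; rewrite in_itv/= andbT.
  by rewrite E; have := Xs_iid.2 i _ mI; rewrite /distribution /pushforward => ->;
    rewrite -E.
pose S t w := sqsum Xs N b t w; pose L t w := linsum Xs N b' t w.
pose M t w := time_average N t w.
have mS t : measurable_fun setT (S t) by exact: measurable_sqsum.
have mL t : measurable_fun setT (L t) by exact: measurable_linsum.
have mM t : measurable_fun setT (M t) by exact: measurable_time_average.
have mUL : measurable_fun setT (fun w => U w / Lam w) by exact: measurable_fun_div.
have mpUL : measurable_fun setT (fun w => pos_part (U w) / pos_part (Lam w)).
  by apply: measurable_fun_div; exact: measurable_pos_part.
have mC t : measurable_fun setT (fun w => C_stat (fun i => Xs i w) (N t w)).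
  exact: measurable_C_stat.
have mD t :
    measurable_fun setT (fun w => sample_dispersion (fun i => Xs i w) (N t w)).
  exact: measurable_dispersion.
have mcst t (Y : T -> R) : measurable_fun setT Y ->
    measurable_fun setT (fun w => a' t / a t ^+ 2 * Y w).
  by move=> mY; apply: measurable_funM => //; exact: measurable_cst.
(* passing between the given variables and their nonnegative versions *)
have transfer (Y Y' : R -> T -> R) :
    (forall t, measurable_fun setT (Y t)) -> (forall t, measurable_fun setT (Y' t)) ->
    (\forall t \near +oo, {ae P, forall w, Y t w = Y' t w}) ->
    cvg_mean_dist P P' +oo Y' (fun w => pos_part (U w) / pos_part (Lam w)) ->
    cvg_in_distribution P P' Y (fun w => U w / Lam w).
  move=> mY mY' YY' cY'; apply/cvg_in_distributionP => // f cf fb.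
  have mf := continuous_measurable_fun cf.
  rewrite (_ : \int[P']_w f (U w / Lam w) =
      \int[P']_w f (pos_part (U w) / pos_part (Lam w))); last first.
    apply: mean_ae_eq; [exact: (measurableT_comp mf mUL)|
      exact: (measurableT_comp mf mpUL)|].
    apply: filterS2 Upos Lpos => w Uw Lw.
    by rewrite /pos_part (max_idPl Uw) (max_idPl (ltW Lw)).
  apply: cvg_trans (cY' f cf fb); apply: near_eq_cvg; apply: filterS YY' => t YY't.
  apply: mean_ae_eq; [exact: (measurableT_comp mf (mY' t))|
    exact: (measurableT_comp mf (mY t))|].
  by apply: filterS YY't => w ->.
have a0 : \forall t \near +oo, 0 < a t by move/cvgryPgt : a_infty; exact.
have a'0 : \forall t \near +oo, 0 < a' t by move/cvgryPgt : a'_infty; exact.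
have CE : \forall t \near +oo, {ae P, forall w,
    a' t / a t ^+ 2 * C_stat (fun i => Xs i w) (N t w) = S t w / L t w}.
  near=> t.
  have at0 : 0 < a t by near: t.
  have a't0 : 0 < a' t by near: t.
  apply: filterS Xpos => w Xw; rewrite C_stat_ratio /S /L /sqsum /linsum /b /b'.
  rewrite (gtr0_norm at0) (gtr0_norm a't0).
  by congr (_ / _); apply: eq_bigr => i _; rewrite /pos_part (max_idPl (ltW (Xw i))).
have SL := cvg_square_over_linear Xs_iid N_indep N_avg U_Lam_law tail_rv tail_gt0
  b0 b'0 boo b'oo bn b'n.
have LM := cvg_linear_over_count Xs_iid N_indep N_avg tail_rv tail_gt0
  b0 b'0 boo b'oo bn b'n.
split => //.
  apply: (transfer _ (fun t w => S t w / L t w)) => //.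
  - by move=> t; exact: mcst.
  - by move=> t; exact: measurable_fun_div.
(* the dispersion is [C_stat] minus the sample mean; the latter, on the scale
   of the former, is a vanishing multiple of a tight ratio *)
have eps0 : - (b' t ^+ 2 / (t * b t ^+ 2)) @[t --> +oo] --> (0 : R).
  rewrite -oppr0; apply: cvgN; exact: (@a'_sq_over _ _ _ P X).
apply: (transfer _ (fun t w => S t w / L t w
    + (- (b' t ^+ 2 / (t * b t ^+ 2))) * (L t w / M t w))) => //.
- by move=> t; exact: mcst.
- move=> t; apply: measurable_funD; first exact: measurable_fun_div.
  by apply: measurable_funM; [exact: measurable_cst|exact: measurable_fun_div].
- near=> t.
  have t0 : 0 < t by [].
  have at0 : 0 < a t by near: t.
  have a't0 : 0 < a' t by near: t.
  have CEt : {ae P, forall w,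
    a' t / a t ^+ 2 * C_stat (fun i => Xs i w) (N t w) = S t w / L t w} by near: t.
  apply: filterS2 Xpos CEt => w Xw CEw.
  rewrite dispersion_C_stat mulrBr CEw mulNr; congr (_ - _).
  rewrite /sample_mean /L /M /linsum /time_average /b /b'.
  rewrite (gtr0_norm at0) (gtr0_norm a't0) (gtr0_norm t0) -mulr_suml.
  have -> : \sum_(i < N t w) pos_part (Xs i w) = \sum_(i < N t w) Xs i w.
    by apply: eq_bigr => i _; rewrite /pos_part (max_idPl (ltW (Xw i))).
  set Y := \sum_(i < _) _.
  have [n0|n0] := eqVneq (N t w)%:R (0 : R).
    by rewrite n0 mul0r invr0 !mulr0.
  by field; rewrite n0 !gt_eqF.
- apply: (@cvg_mean_dist_perturb _ _ _ _ _ _ _ _ _ _ (fun t w => S t w / L t w)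
    (fun t w => L t w / M t w) _ (fun w => pos_part (Lam w) / pos_part (Lam w))
    (fun t => - (b' t ^+ 2 / (t * b t ^+ 2)))) => //.
  + by move=> t; exact: measurable_fun_div.
  + by move=> t; exact: measurable_fun_div.
  + by apply: measurable_fun_div; exact: measurable_pos_part.
Unshelve. all: by end_near. Qed.
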